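(* Let $p\in(1,\infty)$, $1/p+1/q=1$, $\alpha\in(0,1]$, let $\gamma$ be the standard Gaussian measure on $\mathbb{R}^n$, and let $f\in L^p(\gamma)$. Then $V_\gamma^{p,\alpha}(f)<\infty$ if and only if $U_\gamma^{p,\alpha}(f)<\infty$. Moreover, one has $$U_\gamma^{p,\alpha}(f)\le C(q)^{1-\alpha}V_\gamma^{p,\alpha}(f),\qquad V_\gamma^{p,\alpha}(f)\le(4C(p)\alpha^{-1}+1)\,U_\gamma^{p,\alpha}(f),$$ where for $r\in[1,\infty)$ $$C(r):=\biggl((2\pi)^{-1/2}\int_{\mathbb{R}}|s|^re^{-\frac{s^2}{2}}\,ds\biggr)^{1/r}.$$
   Context: $\gamma$ has density $(2\pi)^{-n/2}\exp(-|x|^2/2)$ with respect to Lebesgue measure on $\mathbb{R}^n$; $\|\cdot\|_p$ denotes the norm of $L^p(\gamma)$ (for a vector field $\Phi$, the $L^p(\gamma)$-norm of the Euclidean norm $|\Phi|$). The Ornstein--Uhlenbeck semigroup is $T_tf(x):=\int_{\mathbb{R}^n}f(e^{-t}x+\sqrt{1-e^{-2t}}\,y)\,\gamma(dy)$, $t\ge0$. For $\Phi=(\Phi_i)\in C_0^\infty(\mathbb{R}^n,\mathbb{R}^n)$ (smooth compactly supported vector fields) set $\mathrm{div}_\gamma\Phi=\sum_{i=1}^n(\partial_{x_i}\Phi_i-x_i\Phi_i)$. $V_\gamma^{p,\alpha}(f)$ is the infimum of the numbers $C\ge0$ such that $\int_{\mathbb{R}^n}f\,\mathrm{div}_\gamma\Phi\,d\gamma\le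 C\|\Phi\|_q^\alpha\|\mathrm{div}_\gamma\Phi\|_q^{1-\alpha}$ for all $\Phi\in C_0^\infty(\mathbb{R}^n,\mathbb{R}^n)$ (infimum of the empty set is $+\infty$; $0^0=1$). $U_\gamma^{p,\alpha}(f):=\sup_{t>0}t^{\frac{1-\alpha}{2}}\|\nabla T_tf\|_p$. (For $p>1$, $f\in L^p(\gamma)$ and $t>0$ it is known that $T_tf$ belongs to the Gaussian Sobolev class $W^{p,1}(\gamma)$ of functions in $L^p(\gamma)$ with generalized gradient in $L^p(\gamma)$.) *)

(* Defs.v *)
From HB Require Import structures.
From mathcomp Require Import all_boot all_order all_algebra.
From mathcomp Require Import all_classical all_reals all_analysis.
From mathcomp Require Import measurable_realfun.

Set Implicit Arguments.
Unset Strict Implicit.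
Unset Printing Implicit Defensive.

Import Order.TTheory GRing.Theory Num.Theory.
Import numFieldNormedType.Exports.

Local Open Scope classical_set_scope.
Local Open Scope ring_scope.

Definition rV_display : measure_display.
Proof. exact: default_measure_display. Qed.

(* The sigma-algebra on R^n generated by the coordinate maps, i.e. the product
   of the Borel sigma-algebras of R, which is the Borel sigma-algebra of R^n. *)
Section rV_measurable.
Context {R : realType} {n : nat}.

Let coor : 'I_n -> 'rV[R]_n -> R := fun i x => x ord0 i.

Let rV_set0 : g_sigma_preimage coor set0.
Proof. exact: sigma_algebra0. Qed.

Let rV_setC A : g_sigma_preimage coor A -> g_sigma_preimage coor (~` A).
Proof. exact: sigma_algebraC. Qed.

Let rV_bigcup (F : (set 'rV[R]_n)^nat) : (forall i, g_sigma_preimage coor (F i)) ->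
  g_sigma_preimage coor (\bigcup_i (F i)).
Proof. exact: sigma_algebra_bigcup. Qed.

HB.instance Definition _ := @isMeasurable.Build rV_display
  'rV[R]_n (g_sigma_preimage coor) rV_set0 rV_setC rV_bigcup.

Lemma measurable_coor (i : 'I_n) :
  measurable_fun [set: 'rV[R]_n] (fun x : 'rV[R]_n => x ord0 i).
Proof.
move=> _ Y mY; rewrite setTI; apply: sub_sigma_algebra => /=.
rewrite -bigcup_seq/=; exists i => /=; first by rewrite mem_index_enum.
by exists Y => //; rewrite setTI.
Qed.

Lemma measurable_fun_rVP d (T : measurableType d) (f : T -> 'rV[R]_n) :
  (forall i, measurable_fun [set: T] (fun t => f t ord0 i)) ->
  measurable_fun [set: T] f.
Proof.
move=> mf _ Y mY; rewrite setTI.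
suff : g_sigma_preimage (fun i => coor i \o f) `<=` measurable.
  apply; rewrite g_sigma_preimage_comp; exists Y => //; exact: setTI.
apply: smallest_sub; first exact: sigma_algebra_measurable.
rewrite -bigcup_seq/=; apply: bigcup_sub => i _ A [B mB <-].
exact: mf.
Qed.

End rV_measurable.

Section lebesgue_rV.
Context {R : realType}.
Local Open Scope ereal_scope.

Definition rV_cons n (z : R * 'rV[R]_n) : 'rV[R]_n.+1 :=
  \row_i (if unlift ord0 i is Some j then z.2 ord0 j else z.1).

Lemma measurable_rV_cons n : measurable_fun setT (@rV_cons n).
Proof.
apply: measurable_fun_rVP => i.
under eq_fun do rewrite mxE.
case: unliftP => [j _|_]; last exact: measurable_fst.
apply: (@measurableT_comp _ _ _ _ _ _ (fun x : 'rV[R]_n => x ord0 j)) => //.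
exact: measurable_coor.
Qed.

Section step.
Variables (n : nat) (mu : {sigma_finite_measure set 'rV[R]_n -> \bar R}).

Definition lebesgue_rV_step : set 'rV[R]_n.+1 -> \bar R :=
  pushforward ((@lebesgue_measure R) \x mu) (@rV_cons n).

Let step0 : lebesgue_rV_step set0 = 0.
Proof. by rewrite /lebesgue_rV_step /pushforward preimage_set0 measure0. Qed.

Let step_ge0 A : 0 <= lebesgue_rV_step A.
Proof. by rewrite /lebesgue_rV_step /pushforward; exact: measure_ge0. Qed.

Let step_sigma_additive : semi_sigma_additive lebesgue_rV_step.
Proof.
rewrite /lebesgue_rV_step => F mF tF mUF; rewrite /pushforward preimage_bigcup.
apply: measure_semi_sigma_additive.
- by move=> k; rewrite -[X in measurable X]setTI; exact: measurable_rV_cons.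
- apply/trivIsetP => /= i j _ _ ij; rewrite -preimage_setI.
  by move/trivIsetP : tF => /(_ _ _ _ _ ij) ->//; rewrite preimage_set0.
- rewrite -preimage_bigcup -[X in measurable X]setTI.
  exact: measurable_rV_cons.
Qed.

HB.instance Definition _ := isMeasure.Build _ _ _ lebesgue_rV_step
  step0 step_ge0 step_sigma_additive.

Let step_sigma_finite : sigma_finite setT lebesgue_rV_step.
Proof.
have /sigma_finiteP[F [FT ndF mF]] := sigma_finiteT (@lebesgue_measure R).
have /sigma_finiteP[G [GT ndG mG]] := sigma_finiteT mu.
pose g (v : 'rV[R]_n.+1) : R * 'rV[R]_n :=
  (v ord0 ord0, \row_j v ord0 (lift ord0 j)).
have gK z : g (rV_cons z) = z.
  case: z => a v; rewrite /g mxE unlift_none; congr pair.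
  by apply/rowP => j; rewrite !mxE liftK.
have mg : measurable_fun setT g.
  apply: measurable_fun_pair; first exact: measurable_coor.
  apply: measurable_fun_rVP => i.
  under eq_fun do rewrite mxE.
  exact: measurable_coor.
exists (fun k => g @^-1` (F k `*` G k)).
  rewrite -preimage_bigcup; apply/esym; rewrite -subTset => v _.
  have [i _ Fi] : (\bigcup_i F i) (g v).1 by rewrite -FT.
  have [j _ Gj] : (\bigcup_i G i) (g v).2 by rewrite -GT.
  exists (maxn i j) => //; split.
  - by move: Fi; exact/subsetPset/ndF/leq_maxl.
  - by move: Gj; exact/subsetPset/ndG/leq_maxr.
move=> k; have [mFk Fk] := mF k; have [mGk Gk] := mG k; split.
  by rewrite -[X in measurable X]setTI; apply: mg => //; exact: measurableX.
rewrite /lebesgue_rV_step /pushforward -comp_preimage.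
rewrite (_ : g \o _ = id) ?preimage_id; last by apply/funext => z; exact: gK.
by rewrite product_measure1E// lte_mul_pinfty// ge0_fin_numE.
Qed.

HB.instance Definition _ := Measure_isSigmaFinite.Build _ _ _ lebesgue_rV_step
  step_sigma_finite.

End step.

(* Lebesgue measure on R^n.+1 is the product of Lebesgue measures on R and R^n,
   transported along R * R^n -> R^n.+1. *)
Fixpoint lebesgue_rV n : {sigma_finite_measure set 'rV[R]_n -> \bar R} :=
  if n is m.+1 then lebesgue_rV_step (lebesgue_rV m) else \d_(0%R : 'rV[R]_0).

End lebesgue_rV.
Arguments lebesgue_rV R n : clear implicits.

Section gauss_rV.
Context {R : realType} {n : nat}.
Implicit Types x : 'rV[R]_n.

(* The Euclidean norm; the norm `|x| of the library is the maximum norm. *)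
Definition enorm x : R := Num.sqrt (\sum_(i < n) x ord0 i ^+ 2).

Definition gauss_rV_pdf x : R :=
  (2 * pi) `^ (- (n%:R / 2)) * expR (- (enorm x ^+ 2 / 2)).

Lemma measurable_enorm : measurable_fun setT enorm.
Proof.
apply: (@measurableT_comp _ _ _ _ _ _ (@Num.sqrt R)).
  by apply: continuous_measurable_fun; exact: sqrt_continuous.
by apply: measurable_sum => i; apply: measurable_funX; exact: measurable_coor.
Qed.

Lemma measurable_gauss_rV_pdf : measurable_fun setT gauss_rV_pdf.
Proof.
apply: measurable_funM => //; apply: measurableT_comp => //.
apply: measurableT_comp => //; apply: measurable_funM => //.
by apply: measurable_funX; exact: measurable_enorm.
Qed.

Lemma gauss_rV_pdf_ge0 x : 0 <= gauss_rV_pdf x.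
Proof. by rewrite mulr_ge0 ?powR_ge0 ?expR_ge0. Qed.

Local Open Scope ereal_scope.

Definition gauss_rV (A : set 'rV[R]_n) : \bar R :=
  \int[lebesgue_rV R n]_(x in A) (gauss_rV_pdf x)%:E.

Let gauss_rV0 : gauss_rV set0 = 0.
Proof. exact: integral_set0. Qed.

Let gauss_rV_ge0 A : 0 <= gauss_rV A.
Proof. by apply: integral_ge0 => x _; rewrite lee_fin gauss_rV_pdf_ge0. Qed.

Let gauss_rV_sigma_additive : semi_sigma_additive gauss_rV.
Proof.
move=> F mF tF mUF; rewrite /gauss_rV ge0_integral_bigcup//.
- apply: is_cvg_ereal_nneg_natsum_cond => k _ _.
  by apply: integral_ge0 => x _; rewrite lee_fin gauss_rV_pdf_ge0.
- by apply/measurable_EFinP; apply: measurable_funS measurable_gauss_rV_pdf.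
- by move=> x _; rewrite lee_fin gauss_rV_pdf_ge0.
Qed.

HB.instance Definition _ := isMeasure.Build _ _ _ gauss_rV
  gauss_rV0 gauss_rV_ge0 gauss_rV_sigma_additive.

End gauss_rV.
Arguments gauss_rV R n : clear implicits.

Section calculus.
Context {R : realType} {n : nat}.
Implicit Types (f u phi : 'rV[R]_n -> R) (Phi G : 'rV[R]_n -> 'rV[R]_n).

Definition partial (i : 'I_n) f : 'rV[R]_n -> R :=
  fun x => 'D_(delta_mx ord0 i) f x.

(* Partial derivative of order |s|, along the coordinates listed in s. *)
Definition iter_partial (s : seq 'I_n) f : 'rV[R]_n -> R := foldr partial f s.

Definition smooth f : Prop := forall s : seq 'I_n,
  continuous (iter_partial s f) /\
  forall i x, derivable (iter_partial s f) x (delta_mx ord0 i).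

Definition test_function phi : Prop :=
  smooth phi /\ compact (closure [set x | phi x != 0]).

Definition component (i : 'I_n) Phi : 'rV[R]_n -> R := fun x => Phi x ord0 i.

Definition test_field Phi : Prop :=
  (forall i, smooth (component i Phi)) /\ compact (closure [set x | Phi x != 0]).

Definition div_gauss Phi : 'rV[R]_n -> R := fun x =>
  \sum_(i < n) (partial i (component i Phi) x - x ord0 i * Phi x ord0 i).

Definition loc_integrable u : Prop := forall K : set 'rV[R]_n,
  compact K -> (lebesgue_rV R n).-integrable K (EFin \o u).

(* Distributional gradient on R^n, with respect to Lebesgue measure. *)
Definition generalized_gradient u G : Prop :=
  [/\ loc_integrable u, (forall i, loc_integrable (component i G)) &
      forall i phi, test_function phi ->
        \int[lebesgue_rV R n]_x (u x * partial i phi x) =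
        - \int[lebesgue_rV R n]_x (G x ord0 i * phi x)].

Local Open Scope ereal_scope.

Definition Lnorm_field (p : R) Phi : \bar R :=
  'N[gauss_rV R n]_p%:E[EFin \o (enorm \o Phi)].

(* The generalized gradient of u is unique up to null sets when it exists, so
   the infimum is over at most one number; it is +oo if u has none. *)
Definition Lnorm_gradient (p : R) u : \bar R :=
  ereal_inf [set Lnorm_field p G | G in generalized_gradient u].

Definition OU (t : R) f : 'rV[R]_n -> R := fun x =>
  (\int[gauss_rV R n]_y
     f (expR (- t) *: x + Num.sqrt (1 - expR (- (2 * t))) *: y))%R.

Definition Ugauss (p alpha : R) f : \bar R :=
  ereal_sup [set (t `^ ((1 - alpha) / 2))%:E * Lnorm_gradient p (OU t f)
            | t in [set t : R | (0 < t)%R]].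

(* V_gamma^{p, alpha}(f), which depends on p only through the conjugate
   exponent q. *)
Definition Vgauss (q alpha : R) f : \bar R :=
  ereal_inf [set C%:E | C in [set C : R | (0 <= C)%R /\
    forall Phi, test_field Phi ->
      \int[gauss_rV R n]_x (f x * div_gauss Phi x)%:E <=
      C%:E * (Lnorm_field q Phi `^ alpha *
              'N[gauss_rV R n]_q%:E[EFin \o div_gauss Phi] `^ (1 - alpha))]].

End calculus.

Definition gauss_moment {R : realType} (r : R) : R :=
  ((2 * pi) `^ (- 2^-1) *
   \int[lebesgue_measure]_s (`|s| `^ r * expR (- (s ^+ 2 / 2)))) `^ r^-1.

(* Main.v *)
(* Both bounds rest on the rotation invariance of the product of two Gaussian
   measures, T_t f(x) being the mean over y of f(cx + sy) with c = e^-t and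
   c^2 + s^2 = 1.

   Upper bound on U. Integrating by parts in y, the gradient of T_t f is
   (c/s) times the mean of y f(cx + sy). Its pairing with a bounded field Phi of
   bounded support is, up to sign, the pairing of f with the divergence of the
   field Psi(x) = c * (mean over y of Phi(cx - sy)). Cameron-Martin exhibits Psi as
   a Gaussian factor times a Laplace transform, so Psi is smooth, and cutting it
   off makes the inequality defining V applicable. Now |Psi|_q <= |Phi|_q, and by
   rotation |div Psi|_q <= (c/s) C(q) |Phi|_q with c/s < t^(-1/2), so the bound
   follows by duality between L^p and L^q.

   Upper bound on V. For a test function phi, differentiating
   theta |-> mean of h(x) phi(cos theta x - sin theta y) and integrating by parts
   leaves the mean of <y, grad h(x)> phi(cos theta x - sin theta y), at most
   C(p) |grad h|_p |phi|_q. With h = T_u f, phi = div Phi, cos theta = e^(-3u) and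
   theta <= sqrt(6u), the integrals I(u) of T_u f * phi satisfy
   |I(u) - I(4u)| <= sqrt 6 C(p) U |phi|_q u^(alpha/2). Summing over u = t / 4^k,
   adding the trivial bound |I(t)| <= U t^(-(1-alpha)/2) |Phi|_q, and taking
   t = (|Phi|_q / |phi|_q)^2 gives the claim, as sqrt 6 / (2^alpha - 1) <= 4 / alpha. *)
From HB Require Import structures.
From mathcomp Require Import all_boot all_order all_algebra.
From mathcomp Require Import all_classical all_reals all_analysis.
From mathcomp Require Import measurable_realfun ring lra.
Require Import Defs.

Set Implicit Arguments.
Unset Strict Implicit.
Unset Printing Implicit Defensive.

Import Order.TTheory GRing.Theory Num.Theory.
Import numFieldNormedType.Exports.

Local Open Scope classical_set_scope.
Local Open Scope ring_scope.

(** * Smooth functions on row vectors *)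

Section rV_topology.
Context {R : realType} {n : nat}.
Implicit Types (x y : 'rV[R]_n) (A : set 'rV[R]_n).

(** The test fields are smooth with compact support, whereas the field that is extremal for the L^p
    norm of a gradient is only measurable. It is not approximated: the adjoint of T_t smooths any
    bounded measurable field of bounded support, and only a cutoff remains to be removed, whose
    error is absorbed because c/s < t^(-1/2) is strict. In the other direction f and T_u f are never
    differentiated classically. The derivative of the rotated pairing falls on phi and is removed by
    parts, in y by the Gaussian formula, in x by the definition of the weak gradient. The rotation
    starts from T_u f because its gradient is controlled by U; adding the time 3u leads to T_4u f,
    hence cos theta = e^(-3u), and cos theta <= e^(-theta^2/2) gives theta <= sqrt(6u). The steps at
    u = t/4^k, k >= 1, form a geometric series of ratio 2^(-alpha), of sum at most 1/(alpha ln 2)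
    because 1 + x <= e^x; the constant 4 bounds sqrt 6 / ln 2. The limit, the pairing of f itself
    with phi, is reached because the rotated pairing is differentiable, hence continuous, at angle
    0. *)

Lemma ler_coor_norm x i : `|x ord0 i| <= `|x|.
Proof.
rewrite [leRHS]/Num.norm /= mx_normrE.
by apply/bigmax_geP; right => /=; exists (ord0, i).
Qed.

Lemma ler_rV_norm x (M : R) : 0 <= M -> (forall i, `|x ord0 i| <= M) -> `|x| <= M.
Proof.
move=> M0 xM; rewrite [leLHS]/Num.norm /= mx_normrE.
by apply/bigmax_leP; split => //= -[i j] _ /=; rewrite (ord1 i).
Qed.

Lemma ltr_rV_norm x (M : R) : 0 < M -> (forall i, `|x ord0 i| < M) -> `|x| < M.
Proof.
move=> M0 xM; rewrite [ltLHS]/Num.norm /= mx_normrE.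
by apply/bigmax_ltP; split => //= -[i j] _ /=; rewrite (ord1 i).
Qed.

(** The library norm is the maximum norm, so a ball is a finite intersection of coordinate slabs.
    This links the sigma-algebra generated by the coordinates to the topology. *)
Lemma measurable_rV_ball x (e : R) : measurable [set y : 'rV[R]_n | `|x - y| < e].
Proof.
have [e0|e0] := leP e 0.
  rewrite (_ : [set _ | _] = set0) //; apply/seteqP; split => // y /=.
  by rewrite ltNge (le_trans e0).
rewrite (_ : [set _ | _] =
  \big[setI/setT]_(i < n) [set y : 'rV[R]_n | `|x ord0 i - y ord0 i| < e]).
  apply: bigsetI_measurable => i _.
  have m : measurable_fun setT (fun y : 'rV[R]_n => `|x ord0 i - y ord0 i|).
    apply: measurableT_comp => //; apply: measurable_funB => //.
    exact: measurable_coor.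
  have := m measurableT `]-oo, e[%classic (measurable_itv _).
  by rewrite setTI; congr (measurable _).
rewrite -bigcap_seq; apply/seteqP; split => y /=.
- move=> xye i _ /=; apply: le_lt_trans xye.
  by have := ler_coor_norm (x - y) i; rewrite !mxE.
- move=> xye; apply: ltr_rV_norm => // i.
  by have := xye i; rewrite /= !mxE mem_index_enum; apply.
Qed.

(** An open set is the union of the balls with rational centre and radius 1/(k+1) that it contains,
    and there are countably many of them. *)
Lemma open_measurable_rV A : open A -> measurable A.
Proof.
move=> oA.
pose B (qk : 'rV[rat]_n * nat) :=
  [set y : 'rV[R]_n | `|map_mx ratr qk.1 - y| < qk.2.+1%:R^-1].
rewrite (_ : A = \bigcup_(qk in [set qk | B qk `<=` A]) B qk).
  rewrite bigcup_mkcond; apply: countable_bigcupT_measurable => //.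
  move=> qk; case: ifPn => // _; exact: measurable_rV_ball.
apply/seteqP; split => [x Ax|x [qk /= BA]]; last exact: BA.
have /nbhs_ballP[e /= e0 xeA] : nbhs x A by exact: open_nbhs_nbhs.
have [k ke] : exists k, k.+1%:R^-1 < e / 2.
  by have := near_infty_natSinv_lt (PosNum (divr_gt0 e0 (ltr0n _ 2))) => -[k _ /(_ k (leqnn _))] /= ?; exists k.
have k0 : 0 < k.+1%:R^-1 :> R by rewrite invr_gt0.
have /choice[q qP] : forall i, exists q : rat, `|x ord0 i - ratr q| < k.+1%:R^-1.
  move=> i; have : x ord0 i - k.+1%:R^-1 < x ord0 i + k.+1%:R^-1.
    by rewrite ltrBlDr -addrA ltrDl addr_gt0.
  move=> /rat_in_itvoo[q].
  rewrite in_itv/= => /andP[q1 q2]; exists q.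
  by rewrite distrC ltr_distl q1 q2.
have Bx : B (\row_i q i, k) x.
  by apply: ltr_rV_norm => // i; rewrite !mxE distrC.
exists (\row_i q i, k) => //= y By; apply: xeA.
rewrite mx_norm_ball /ball_ /=.
rewrite (_ : x - y = (map_mx ratr (\row_i q i) - y) - (map_mx ratr (\row_i q i) - x)).
  rewrite (le_lt_trans (ler_normB _ _))// (splitr e) ltrD//.
  - exact: lt_trans By ke.
  - exact: lt_trans Bx ke.
by rewrite opprB [RHS]addrC subrKA.
Qed.

Lemma closed_measurable_rV A : closed A -> measurable A.
Proof. by move/closed_openC/open_measurable_rV/measurableC; rewrite setCK. Qed.

Lemma compact_measurable_rV A : compact A -> measurable A.
Proof.
move/compact_closed => /(_ (@norm_hausdorff _ _)); exact: closed_measurable_rV.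
Qed.

Lemma continuous_measurable_rV (f : 'rV[R]_n -> R) :
  continuous f -> measurable_fun setT f.
Proof.
move=> /continuousP cf; apply: (measurability _ (RGenOpens.measurableE R)).
move=> _ [_ [a [b ->] <-]]; rewrite setTI; apply: open_measurable_rV.
exact/cf/interval_open.
Qed.

Definition bounded_support (f : 'rV[R]_n -> R) :=
  exists M : R, forall x, f x != 0 -> `|x| <= M.

(** The codomain is any [eqType] with a base point, so that scalar test functions and vector fields
    are both covered. *)
Lemma compact_support_bounded (T : eqType) (z : T) (f : 'rV[R]_n -> T) :
  compact (closure [set x | f x != z]) <->
  exists M : R, forall x, f x != z -> `|x| <= M.
Proof.
split => [/compact_bounded[M [_ Mf]]|[M Mf]].
  exists (M + 1) => x fx; apply: (Mf (M + 1)); first by rewrite ltrDl.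
  exact: subset_closure.
apply: bounded_closed_compact; last exact: closed_closure.
have cM : closed [set x : 'rV[R]_n | `|x| <= M].
  rewrite (_ : [set _ | _] = Num.norm @^-1` [set r | r <= M])//.
  by apply: closed_comp => [x _|]; [exact: norm_continuous|exact: closed_le].
exists M; split; first exact: num_real.
move=> N /ltW MN x; rewrite closureEbigcap => fx.
by apply: le_trans MN; exact: (fx [set x : 'rV[R]_n | `|x| <= M]).
Qed.

End rV_topology.

Section line.
Context {R : realType} {V W : normedModType R}.
Implicit Types (f : V -> W).

Let line_quotient f x v (t : R) :
  (fun h : R => h^-1 *: (((fun s : R => f (x + s *: v)) \o shift t) (h *: 1) - f (x + t *: v)))
  = (fun h : R => h^-1 *: ((f \o shift (x + t *: v)) (h *: v) - f (x + t *: v))).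
Proof.
apply/funext => h /=; congr (_ *: (f _ - _)).
by rewrite scalerDl addrCA; congr (_ *: _ + _); exact: mulr1.
Qed.

Lemma derivable_line f x v (t : R) :
  derivable f (x + t *: v) v -> derivable (fun s : R => f (x + s *: v)) t 1.
Proof. by rewrite /derivable line_quotient. Qed.

Lemma derive_line f x v (t : R) :
  'D_1 (fun s : R => f (x + s *: v)) t = 'D_v f (x + t *: v).
Proof. by rewrite /derive line_quotient. Qed.

End line.

Section partial_calculus.
Context {R : realType} {n : nat}.
Implicit Types (x y h : 'rV[R]_n) (f g : 'rV[R]_n -> R).

Let e_ (i : 'I_n) : 'rV[R]_n := delta_mx ord0 i.

Lemma is_derive_line f i x (t : R) : (forall y, derivable f y (e_ i)) ->
  is_derive t 1 (fun s : R => f (x + s *: e_ i)) (partial i f (x + t *: e_ i)).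
Proof.
move=> df; apply: DeriveDef; first exact: derivable_line.
by rewrite derive_line.
Qed.

Lemma partial_MVT f i x (t : R) : (forall y, derivable f y (e_ i)) ->
  exists2 s : R, `|s| <= `|t| &
    f (x + t *: e_ i) - f x = t * partial i f (x + s *: e_ i).
Proof.
move=> df; pose F s := f (x + s *: e_ i).
have dF (s : R) : is_derive s 1 F (partial i f (x + s *: e_ i)) by exact: is_derive_line.
have cF : continuous F.
  by move=> s; apply: differentiable_continuous; apply/derivable1_diffP.
have F0 : F 0 = f x by rewrite /F scale0r addr0.
have [t0|t0|->] := ltgtP t 0.
- have [s] := MVT t0 (fun s _ => dF s) (continuous_subspaceT cF).
  rewrite in_itv/= => /andP[ts s0] Fst; exists s.
    by rewrite !ltr0_norm// lerN2 ltW.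
  by rewrite -F0 -[LHS]opprB Fst sub0r mulrN opprK mulrC.
- have [s] := MVT t0 (fun s _ => dF s) (continuous_subspaceT cF).
  rewrite in_itv/= => /andP[s0 st] Fst; exists s.
    by rewrite !gtr0_norm// ltW.
  by rewrite -F0 Fst subr0 mulrC.
- by exists 0; rewrite // scale0r addr0 subrr mul0r.
Qed.

(** The increment telescopes along the coordinate axes, with one mean value theorem per axis. Since
    [smooth] only speaks of partial derivatives, this takes the place of differentiability. *)
Lemma rV_MVT f x h : (forall i y, derivable f y (e_ i)) ->
  exists2 xi : 'I_n -> 'rV[R]_n, (forall i, `|xi i - x| <= `|h|) &
    f (x + h) - f x = \sum_(i < n) h ord0 i * partial i f (xi i).
Proof.
move=> df.
pose u k : 'rV[R]_n := \row_i (if (i < k)%N then h ord0 i else 0).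
have uS (i : 'I_n) : u i.+1 = u i + h ord0 i *: e_ i.
  apply/rowP => j; rewrite !mxE eqxx/=; have [->|ji] := eqVneq j i.
    by rewrite ltnSn ltnn mulr1 add0r.
  by rewrite ltnS leq_eqVlt (inj_eq val_inj) (negbTE ji)/= mulr0 addr0.
have /choice[s sP] : forall i : 'I_n, exists s : R, `|s| <= `|h ord0 i| /\
    f (x + u i.+1) - f (x + u i) =
    h ord0 i * partial i f (x + u i + s *: e_ i).
  move=> i; have [s sh fs] := partial_MVT (x + u i) (h ord0 i) (df i).
  by exists s; split=> //; rewrite -fs uS addrA.
exists (fun i : 'I_n => x + u i + s i *: e_ i).
  move=> i; rewrite -(addrA x) [x + _]addrC addrK; apply: ler_rV_norm => // j.
  rewrite !mxE eqxx/=; have [->|ji] := eqVneq j i.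
    rewrite ltnn add0r mulr1; apply: le_trans (proj1 (sP i)) _.
    exact: ler_coor_norm.
  by rewrite mulr0 addr0; case: ifP; rewrite ?normr0// ler_coor_norm.
under eq_bigr do rewrite -(proj2 (sP _)).
rewrite -(big_mkord xpredT (fun i => f (x + u i.+1) - f (x + u i))).
rewrite telescope_sumr//; congr (f _ - f _).
- by congr (_ + _); apply/rowP => j; rewrite mxE ltn_ord.
- by rewrite (_ : u 0%N = 0) ?addr0//; apply/rowP => j; rewrite !mxE.
Qed.

(** Meant for functions whose partial derivatives are known to be bounded before they are known to
    be continuous, such as Laplace transforms. *)
Lemma continuous_partial_locally_bounded f :
  (forall i y, derivable f y (e_ i)) ->
  (forall x, exists M : R, forall i y, `|y - x| <= 1 -> `|partial i f y| <= M) ->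
  continuous f.
Proof.
move=> df bf x; have [M Mf] := bf x.
apply/(@cvgrPdist_le _ R^o _ (nbhs (x : 'rV[R]_n))) => e e0.
pose K := n%:R * `|M| + 1.
have K0 : 0 < K by rewrite ltr_wpDl// mulr_ge0.
near=> y.
have yx1 : `|y - x| <= 1.
  by near: y; apply: cvgr_distC_le => //; exact: cvg_id.
have yxe : `|y - x| <= e / K.
  by near: y; apply: cvgr_distC_le; [exact: cvg_id|rewrite divr_gt0].
have [xi xiP] := rV_MVT x (y - x) df; rewrite [x + _]addrC subrK distrC => ->.
rewrite (le_trans (ler_norm_sum _ _ _))//.
rewrite (@le_trans _ _ (\sum_(i < n) e / K * `|M|))//.
  apply: ler_sum => i _; rewrite normrM ler_pM//.
    exact: le_trans (ler_coor_norm _ _) yxe.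
  by rewrite (le_trans (Mf _ _ (le_trans (xiP i) yx1)))// ler_norm.
rewrite sumr_const card_ord -mulr_natr -mulrA mulrAC ler_pdivrMr//.
by rewrite ler_pM2l// /K mulrC lerDl.
Unshelve. all: by end_near. Qed.

(** The increment along the curve is expanded by [rV_MVT]; its intermediate points are no farther
    from [c t] than the moved point, hence converge to [c t], and continuity of the partial
    derivatives concludes. *)
Lemma is_derive_curve f (c : R -> 'rV[R]_n) (c' : 'rV[R]_n) (t : R) :
  (forall i y, derivable f y (e_ i)) -> (forall i, continuous (partial i f)) ->
  (forall i, is_derive t 1 (fun s => c s ord0 i) (c' ord0 i)) ->
  is_derive t 1 (f \o c) (\sum_(i < n) c' ord0 i * partial i f (c t)).
Proof.
move=> df cf dc.
have cc : {for t, continuous c}.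
  apply/cvgrPdist_le => e e0; near=> s; apply: ler_rV_norm => [|i]; first exact: ltW.
  move: i; near: s; apply: filter_forall => i.
  have : {for t, continuous (fun s => c s ord0 i)}.
    by apply: differentiable_continuous; apply/derivable1_diffP; apply: ex_derive.
  move/cvgrPdist_le => /(_ e e0); apply: filterS => s.
  by rewrite !mxE.
have /choice[xi xiP] : forall h : R, exists xi : 'I_n -> 'rV[R]_n,
    (forall i, `|xi i - c t| <= `|c (h + t) - c t|) /\
    f (c (h + t)) - f (c t) =
    \sum_(i < n) (c (h + t) - c t) ord0 i * partial i f (xi i).
  move=> h; have [xi] := rV_MVT (c t) (c (h + t) - c t) df.
  by rewrite [c t + _]addrC subrK => xi1 xi2; exists xi.
have lim : h^-1 *: ((f \o c) (h + t) - (f \o c) t) @[h --> 0^'] -->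
    \sum_(i < n) c' ord0 i * partial i f (c t).
  rewrite [X in X @ _](_ : _ = fun h : R => \sum_(i < n)
      (h^-1 *: (c (h + t) ord0 i - c t ord0 i)) * partial i f (xi h i)); last first.
    apply/funext => h /=; rewrite (proj2 (xiP h)) scaler_sumr.
    by apply: eq_bigr => i _; rewrite !mxE scalerAl.
  have ct : c (h + t) @[h --> 0^'] --> c t.
    have ht : (h + t) @[h --> (0 : R)] --> t.
      by rewrite -[X in _ --> X]add0r; apply: cvgD; [exact: cvg_id|exact: cvg_cst].
    apply: cvg_within_filter; exact: (@cvg_comp _ _ _ _ c _ _ _ ht cc).
  apply: cvg_big => [|i _]; first exact: add_continuous.
  apply: cvgM.
    have := dc i; move=> -[di <-].
    move: di => /cvg_ex[l dl].
    rewrite /derive (cvg_lim _ dl)//.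
    move: dl; apply: cvg_trans; apply: near_eq_cvg; near=> h.
    by congr (_ *: (c (_ + _) ord0 i - _)); exact: mulr1.
  have xit : xi h i @[h --> 0^'] --> c t; last first.
    exact: (@cvg_comp _ _ _ _ (partial i f) _ _ _ xit (cf i (c t))).
  apply/cvgrPdist_le => e e0.
  move/cvgrPdist_le : ct => /(_ _ e0); apply: filterS => h.
  rewrite distrC => ch; rewrite distrC; exact: le_trans (proj1 (xiP h) i) ch.
have E : (fun h : R => h^-1 *: ((f \o c) (h *: 1 + t) - (f \o c) t)) =
         (fun h : R => h^-1 *: ((f \o c) (h + t) - (f \o c) t)).
  by apply/funext => h; congr (_ *: ((f \o c) (_ + _) - _)); exact: mulr1.
apply: DeriveDef.
  by rewrite /derivable /= E; apply: cvgP lim.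
by rewrite /derive /= E; apply/cvg_lim.
Unshelve. all: by end_near. Qed.

End partial_calculus.

Lemma is_derive_lineP {R : realType} {V W : normedModType R} (f : V -> W) x v d :
  is_derive x v f d <-> is_derive (0 : R) 1 (fun s : R => f (x + s *: v)) d.
Proof.
have x0 : x + (0 : R) *: v = x by rewrite scale0r addr0.
split=> -[df <-].
- by apply: DeriveDef; [apply: derivable_line; rewrite x0|rewrite derive_line x0].
- apply: DeriveDef; last by rewrite derive_line x0.
  apply/derivable1P.
  have -> : (fun h : R => f (h *: v + x)) = (fun s : R => f (x + s *: v)).
    by apply/funext => s; rewrite addrC.
  exact: df.
Qed.

Lemma is_derive_affine_real {R : realType} (a b t : R) : is_derive t 1 (fun s : R => a + b * s) b.
Proof.
have := is_deriveD (is_derive_cst a t 1) (is_deriveM (is_derive_cst b t 1) (is_derive_id t 1)).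
by rewrite scaler0 addr0 add0r [_ *: _]mulr1.
Qed.

Section Ck.
Context {R : realType} {n : nat}.
Implicit Types (x y h : 'rV[R]_n) (f g : 'rV[R]_n -> R).

Let e_ (i : 'I_n) : 'rV[R]_n := delta_mx ord0 i.

(** Recursion on the order, where [smooth] quantifies over lists of coordinates: the product rule
    needs an induction hypothesis for all pairs of functions at the lower order. *)
Fixpoint Ck k f : Prop := continuous f /\
  (if k is k'.+1 then
     forall i, (forall x, derivable f x (delta_mx ord0 i)) /\ Ck k' (partial i f)
   else True).

Lemma Ck_continuous k f : Ck k f -> continuous f.
Proof. by case: k => [|k] []. Qed.

Lemma CkS k f : Ck k.+1 f -> Ck k f.
Proof.
elim: k f => [|k IH] f; first by move=> [].
by move=> [cf df]; split=> // i; have [? ?] := df i; split=> //; exact: IH.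
Qed.

Lemma smoothP f : smooth f <-> forall k, Ck k f.
Proof.
split=> [sf k|Cf].
  suff : forall s, Ck k (iter_partial s f) by move=> /(_ [::]).
  elim: k => [|k IH] s; have [? ?] := sf s; split=> //.
  by move=> i; split=> //; exact: (IH (i :: s)).
move=> s; suff Csf : forall k, Ck k (iter_partial s f).
  split; first exact: Ck_continuous (Csf 0%N).
  by move=> i; have [_ /(_ i)[]] := Csf 1%N.
by elim: s => [//|i s IH] k; have [_ /(_ i)[]] := IH k.+1.
Qed.

Lemma smooth_continuous f : smooth f -> continuous f.
Proof. by move=> /(_ [::])[]. Qed.

Lemma smooth_derivable f : smooth f ->
  forall i x, derivable f x (delta_mx ord0 i).
Proof. by move=> /(_ [::])[]. Qed.

Lemma smooth_partial f i : smooth f -> smooth (partial i f).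
Proof. by move=> /smoothP Cf; apply/smoothP => k; have [_ /(_ i)[]] := Cf k.+1. Qed.

Lemma is_derive_partial f i x : smooth f ->
  is_derive x (delta_mx ord0 i) f (partial i f x).
Proof. by move=> sf; apply: DeriveDef => //; exact: smooth_derivable. Qed.

(** A coinduction principle: an invariant class replaces formulas for the higher derivatives. The
    class is usually larger than the functions of interest, for instance coordinates together with
    constants. *)
Lemma smooth_class (S : ('rV[R]_n -> R) -> Prop) :
  (forall f, S f -> continuous f) ->
  (forall f i, S f -> exists2 g, S g &
     forall x, is_derive x (delta_mx ord0 i) f (g x)) ->
  forall f, S f -> smooth f.
Proof.
move=> Sc Sd f Sf; apply/smoothP => k; elim: k f Sf => [|k IH] f Sf.
  by split => //; exact: Sc.
split; first exact: Sc.
move=> i; have [g Sg dg] := Sd f i Sf; split=> [x|].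
  by have [] := dg x.
rewrite (_ : partial i f = g); first exact: IH.
by apply/funext => x; have [_] := dg x.
Qed.

Lemma CkD k f g : Ck k f -> Ck k g -> Ck k (f \+ g).
Proof.
elim: k f g => [|k IH] f g [cf df] [cg dg].
  by split=> // x; exact: (cvgD (cf x) (cg x)).
split; first by move=> x; exact: (cvgD (cf x) (cg x)).
move=> i; have [dfi Cf] := df i; have [dgi Cg] := dg i; split.
  by move=> x; apply: derivableD.
rewrite (_ : partial i _ = partial i f \+ partial i g); first exact: IH.
by apply/funext => x; rewrite /partial deriveD.
Qed.

Lemma CkM k f g : Ck k f -> Ck k g -> Ck k (f \* g).
Proof.
elim: k f g => [|k IH] f g /[dup] Ckf [cf df] /[dup] Ckg [cg dg].
  by split=> // x; exact: (cvgM (cf x) (cg x)).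
split; first by move=> x; exact: (cvgM (cf x) (cg x)).
move=> i; have [dfi Cf] := df i; have [dgi Cg] := dg i; split.
  by move=> x; apply: derivableM.
rewrite (_ : partial i _ = (f \* partial i g) \+ (g \* partial i f)).
  by apply: CkD; apply: IH => //; exact: CkS.
by apply/funext => x; rewrite /partial deriveM.
Qed.

Lemma smoothD f g : smooth f -> smooth g -> smooth (f \+ g).
Proof. by move=> /smoothP ? /smoothP ?; apply/smoothP => k; exact: CkD. Qed.

Lemma smoothM f g : smooth f -> smooth g -> smooth (f \* g).
Proof. by move=> /smoothP ? /smoothP ?; apply/smoothP => k; exact: CkM. Qed.

Lemma smooth_cst (c : R) : smooth (fun _ : 'rV[R]_n => c).
Proof.
apply: (@smooth_class (fun f => exists c : R, f = cst c)); last by exists c.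
  by move=> _ [d ->]; exact: cst_continuous.
move=> _ i [d ->]; exists (fun=> 0); first by exists 0.
by move=> x; exact: is_derive_cst.
Qed.

Lemma is_derive_coor (j i : 'I_n) x :
  is_derive x (e_ i) (fun y : 'rV[R]_n => y ord0 j) (j == i)%:R.
Proof.
apply/is_derive_lineP.
have -> : (fun s : R => (x + s *: e_ i) ord0 j) =
    (fun s => x ord0 j + (j == i)%:R * s).
  by apply/funext => s; rewrite !mxE eqxx/= [in RHS]mulrC.
exact: is_derive_affine_real.
Qed.

Lemma smooth_coor j : smooth (fun y : 'rV[R]_n => y ord0 j).
Proof.
apply: (@smooth_class (fun f => (exists c : R, f = cst c) \/
    f = fun y : 'rV[R]_n => y ord0 j)); last by right.
  by move=> f [[c ->]|->]; [exact: cst_continuous|exact: coord_continuous].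
move=> f i [[c ->]|->].
  by exists (fun=> 0) => [|x]; [left; exists 0|exact: is_derive_cst].
by exists (fun=> (j == i)%:R) => [|x]; [left; exists (j == i)%:R|exact: is_derive_coor].
Qed.

Lemma smooth_sum (I : Type) (r : seq I) (F : I -> 'rV[R]_n -> R) :
  (forall i, smooth (F i)) -> smooth (fun x => \sum_(i <- r) F i x).
Proof.
move=> sF; elim: r => [|i r IH].
  rewrite (_ : (fun _ => _) = fun=> 0); first exact: smooth_cst.
  by apply/funext => x; rewrite big_nil.
rewrite (_ : (fun _ => _) = F i \+ (fun x => \sum_(i <- r) F i x)).
  exact: (smoothD (sF i) IH).
by apply/funext => x; rewrite big_cons.
Qed.

Lemma is_derive_comp_real (phi : R -> R) f v x (a b : R) :
  is_derive (f x) 1 phi a -> is_derive x v f b ->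
  is_derive x v (phi \o f) (a * b).
Proof.
move=> da /is_derive_lineP db; apply/is_derive_lineP.
apply: (is_derive1_comp (f := phi)) db.
by rewrite scale0r addr0.
Qed.

Lemma smooth_comp (S : (R -> R) -> Prop) f : smooth f ->
  (forall phi, S phi -> exists2 psi, S psi & forall t : R, is_derive t 1 phi (psi t)) ->
  forall phi, S phi -> smooth (phi \o f).
Proof.
move=> sf Sd phi Sphi; apply/smoothP => k; elim: k phi Sphi => [|k IH] phi Sphi;
  have [psi Spsi dphi] := Sd _ Sphi.
all: have cphi : continuous (phi \o f).
- by move=> x; apply: continuous_comp; [exact: smooth_continuous|
    apply: differentiable_continuous; apply/derivable1_diffP; apply: ex_derive].
- by split.
- by move=> x; apply: continuous_comp; [exact: smooth_continuous|
    apply: differentiable_continuous; apply/derivable1_diffP; apply: ex_derive].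
split=> // i.
have d x : is_derive x (e_ i) (phi \o f) (psi (f x) * partial i f x).
  by apply: is_derive_comp_real; exact: is_derive_partial.
split=> [x|]; first by have [] := d x.
rewrite (_ : partial i _ = (psi \o f) \* partial i f).
  by apply: CkM; [exact: IH|have /smoothP := smooth_partial i sf].
by apply/funext => x; have [_] := d x.
Qed.

Lemma smooth_expR f : smooth f -> smooth (expR \o f).
Proof.
move=> sf; apply: (@smooth_comp (fun phi => phi = expR)) => // _ ->.
by exists expR => // t; exact: is_derive_expR.
Qed.

Lemma is_derive_affine f (a : 'rV[R]_n) (b : R) i x : smooth f ->
  is_derive x (e_ i) (fun x => f (a + b *: x)) (b * partial i f (a + b *: x)).
Proof.
move=> sf; apply/is_derive_lineP.
have d := is_derive_line (a + b *: x) (0 + b * 0) (fun y => @smooth_derivable _ sf i y).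
have := @is_derive1_comp R _ (fun s : R => 0 + b * s) 0 _ _ d (is_derive_affine_real 0 b 0).
rewrite mulr0 addr0 scale0r addr0 mulrC.
have -> : (fun s : R => f (a + b *: x + s *: e_ i)) \o (fun s : R => 0 + b * s) =
    (fun s : R => f (a + b *: (x + s *: e_ i))).
  by apply/funext => s /=; rewrite add0r scalerDr addrA scalerA.
by [].
Qed.

Lemma continuous_affine f (a : 'rV[R]_n) (b : R) : continuous f ->
  continuous (fun x => f (a + b *: x)).
Proof.
move=> cf x.
have ax (z : 'rV[R]_n) : (a + b *: y) @[y --> z] --> a + b *: z.
  apply: (@cvgD _ 'rV[R]_n _ (nbhs z) _ (fun=> a) (fun y => b *: y)).
    exact: (@cvg_cst 'rV[R]_n a _ (nbhs z)).
  by apply: cvgZl_tmp; exact: cvg_id.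
exact: (@cvg_comp _ _ _ _ f _ _ _ (ax x) (cf _)).
Qed.

Lemma smooth_affine f (a : 'rV[R]_n) (b : R) : smooth f ->
  smooth (fun x => f (a + b *: x)).
Proof.
(* Each differentiation brings out a factor [b], hence the constant multiple in the class. *)
move=> sf; apply: (@smooth_class (fun g => exists f (c : R), smooth f /\
    g = (fun x => c * f (a + b *: x)))); last first.
- by exists f, 1; split=> //; apply/funext => x; rewrite mul1r.
- move=> _ i [g [c [sg ->]]].
  exists (fun x => (c * b) * partial i g (a + b *: x)).
    by exists (partial i g), (c * b); split; first exact: (smooth_partial i sg).
  move=> x; rewrite -mulrA.
  exact: (is_deriveZ c (is_derive_affine a b i x sg)).
- move=> _ [g [c [sg ->]]].
  have cg : continuous (fun x => g (a + b *: x)).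
    by apply: continuous_affine; exact: smooth_continuous.
  by move=> x; exact: (@cvgM _ _ (nbhs (x : 'rV[R]_n)) _ (fun=> c) _ _ _ (cvg_cst c) (cg x)).
Qed.

End Ck.

(** * Bump functions and cutoffs *)

Section bump.
Context {R : realType}.

(* The powers of [x^-1] make the family closed under derivation up to linear combination. *)
Definition flat m (x : R) : R := if 0 < x then x^-1 ^+ m * expR (- x^-1) else 0.

Lemma flat_ge0 m x : 0 <= flat m x.
Proof.
by rewrite /flat; case: ifPn => // x0; rewrite mulr_ge0 ?expR_ge0// exprn_ge0// invr_ge0 ltW.
Qed.

Lemma flatS m x : flat m.+1 x = x^-1 * flat m x.
Proof. by rewrite /flat; case: ifPn => x0; rewrite ?mulr0// exprS mulrA. Qed.

(** The exponential dominates each term y^(m+1)/(m+1)! of its series, at y = 1/x. *)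
Lemma flat_le_fact m x : flat m.+1 x <= m.+1`!%:R.
Proof.
rewrite /flat; case: ifPn => // x0.
have xV0 : 0 <= x^-1 by rewrite invr_ge0 ltW.
rewrite expRN ler_pdivrMr ?expR_gt0//.
rewrite -ler_pdivrMl ?ltr0n ?fact_gt0// mulrC.
by rewrite (le_trans _ (expR_ge1Dxn m xV0))// lerDr.
Qed.

(** The difference quotient of [flat m] at 0 is [flat m.+1]; a bound linear in |x|, rather than a
    constant, sends it to 0. *)
Lemma flat_le m x : flat m x <= m.+1`!%:R * `|x|.
Proof.
have := flat_le_fact m x; rewrite flatS.
have [x0|x0] := ltP 0 x.
  by rewrite mulrC ler_pdivrMr// gtr0_norm.
by rewrite /flat ltNge x0/= mulr0 => _; rewrite mulr_ge0.
Qed.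

Lemma is_derive_flat m (x : R) :
  is_derive x 1 (flat m) (- m%:R * flat m.+1 x + flat m.+2 x).
Proof.
have [x0|x0|->] := ltgtP x 0.
- have -> : - m%:R * flat m.+1 x + flat m.+2 x = 0.
    by rewrite /flat ltNge ltW//= mulr0 addr0.
  apply: near_eq_is_derive (is_derive_cst (0 : R) x 1).
  by near=> y; rewrite /flat ltNge ltW//=; near: y; exact: lt_nbhsl.
- have dV := is_deriveV (lt0r_neq0 x0 : id x != 0) (is_derive_id x 1).
  have dE := is_derive1_comp (is_derive_expR (- x^-1)) (is_deriveNid x^-1 1).
  have dX := is_deriveX m (is_derive_id x^-1 1).
  have d := is_derive1_comp (is_deriveM dX dE) dV.
  have E : \forall y \near x,
      ((id ^+ m * (expR \o -%R)) \o @GRing.inv R) y = flat m y.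
    by near=> y; rewrite /flat ifT ?fctE//; near: y; exact: lt_nbhsr.
  apply: (is_derive_eq (near_eq_is_derive E d)); rewrite /flat x0 /=.
  rewrite /GRing.scale /= !mulr1 mulrN1 -exprVn.
  have -> : (id ^+ m) x^-1 = x^-1 ^+ m by rewrite fctE.
  move: (expR (- x^-1)) (x^-1) => E' y; case: m {dX d E} => [|m]; first by rewrite !exprS expr0; ring.
  by rewrite /= !exprS; ring.
- have flat0 k : flat k 0 = 0 by rewrite /flat ltxx.
  have lim : h^-1 *: (flat m (h + 0) - flat m 0) @[h --> (0:R)^'] --> (0 : R).
    apply: (@cvg_to_0_linear _ _ m.+2`!%:R 1) => // h _.
    rewrite flat0 subr0 addr0.
    have -> : h^-1 *: flat m h = flat m.+1 h by rewrite flatS.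
    by rewrite ger0_norm ?flat_ge0// flat_le.
  have E : (fun h : R => h^-1 *: ((flat m \o shift 0) (h *: 1) - flat m 0)) =
           (fun h : R => h^-1 *: (flat m (h + 0) - flat m 0)).
    by apply/funext => h; congr (_ *: (flat m (_ + _) - _)); exact: mulr1.
  rewrite !flat0 mulr0 addr0; apply: DeriveDef.
    by rewrite /derivable E; exact: cvgP lim.
  by rewrite /derive E; exact/cvg_lim.
Unshelve. all: by end_near. Qed.

Inductive flat_comb : (R -> R) -> Prop :=
| flat_comb1 m : flat_comb (flat m)
| flat_combD a f b g : flat_comb f -> flat_comb g ->
    flat_comb (fun x => a * f x + b * g x).

Lemma flat_comb_derive f : flat_comb f ->
  exists2 g, flat_comb g & forall x : R, is_derive x 1 f (g x).
Proof.
elim=> [m|a {}f b g _ [f' cf' df] _ [g' cg' dg]].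
  exists (fun x => - m%:R * flat m.+1 x + 1 * flat m.+2 x).
    by apply: flat_combD; exact: flat_comb1.
  by move=> x; rewrite mul1r; exact: is_derive_flat.
exists (fun x => a * f' x + b * g' x); first exact: flat_combD.
by move=> x; exact: (is_deriveD (is_deriveZ a (df x)) (is_deriveZ b (dg x))).
Qed.

End bump.

Section cutoff.
Context {R : realType} {n : nat}.
Implicit Types (x : 'rV[R]_n) (k : R).

Definition sumsq x : R := \sum_(i < n) x ord0 i ^+ 2.

Lemma sumsq_ge0 x : 0 <= sumsq x.
Proof. by apply: sumr_ge0 => i _; exact: sqr_ge0. Qed.

Lemma enorm_sqr x : enorm x ^+ 2 = sumsq x.
Proof. by rewrite sqr_sqrtr// sumsq_ge0. Qed.

Lemma enorm_ge0 x : 0 <= enorm x. Proof. exact: sqrtr_ge0. Qed.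

Lemma ler_coor_enorm x i : `|x ord0 i| <= enorm x.
Proof.
rewrite -sqrtr_sqr ler_sqrt ?sumsq_ge0// (bigD1 i)//= lerDl.
by apply: sumr_ge0 => j _; exact: sqr_ge0.
Qed.

Lemma smooth_sumsq : smooth sumsq.
Proof.
apply: smooth_sum => i.
exact: (smoothM (smooth_coor i) (smooth_coor i)).
Qed.

Lemma partial_sumsq i x : is_derive x (delta_mx ord0 i) sumsq (2 * x ord0 i).
Proof.
have := @is_derive_sum R _ _ n
  (fun j => (fun y : 'rV[R]_n => y ord0 j) * (fun y : 'rV[R]_n => y ord0 j)) x
  (delta_mx ord0 i) _ (fun j => is_deriveM (is_derive_coor j i x) (is_derive_coor j i x)).
rewrite (_ : \sum_(j < n) _ = sumsq); last first.
  by apply/funext => y; rewrite fct_sumE.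
rewrite (bigD1 i)//= big1 => [|j /negbTE ->]; last by rewrite !scaler0 addr0.
by rewrite eqxx addr0 [_ *: _]mulr1 -mulr2n mulr_natl.
Qed.

(** On the ball of radius k this is exp(1 - 1/(1 - |x|^2/k^2)); the factor e normalises the value at
    0, hence the pointwise limit as k grows, to 1. *)
Definition cutoff k x : R := expR 1 * flat 0 (1 - k^-1 ^+ 2 * sumsq x).

Lemma cutoff_ge0 k x : 0 <= cutoff k x.
Proof. by rewrite mulr_ge0 ?expR_ge0 ?flat_ge0. Qed.

Lemma cutoff_le1 k x : cutoff k x <= 1.
Proof.
rewrite /cutoff /flat; case: ifPn => [s0|_]; last by rewrite mulr0.
rewrite expr0 mul1r -expRD -[leRHS]expR0 ler_expR subr_le0 invf_ge1//.
by rewrite gerBl mulr_ge0 ?sumsq_ge0// exprn_even_ge0.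
Qed.

Lemma cutoff_support k x : 0 < k -> cutoff k x != 0 -> sumsq x <= k ^+ 2.
Proof.
move=> k0; rewrite /cutoff /flat; case: ifPn => [|_]; last by rewrite mulr0 eqxx.
rewrite subr_gt0 exprVn mulrC ltr_pdivrMr ?exprn_gt0// mul1r.
by move=> /ltW.
Qed.

Lemma cutoff_arg_derive k i x :
  is_derive x (delta_mx ord0 i) (fun x => 1 - k^-1 ^+ 2 * sumsq x)
    (- (k^-1 ^+ 2 * (2 * x ord0 i))).
Proof.
have := is_deriveD (is_derive_cst (1 : R) x (delta_mx ord0 i))
  (is_deriveN (is_deriveZ (k^-1 ^+ 2) (partial_sumsq i x))).
by rewrite add0r.
Qed.

Lemma smooth_cutoff k : smooth (cutoff k).
Proof.
apply: (smoothM (smooth_cst (expR 1))).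
have sq : smooth (fun x => 1 - k^-1 ^+ 2 * sumsq x).
  rewrite (_ : (fun x => _) =
    (cst 1) \+ ((fun=> - k^-1 ^+ 2) \* sumsq)); last first.
    by apply/funext => x /=; rewrite mulNr.
  exact: (smoothD (smooth_cst 1) (smoothM (smooth_cst _) smooth_sumsq)).
exact: (smooth_comp sq flat_comb_derive (flat_comb1 0)).
Qed.

(** Where the profile does not vanish |x_i| <= k, so the inner derivative is at most 2/k in absolute
    value, and [flat 2] is at most 2! = 2. The decay in k, uniform in x, makes the cutoff error
    vanish. *)
Lemma partial_cutoff_le k i x : 0 < k ->
  `|partial i (cutoff k) x| <= expR 1 * 4 / k.
Proof.
move=> k0; pose q x : R := 1 - k^-1 ^+ 2 * sumsq x.
have dq := cutoff_arg_derive k i x.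
have d := is_deriveZ (expR 1) (is_derive_comp_real (is_derive_flat 0 (q x)) dq).
have -> : partial i (cutoff k) x = expR 1 * (flat 2 (q x) * - (k^-1 ^+ 2 * (2 * x ord0 i))).
  by have [_] := d; rewrite oppr0 mul0r add0r.
rewrite -mulrA normrM ger0_norm ?expR_ge0// ler_pM2l ?expR_gt0//.
rewrite normrM normrN ger0_norm ?flat_ge0//.
have [q0|q0] := ltP 0 (q x); last first.
  by rewrite /flat ltNge q0/= mul0r mulr_ge0// invr_ge0 ltW.
have xk : `|x ord0 i| <= k.
  rewrite (le_trans (ler_coor_enorm x i))// -(@ler_pXn2r _ 2)// ?nnegrE ?enorm_ge0 ?(ltW k0)//.
  rewrite enorm_sqr; move: q0; rewrite subr_gt0 exprVn mulrC ltr_pdivrMr ?exprn_gt0//.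
  by rewrite mul1r => /ltW.
rewrite (@le_trans _ _ (2 * (k^-1 ^+ 2 * (2 * k))))//.
  apply: ler_pM => //; rewrite ?flat_ge0//; first exact: (flat_le_fact 1).
  rewrite normrM ger0_norm ?exprn_even_ge0// ler_wpM2l ?exprn_even_ge0//.
  by rewrite normrM ger0_norm// ler_pM2l.
by rewrite le_eqVlt; apply/orP; left; apply/eqP; field; rewrite gt_eqF.
Qed.

Lemma cvg_cutoff x : cutoff N.+1%:R x @[N --> \oo] --> (1 : R).
Proof.
rewrite [X in _ --> X](_ : _ = expR 1 * flat 0 1); last first.
  by rewrite /flat ltr01 expr0 mul1r invr1 expRN divff// gt_eqF// expR_gt0.
apply: cvgM; first exact: cvg_cst.
have cf : {for (1 : R), continuous (flat 0)}.
  apply: differentiable_continuous; apply/derivable1_diffP.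
  by have [] := is_derive_flat 0 (1 : R).
have h : (1 - N.+1%:R^-1 ^+ 2 * sumsq x) @[N --> \oo] --> (1 : R).
  rewrite -[X in _ --> X]subr0; apply: cvgB; first exact: cvg_cst.
  have -> : (0 : R) = 0 * 0 * sumsq x by rewrite !mul0r.
  have c0 : N.+1%:R^-1 @[N --> \oo] --> (0 : R) by exact: cvg_harmonic.
  exact: (cvgM (cvgM c0 c0) (cvg_cst (sumsq x))).
exact: (cvg_comp _ _ h cf).
Qed.

End cutoff.

(** * Invariance and moments of the Gaussian measure *)

Section density.
Local Open Scope ereal_scope.
Context d (T : measurableType d) (R : realType).
Variables (mu nu : {measure set T -> \bar R}) (rho : T -> R).
Hypothesis mrho : measurable_fun setT rho.
Hypothesis rho0 : forall x, (0 <= rho x)%R.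
Hypothesis nuE : forall A, measurable A -> nu A = \int[mu]_(x in A) (rho x)%:E.

Import HBNNSimple.

Let integral_density_nnsfun (f : {nnsfun T >-> R}) :
  \int[nu]_x (f x)%:E = \int[mu]_x ((f x)%:E * (rho x)%:E).
Proof.
under [LHS]eq_integral do rewrite fimfunE -fsumEFin//.
rewrite [LHS]ge0_integral_fsum//; last 2 first.
- by move=> r; exact/measurable_EFinP/measurableT_comp.
- by move=> n x _; rewrite EFinM nnfun_muleindic_ge0.
under [RHS]eq_integral.
  move=> x xD; rewrite fimfunE -fsumEFin// muleC ge0_mule_fsumr; last first.
    by move=> r; rewrite EFinM nnfun_muleindic_ge0.
  over.
rewrite [RHS]ge0_integral_fsum//; last 2 first.
- move=> r; apply/measurable_EFinP; apply: measurable_funM => //.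
  exact: measurableT_comp.
- by move=> n x _; apply: mule_ge0; [rewrite lee_fin|rewrite EFinM nnfun_muleindic_ge0].
apply: eq_fsbigr => r _.
have [r0|r0] := ltP r 0%R.
  rewrite !integral0_eq// => x _; rewrite preimage_nnfun0// indicE in_set0 mulr0//.
  by rewrite mule0.
under [RHS]eq_integral do rewrite EFinM muleCA.
rewrite [RHS]ge0_integralZl//; last 2 first.
- apply/measurable_EFinP; apply: measurable_funM => //.
- by move=> x _; rewrite mule_ge0 ?lee_fin.
rewrite integralZl_indic_nnsfun// integral_indic// setIT nuE//; congr (_ * _).
rewrite integral_mkcond; apply: eq_integral => x _.
by rewrite patchE indicE; case: ifPn => _; rewrite ?mule1 ?mule0.
Qed.

Lemma ge0_integral_density (f : T -> \bar R) : measurable_fun setT f ->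
  (forall x, 0 <= f x) -> \int[nu]_x f x = \int[mu]_x (f x * (rho x)%:E).
Proof.
move=> mf f0.
pose f_ := nnsfun_approx measurableT mf.
transitivity (limn (fun n => \int[nu]_x (f_ n x)%:E)).
  rewrite -monotone_convergence//=.
  - apply: eq_integral => ? /[!inE] xD; apply/esym/cvg_lim => //=.
    exact: cvg_nnsfun_approx.
  - by move=> n; exact/measurable_EFinP/measurable_funTS.
  - by move=> n ? _; rewrite lee_fin.
  - by move=> ? _ ? ? mn; rewrite lee_fin; exact/lefP/nd_nnsfun_approx.
transitivity (limn (fun n => \int[mu]_x ((f_ n x)%:E * (rho x)%:E))).
  by apply: congr_lim; apply/funext => n /=; exact: integral_density_nnsfun.
rewrite -monotone_convergence//=.
- apply: eq_integral => x _; apply/cvg_lim => //=.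
  apply: cvgeZr => //; exact: cvg_nnsfun_approx.
- by move=> n; apply/measurable_EFinP/measurable_funM.
- by move=> n ? _; rewrite mule_ge0 ?lee_fin.
- move=> x _ a b ab; rewrite lee_wpmul2r ?lee_fin//.
  exact/lefP/nd_nnsfun_approx.
Qed.

Lemma integral_density (f : T -> \bar R) : measurable_fun setT f ->
  \int[nu]_x f x = \int[mu]_x (f x * (rho x)%:E).
Proof.
move=> mf; rewrite [LHS]integralE [RHS]integralE.
rewrite !ge0_integral_density//; [|exact: measurable_funeneg|exact: measurable_funepos].
have posM x : 0 <= (rho x)%:E by rewrite lee_fin.
congr (_ - _); apply: eq_integral => x _.
  by rewrite !funeposE maxe_pMl// mul0e.
by rewrite !funenegE maxe_pMl// mul0e mulNe.
Qed.

End density.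

Section translation.
Local Open Scope ereal_scope.
Context {R : realType}.

Lemma lebesgue_measure_shift (a : R) (A : set R) : measurable A ->
  pushforward (@lebesgue_measure R) (fun x : R => x + a : measurableTypeR R)%R A =
  (@lebesgue_measure R) A.
Proof.
have ma : measurable_fun [set: R] (fun x : R => x + a : measurableTypeR R)%R.
  exact: measurable_funD.
pose pa : {mfun _ >-> measurableTypeR R} := HB.pack (fun x : R => x + a : measurableTypeR R)%R
  (isMeasurableFun.Build _ _ _ _ _ ma).
move=> mA; apply/esym.
apply: (@lebesgue_measure_unique _ (pushforward (@lebesgue_measure R) pa)) => //= _ [[b c]] _ <-.
rewrite /pushforward /=.
have -> : (fun x : R => x + a)%R @^-1` [set` `]b, c]] = [set` `](b - a)%R, (c - a)%R]].
  by apply/seteqP; split => x /=; rewrite !in_itv/= ltrBlDr lerBrDr.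
rewrite !lebesgue_measure_itv/= !lte_fin ltrD2r.
by case: ifPn => // _; rewrite -!EFinD opprB addrA subrK.
Qed.

Lemma ge0_integral_shift (a : R) (F : R -> \bar R) : measurable_fun setT F ->
  (forall x, 0 <= F x) ->
  \int[lebesgue_measure]_x F (x + a)%R = \int[lebesgue_measure]_x F x.
Proof.
move=> mF F0.
have ma : measurable_fun setT (fun x : measurableTypeR R => x + a : measurableTypeR R)%R.
  by move=> *; exact: measurable_funD.
have := ge0_integral_pushforward ma (@lebesgue_measure R) measurableT mF.
move=> /(_ (fun y _ => F0 y)); rewrite preimage_setT => <-.
by apply: eq_measure_integral => A mA _; exact: lebesgue_measure_shift.
Qed.

Lemma ge0_integral_rV_cons n (F : 'rV[R]_n.+1 -> \bar R) : measurable_fun setT F ->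
  (forall x, 0 <= F x) ->
  \int[lebesgue_rV R n.+1]_x F x =
  \int[lebesgue_measure]_t \int[lebesgue_rV R n]_x F (rV_cons (t, x)).
Proof.
move=> mF F0.
have mFc : measurable_fun setT (fun z : measurableTypeR R * 'rV[R]_n => F (rV_cons z)).
  have h := measurableT_comp mF (@measurable_rV_cons R n).
  by move=> mT Y mY; exact: (h mT Y mY).
have T := @fubini_tonelli1 _ _ _ _ _ (@lebesgue_measure R) (lebesgue_rV R n) _ mFc
  (fun z => F0 (rV_cons z)).
rewrite /fubini_F in T; apply: (etrans _ T).
have mc : measurable_fun setT
    (fun z : measurableTypeR R * 'rV[R]_n => rV_cons z : 'rV[R]_n.+1).
  by have h := @measurable_rV_cons R n; move=> mT Y mY; exact: (h mT Y mY).
have := ge0_integral_pushforward mc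
  ((@lebesgue_measure R) \x (lebesgue_rV R n)) measurableT mF.
by move=> /(_ (fun y _ => F0 y)); rewrite preimage_setT.
Qed.

Lemma rV_consD n t s (x y : 'rV[R]_n) :
  (rV_cons (t, x) + rV_cons (s, y) = rV_cons (t + s, x + y))%R.
Proof. by apply/rowP => i; rewrite !mxE; case: unliftP => [j _|_] /=; rewrite ?mxE. Qed.

Lemma rV_consK n (x : 'rV[R]_n.+1) :
  x = rV_cons (x ord0 ord0, \row_j x ord0 (lift ord0 j))%R.
Proof.
by apply/rowP => i; rewrite !mxE; case: unliftP => [j ->|->] //=; rewrite mxE.
Qed.

Lemma measurable_rV_affine n d (T : measurableType d) (b c : R) (f g : T -> 'rV[R]_n) :
  measurable_fun setT f -> measurable_fun setT g ->
  measurable_fun setT (fun t => b *: f t + c *: g t)%R.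
Proof.
move=> mf mg; apply: measurable_fun_rVP => i.
under eq_fun do rewrite !mxE.
apply: measurable_funD; apply: measurable_funM => //.
- exact: (measurableT_comp (measurable_coor i) mf).
- exact: (measurableT_comp (measurable_coor i) mg).
Qed.

Lemma ge0_integral_rV_shift n (a : 'rV[R]_n) (F : 'rV[R]_n -> \bar R) :
  measurable_fun setT F -> (forall x, 0 <= F x) ->
  \int[lebesgue_rV R n]_x F (x + a)%R = \int[lebesgue_rV R n]_x F x.
Proof.
elim: n a F => [|n IH] a F mF F0.
  by apply: eq_integral => x _; congr F; apply/rowP => -[].
have mD m (b : 'rV[R]_m) : measurable_fun setT (fun x : 'rV[R]_m => x + b)%R.
  have := @measurable_rV_affine m _ _ 1 1 _ _ (@measurable_id _ 'rV[R]_m setT) (measurable_cst b).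
  by under eq_fun do rewrite !scale1r.
have mFc : measurable_fun setT (fun z => F (rV_cons z)).
  exact: (measurableT_comp mF (@measurable_rV_cons R n)).
rewrite [LHS]ge0_integral_rV_cons//; last exact: (measurableT_comp mF (mD _ _)).
rewrite [RHS](ge0_integral_rV_cons mF F0).
rewrite [a]rV_consK; set a0 := a _ _; set a' := \row_j _.
rewrite -[RHS](ge0_integral_shift a0); last 2 first.
- exact: (measurable_fun_fubini_tonelli_F _ mFc).
- by move=> x; apply: integral_ge0 => y _; exact: F0.
apply: eq_integral => t _; rewrite -[RHS](IH a')//.
  by apply: eq_integral => x _; rewrite rV_consD.
by apply: (measurableT_comp mFc); exact: measurable_pair1.
Qed.

End translation.

Section gauss_basic.
Local Open Scope ereal_scope.
Context {R : realType}.

Lemma ge0_integral_gauss n (F : 'rV[R]_n -> \bar R) : measurable_fun setT F ->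
  (forall x, 0 <= F x) ->
  \int[gauss_rV R n]_x F x = \int[lebesgue_rV R n]_x (F x * (gauss_rV_pdf x)%:E).
Proof.
move=> mF F0.
apply: (ge0_integral_density measurable_gauss_rV_pdf) => //.
exact: gauss_rV_pdf_ge0.
Qed.

Lemma integral_gauss n (F : 'rV[R]_n -> \bar R) : measurable_fun setT F ->
  \int[gauss_rV R n]_x F x = \int[lebesgue_rV R n]_x (F x * (gauss_rV_pdf x)%:E).
Proof.
move=> mF.
apply: (integral_density measurable_gauss_rV_pdf) => //.
exact: gauss_rV_pdf_ge0.
Qed.

Lemma normal_pdf01 (t : R) : normal_pdf 0 1 t =
  ((2 * pi) `^ (- 2^-1) * expR (- (t ^+ 2 / 2)))%R.
Proof.
rewrite normal_pdfE ?oner_neq0// /normal_peak /normal_fun subr0 expr1n mul1r.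
congr (_ * _)%R; last by rewrite mulNr.
by rewrite powRN -mulr_natl powR12_sqrt// mulr_ge0// pi_ge0.
Qed.

Lemma sumsq_cons n t (x : 'rV[R]_n) : sumsq (rV_cons (t, x)) = (t ^+ 2 + sumsq x)%R.
Proof.
rewrite /sumsq big_ord_recl mxE unlift_none; congr (_ + _)%R.
by apply: eq_bigr => i _; rewrite mxE liftK.
Qed.

Lemma gauss_rV_pdf_cons n t (x : 'rV[R]_n) :
  gauss_rV_pdf (rV_cons (t, x)) = (normal_pdf 0 1 t * gauss_rV_pdf x)%R.
Proof.
rewrite normal_pdf01 /gauss_rV_pdf !enorm_sqr sumsq_cons mulrACA -powRD.
  rewrite -expRD; congr (_ `^ _ * expR _)%R; first by rewrite -natr1; field.
  by field.
by apply/implyP => _; rewrite gt_eqF// mulr_gt0// pi_gt0.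
Qed.

Lemma measurable_normal_pdf01 : measurable_fun setT (fun t : R => (normal_pdf 0 1 t)%:E).
Proof. by apply/measurable_EFinP; exact: measurable_normal_pdf. Qed.

Lemma ge0_integral_gauss_cons n (F : 'rV[R]_n.+1 -> \bar R) : measurable_fun setT F ->
  (forall x, 0 <= F x) ->
  \int[gauss_rV R n.+1]_x F x =
  \int[lebesgue_measure]_t ((normal_pdf 0 1 t)%:E *
    \int[gauss_rV R n]_x F (rV_cons (t, x))).
Proof.
move=> mF F0; rewrite ge0_integral_gauss//.
have mpdf m : measurable_fun setT (fun x : 'rV[R]_m => (gauss_rV_pdf x)%:E).
  by apply/measurable_EFinP; exact: measurable_gauss_rV_pdf.
have mFp : measurable_fun setT (fun x => F x * (gauss_rV_pdf x)%:E).
  exact: (emeasurable_funM mF (mpdf _)).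
have Fp0 x : 0 <= F x * (gauss_rV_pdf x)%:E by rewrite mule_ge0// lee_fin gauss_rV_pdf_ge0.
rewrite (ge0_integral_rV_cons mFp Fp0); apply: eq_integral => t _.
have mFt : measurable_fun setT (fun x => F (rV_cons (t, x))).
  have mFc := measurableT_comp mF (@measurable_rV_cons R n).
  by apply: (measurableT_comp mFc); exact: measurable_pair1.
rewrite ge0_integral_gauss// -ge0_integralZl//; last 3 first.
- exact: (emeasurable_funM mFt (mpdf _)).
- by move=> x _; rewrite mule_ge0// lee_fin gauss_rV_pdf_ge0.
- by rewrite lee_fin normal_pdf_ge0.
by apply: eq_integral => x _; rewrite gauss_rV_pdf_cons EFinM muleCA.
Qed.

Lemma gauss_rV_setT n : gauss_rV R n setT = 1.
Proof.
elim: n => [|n IH].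
  rewrite /gauss_rV /= integral_dirac//; last first.
    by apply/measurable_EFinP; exact: measurable_gauss_rV_pdf.
  rewrite diracT mul1e /gauss_rV_pdf enorm_sqr /sumsq big_ord0 mul0r oppr0 powRr0.
  by rewrite expR0 mulr1.
have := @ge0_integral_gauss_cons n (cst 1) (measurable_cst _) (fun=> lee01).
rewrite /= !integral_cst//= mul1e => ->.
under eq_integral do rewrite IH mul1e mule1.
exact: integral_normal_pdf.
Qed.

HB.instance Definition _ n := @Measure_isProbability.Build _ _ R (gauss_rV R n) (@gauss_rV_setT n).

End gauss_basic.

Section rotation.
Local Open Scope ereal_scope.
Context {R : realType} {n : nat}.
Local Notation V := 'rV[R]_n.
Local Notation lam := (lebesgue_rV R n).
Local Notation g := (gauss_rV R n).

Lemma measurable_rV_lin (a b c d : R) : measurable_fun setT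
  (fun z : V * V => (a *: z.1 + b *: z.2, c *: z.1 + d *: z.2)%R).
Proof.
by apply: measurable_fun_pair; exact: measurable_rV_affine.
Qed.

(** By Tonelli with y fixed, the shear is a translation in x. The entries 0 and 1 of the matrix are
    kept so that it is literally an instance of [measurable_rV_lin]. *)
Let shear1 (a : R) (F : V * V -> \bar R) : measurable_fun setT F ->
  (forall z, 0 <= F z) ->
  \int[lam \x lam]_z F (1 *: z.1 + a *: z.2, 0 *: z.1 + 1 *: z.2)%R = \int[lam \x lam]_z F z.
Proof.
move=> mF F0.
have mFs := measurableT_comp mF (measurable_rV_lin 1 a 0 1).
rewrite (fubini_tonelli2 _ mF)//.
rewrite (fubini_tonelli2 _ mFs) => [|z]; last exact: F0.
apply: eq_integral => y _; rewrite /fubini_G /=.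
rewrite -[RHS](ge0_integral_rV_shift (a *: y)%R)//.
  by apply: eq_integral => x _; rewrite !scale1r scale0r add0r.
exact: (measurableT_comp mF (measurable_pair2 y)).
Qed.

Let shear2 (a : R) (F : V * V -> \bar R) : measurable_fun setT F ->
  (forall z, 0 <= F z) ->
  \int[lam \x lam]_z F (1 *: z.1 + 0 *: z.2, a *: z.1 + 1 *: z.2)%R = \int[lam \x lam]_z F z.
Proof.
move=> mF F0.
have mFs := measurableT_comp mF (measurable_rV_lin 1 0 a 1).
rewrite (fubini_tonelli1 _ mF)//.
rewrite (fubini_tonelli1 _ mFs) => [|z]; last exact: F0.
apply: eq_integral => x _; rewrite /fubini_F /=.
rewrite -[RHS](ge0_integral_rV_shift (a *: x)%R)//.
  by apply: eq_integral => y _; rewrite !scale1r scale0r addr0 addrC.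
exact: (measurableT_comp mF (measurable_pair1 x)).
Qed.

Definition rot (c s : R) (z : V * V) : V * V :=
  (c *: z.1 + s *: z.2, - s *: z.1 + c *: z.2)%R.

Lemma measurable_rot c s : measurable_fun setT (rot c s).
Proof. exact: measurable_rV_lin. Qed.

Let ge0_integral_lebesgue_rot (c s : R) (F : V * V -> \bar R) : s != 0%R ->
  (c ^+ 2 + s ^+ 2 = 1)%R ->
  measurable_fun setT F -> (forall z, 0 <= F z) ->
  \int[lam \x lam]_z F (rot c s z) = \int[lam \x lam]_z F z.
Proof.
move=> s0 cs1 mF F0.
(* A rotation is a product of three shears. *)
pose a : R := ((1 - c) / s)%R.
have as1 : (1 + a * - s = c)%R by rewrite /a; field.
have asc : (a + a * c = s)%R.
  apply: (mulIf s0); rewrite -[in RHS]expr2; have -> : (s ^+ 2 = 1 - c ^+ 2)%R.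
    by rewrite -cs1; ring.
  by rewrite /a; field.
pose F1 z := F (1 *: z.1 + a *: z.2, 0 *: z.1 + 1 *: z.2)%R.
have mF1 : measurable_fun setT F1 := measurableT_comp mF (measurable_rV_lin 1 a 0 1).
pose F2 z := F1 (1 *: z.1 + 0 *: z.2, - s *: z.1 + 1 *: z.2)%R.
have mF2 : measurable_fun setT F2 := measurableT_comp mF1 (measurable_rV_lin 1 0 (- s) 1).
rewrite -(shear1 a mF)// -(shear2 (- s) mF1); last by move=> z; exact: F0.
rewrite -(shear1 a mF2); last by move=> z; exact: F0.
apply: eq_integral => -[x y] _; rewrite /F2 /F1 /rot /=; congr F.
rewrite !(scale0r, scale1r, addr0, add0r); congr pair.
- apply/rowP => i; rewrite !mxE; move: (x ord0 i) (y ord0 i) => u v.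
  transitivity ((1 + a * - s) * u + (a + a * (1 + a * - s)) * v)%R; last by ring.
  by rewrite as1 asc.
- apply/rowP => i; rewrite !mxE; move: (x ord0 i) (y ord0 i) => u v.
  by rewrite -[in LHS]as1; ring.
Qed.

Lemma sumsq_rot c s z : (c ^+ 2 + s ^+ 2 = 1)%R ->
  (sumsq (rot c s z).1 + sumsq (rot c s z).2 = sumsq z.1 + sumsq z.2)%R.
Proof.
move=> cs1; rewrite /sumsq -!big_split/=; apply: eq_bigr => i _; rewrite !mxE.
transitivity ((c ^+ 2 + s ^+ 2) * (z.1 ord0 i ^+ 2 + z.2 ord0 i ^+ 2))%R; first by ring.
by rewrite cs1 mul1r.
Qed.

Let ge0_integral_gauss2 (F : V * V -> \bar R) :
  measurable_fun setT F -> (forall z, 0 <= F z) ->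
  \int[g \x g]_z F z =
  \int[lam \x lam]_z (F z * (gauss_rV_pdf z.1 * gauss_rV_pdf z.2)%:E).
Proof.
move=> mF F0.
have mpdf : measurable_fun setT (fun x : V => (gauss_rV_pdf x)%:E).
  by apply/measurable_EFinP; exact: measurable_gauss_rV_pdf.
have pdf0 (x : V) : 0 <= (gauss_rV_pdf x)%:E by rewrite lee_fin gauss_rV_pdf_ge0.
have mFp : measurable_fun setT
    (fun z => F z * (gauss_rV_pdf z.1 * gauss_rV_pdf z.2)%:E).
  apply: (emeasurable_funM mF).
  rewrite (_ : (fun _ => _) =
    fun z : V * V => (gauss_rV_pdf z.1)%:E * (gauss_rV_pdf z.2)%:E)//.
  by apply: emeasurable_funM; exact: measurableT_comp mpdf _.
rewrite (fubini_tonelli1 _ mF)// (fubini_tonelli1 _ mFp) => [|z]; last first.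
  by rewrite mule_ge0// lee_fin mulr_ge0// gauss_rV_pdf_ge0.
rewrite ge0_integral_gauss; last 2 first.
- exact: (measurable_fun_fubini_tonelli_F _ mF).
- by move=> x; apply: integral_ge0.
apply: eq_integral => x _; rewrite /fubini_F /=.
have mFx : measurable_fun setT (fun y => F (x, y)).
  exact: (measurableT_comp mF (measurable_pair1 x)).
rewrite ge0_integral_gauss// -ge0_integralZr//; last 2 first.
- exact: (emeasurable_funM mFx mpdf).
- by move=> y _; rewrite mule_ge0.
by apply: eq_integral => y _; rewrite -muleA -EFinM [(gauss_rV_pdf x * _)%R]mulrC.
Qed.

(** The product of the Lebesgue measures is rotation invariant, and the joint density depends only
    on |x|^2 + |y|^2. *)
Lemma ge0_integral_rot c s (F : V * V -> \bar R) : s != 0%R ->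
  (c ^+ 2 + s ^+ 2 = 1)%R ->
  measurable_fun setT F -> (forall z, 0 <= F z) ->
  \int[g \x g]_z F (rot c s z) = \int[g \x g]_z F z.
Proof.
move=> s0 cs1 mF F0.
have mFr := measurableT_comp mF (measurable_rot c s).
rewrite (ge0_integral_gauss2 mFr (fun z => F0 _)) (ge0_integral_gauss2 mF F0).
pose pp (z : V * V) := (gauss_rV_pdf z.1 * gauss_rV_pdf z.2)%:E.
have ppE z : pp (rot c s z) = pp z.
  rewrite /pp /gauss_rV_pdf; congr EFin.
  rewrite mulrACA [RHS]mulrACA -!expRD !enorm_sqr; congr (_ * expR _)%R.
  by rewrite -!opprD -!mulrDl sumsq_rot.
have mpp : measurable_fun setT (fun z => F z * pp z).
  apply: (emeasurable_funM mF).
  rewrite (_ : pp = fun z : V * V => (gauss_rV_pdf z.1)%:E * (gauss_rV_pdf z.2)%:E)//.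
  have mpdf : measurable_fun setT (fun x : V => (gauss_rV_pdf x)%:E).
    by apply/measurable_EFinP; exact: measurable_gauss_rV_pdf.
  by apply: emeasurable_funM; exact: measurableT_comp mpdf _.
rewrite -(ge0_integral_lebesgue_rot s0 cs1 mpp).
  by apply: eq_integral => z _; rewrite ppE.
by move=> z; rewrite mule_ge0// lee_fin mulr_ge0// gauss_rV_pdf_ge0.
Qed.

Lemma integral_rot c s (F : V * V -> \bar R) : s != 0%R ->
  (c ^+ 2 + s ^+ 2 = 1)%R -> measurable_fun setT F ->
  \int[g \x g]_z F (rot c s z) = \int[g \x g]_z F z.
Proof.
move=> s0 cs1 mF; rewrite [LHS]integralE [RHS]integralE.
rewrite -(ge0_integral_rot s0 cs1 (measurable_funepos mF))//.
rewrite -(ge0_integral_rot s0 cs1 (measurable_funeneg mF))//.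
by congr (_ - _); apply: eq_integral => z _; rewrite ?funeposE ?funenegE.
Qed.

Lemma integrable_rot c s (F : V * V -> \bar R) : s != 0%R ->
  (c ^+ 2 + s ^+ 2 = 1)%R -> (g \x g).-integrable setT F ->
  (g \x g).-integrable setT (F \o rot c s).
Proof.
move=> s0 cs1 /integrableP[mF iF]; apply/integrableP; split.
  exact: (measurableT_comp mF (measurable_rot c s)).
rewrite (ge0_integral_rot (F := fun z => `|F z|) s0 cs1)//.
exact: measurableT_comp.
Qed.

End rotation.

Section moment.
Local Open Scope ereal_scope.
Context {R : realType}.
Local Notation np := (fun t : R => (normal_pdf 0 1 t)%:E).

Lemma integral_gauss_cst n (k : \bar R) : \int[gauss_rV R n]_x k = k.
Proof.
rewrite (integral_cst (gauss_rV R n) measurableT) [X in _ * X](_ : _ = 1) ?mule1//.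
exact: gauss_rV_setT.
Qed.

Lemma np_ge0 (t : R) : 0 <= np t. Proof. by rewrite lee_fin normal_pdf_ge0. Qed.

Lemma ge0_integral_gauss1 (h : R -> \bar R) : measurable_fun setT h ->
  (forall x, 0 <= h x) ->
  \int[gauss_rV R 1]_v h (v ord0 ord0) = \int[lebesgue_measure]_t (np t * h t).
Proof.
move=> mh h0.
rewrite (ge0_integral_gauss_cons (F := fun v => h (v ord0 ord0)))//; last first.
  exact: (measurableT_comp mh (measurable_coor ord0)).
apply: eq_integral => t _; congr (_ * _).
under eq_integral do rewrite mxE unlift_none /=.
exact: integral_gauss_cst.
Qed.

Let integral_normal_cst (k : \bar R) : 0 <= k -> \int[lebesgue_measure]_t (np t * k) = k.
Proof.
move=> k0; rewrite ge0_integralZr//.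
- by rewrite integral_normal_pdf mul1e.
- exact: measurable_normal_pdf01.
- by move=> t _; exact: np_ge0.
Qed.

Let ge0_integral_normal_rot_neq0 (h : R -> \bar R) (c s : R) : s != 0%R ->
  (c ^+ 2 + s ^+ 2 = 1)%R -> measurable_fun setT h -> (forall x, 0 <= h x) ->
  \int[lebesgue_measure]_t (np t * \int[lebesgue_measure]_u (np u * h (c * t + s * u)%R)) =
  \int[lebesgue_measure]_t (np t * h t).
Proof.
move=> s0 cs1 mh h0.
pose F (z : 'rV[R]_1 * 'rV[R]_1) := h (z.1 ord0 ord0).
have mF : measurable_fun setT F.
  apply: (measurableT_comp mh); exact: (measurableT_comp (measurable_coor ord0) measurable_fst).
have mhl t : measurable_fun setT (fun u : R => h (c * t + s * u)%R).
  apply: (measurableT_comp mh).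
  by apply: measurable_funD => //; exact: measurable_funM.
have := ge0_integral_rot s0 cs1 mF (fun z => h0 _).
have mFr := measurableT_comp mF (measurable_rot c s).
rewrite (fubini_tonelli1 _ mF (fun z => h0 _)) (fubini_tonelli1 _ mFr (fun z => h0 _)).
rewrite /fubini_F /F /rot /=.
under eq_integral => x _.
  under eq_integral do rewrite !mxE.
  rewrite (ge0_integral_gauss1 (mhl _) (fun=> h0 _)); over.
under [in RHS]eq_integral => x _.
  rewrite integral_gauss_cst; over.
rewrite (ge0_integral_gauss1 mh h0).
rewrite (@ge0_integral_gauss1 (fun t => \int[lebesgue_measure]_u (np u * h (c * t + s * u)%R)))//.
  pose k (z : measurableTypeR R * measurableTypeR R) := np z.2 * h (c * z.1 + s * z.2)%R.
  apply: (@measurable_fun_fubini_tonelli_F _ _ _ _ _ (@lebesgue_measure R) k).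
    apply: emeasurable_funM.
      exact: (measurableT_comp measurable_normal_pdf01 measurable_snd).
    apply: (measurableT_comp mh).
    by apply: measurable_funD; apply: measurable_funM.
  by move=> z; rewrite mule_ge0// np_ge0.
by move=> x; apply: integral_ge0 => u _; rewrite mule_ge0// np_ge0.
Qed.

(** Stability of the normal law, read off from the rotation invariance in dimension 1. The
    degenerate case s = 0 occurs in [ge0_integral_gauss_dotr], when all coordinates of the vector
    but the first vanish. *)
Lemma ge0_integral_normal_rot (h : R -> \bar R) (c s : R) :
  (c ^+ 2 + s ^+ 2 = 1)%R -> measurable_fun setT h -> (forall x, 0 <= h x) ->
  \int[lebesgue_measure]_t (np t * \int[lebesgue_measure]_u (np u * h (c * t + s * u)%R)) =
  \int[lebesgue_measure]_t (np t * h t).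
Proof.
move=> cs1 mh h0; have [s0|s0] := eqVneq s 0%R; last exact: ge0_integral_normal_rot_neq0.
have N0 (k : R -> \bar R) : (forall x, 0 <= k x) -> 0 <= \int[lebesgue_measure]_t (np t * k t).
  by move=> k0; apply: integral_ge0 => u _; rewrite mule_ge0// np_ge0.
transitivity (\int[lebesgue_measure]_t (np t * h (c * t)%R)).
  apply: eq_integral => t _; congr (_ * _).
  transitivity (\int[lebesgue_measure]_u (np u * h (c * t)%R)).
    by apply: eq_integral => u _; rewrite s0 mul0r addr0.
  exact: integral_normal_cst.
have : c == 1%R \/ c == (-1)%R.
  by apply/orP; rewrite -eqf_sqr expr1n -cs1 s0 expr0n addr0.
move=> [/eqP->|/eqP->]; first by under eq_integral do rewrite mul1r.
(* For c = -1 the claim is the symmetry of the normal law, which is the rotation with c = 0 and s =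
   -1. *)
have := @ge0_integral_normal_rot_neq0 h 0 (-1).
rewrite oppr_eq0 oner_neq0 expr0n add0r sqrrN expr1n => /(_ isT erefl mh h0) <-.
set k := LHS; transitivity (\int[lebesgue_measure]_t (np t * k)).
  by apply/esym/integral_normal_cst; exact: (N0 (fun t => h (-1 * t)%R)).
by apply: eq_integral => t _; congr (_ * _); apply: eq_integral => u _; rewrite mul0r add0r.
Qed.

Lemma sumsq_eq0 n (x : 'rV[R]_n) : sumsq x = 0%R -> x = 0%R.
Proof.
move=> /eqP; rewrite psumr_eq0 => [|i _]; last exact: sqr_ge0.
move=> /allP x0; apply/rowP => i; rewrite mxE.
by have := x0 i (mem_index_enum i); rewrite sqrf_eq0 => /eqP.
Qed.

Definition dotr n (x y : 'rV[R]_n) : R := (\sum_(i < n) x ord0 i * y ord0 i)%R.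

Lemma measurable_dotr n (a : 'rV[R]_n) : measurable_fun setT (fun v => dotr v a).
Proof.
apply: measurable_sum => i; apply: measurable_funM => //; exact: measurable_coor.
Qed.

(** The image of the Gaussian measure under v -> <v, a> is normal with deviation |a|. By induction
    on n: the first coordinate a_0 and the remainder a' contribute independent normal variables, and
    writing (a_0, |a'|) = |a| (c, s) with c^2 + s^2 = 1 reduces their sum to
    [ge0_integral_normal_rot]. *)
Lemma ge0_integral_gauss_dotr n (a : 'rV[R]_n) (h : R -> \bar R) :
  measurable_fun setT h -> (forall x, 0 <= h x) ->
  \int[gauss_rV R n]_v h (dotr v a) =
  \int[lebesgue_measure]_t (np t * h (enorm a * t)%R).
Proof.
move=> mh h0; elim: n a h mh h0 => [|n IH] a h mh h0.
  have -> : enorm a = 0%R by rewrite /enorm big_ord0 sqrtr0.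
  under eq_integral do rewrite /dotr big_ord0.
  rewrite integral_gauss_cst.
  under eq_integral do rewrite mul0r.
  by rewrite integral_normal_cst.
rewrite ge0_integral_gauss_cons//; last exact: (measurableT_comp mh (measurable_dotr a)).
pose a' : 'rV[R]_n := (\row_j a ord0 (lift ord0 j))%R.
have dot_cons t (x : 'rV[R]_n) : dotr (rV_cons (t, x)) a = (t * a ord0 ord0 + dotr x a')%R.
  rewrite /dotr big_ord_recl mxE unlift_none; congr (_ + _)%R.
  by apply: eq_bigr => i _; rewrite !mxE liftK.
have rho2 : (enorm a ^+ 2 = a ord0 ord0 ^+ 2 + enorm a' ^+ 2)%R.
  rewrite !enorm_sqr [a]rV_consK sumsq_cons mxE unlift_none.
  by congr (_ + sumsq _)%R; apply/rowP => i; rewrite !mxE liftK mxE.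
have [c [s [ac as_ cs1]]] : exists c s : R, [/\ (a ord0 ord0 = enorm a * c)%R,
    (enorm a' = enorm a * s)%R & (c ^+ 2 + s ^+ 2 = 1)%R].
  have [r0|r0] := eqVneq (enorm a) 0%R.
    move: rho2; rewrite r0 expr0n/= => /esym/eqP.
    rewrite paddr_eq0 ?sqr_ge0// !sqrf_eq0 => /andP[/eqP-> /eqP->].
    by exists 1%R, 0%R; rewrite !mul0r expr1n expr0n addr0.
  exists (a ord0 ord0 / enorm a)%R, (enorm a' / enorm a)%R; split.
  - by rewrite mulrC divfK.
  - by rewrite mulrC divfK.
  - by rewrite !expr_div_n -mulrDl -rho2 divff// sqrf_eq0.
have mha : measurable_fun setT (fun t => h (enorm a * t)%R).
  by apply: (measurableT_comp mh); exact: measurable_funM.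
rewrite -(ge0_integral_normal_rot cs1 mha)//.
apply: eq_integral => t _; congr (_ * _).
under eq_integral do rewrite dot_cons.
rewrite (IH a' (fun x => h (t * a ord0 ord0 + x)%R))//; last first.
  by apply: (measurableT_comp mh); exact: measurable_funD.
apply: eq_integral => u _; congr (_ * h _); rewrite ac as_; ring.
Qed.

End moment.

Section gauss_moment.
Context {R : realType}.
Implicit Types r s : R.

Let J r (s : R) : R := `|s| `^ r * expR (- (s ^+ 2 / 2)).

Let J_ge0 r s : 0 <= J r s.
Proof. by rewrite mulr_ge0 ?powR_ge0 ?expR_ge0. Qed.

Let measurable_J r : measurable_fun setT (J r).
Proof.
apply: measurable_funM.
  exact: (measurableT_comp (measurable_powR r) (@normr_measurable R setT)).
apply: measurableT_comp => //; apply: measurableT_comp => //.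
by apply: measurable_funM => //; exact: measurable_funX.
Qed.

(** From r ln|s| <= r|s| <= r^2 + s^2/4, half of the Gaussian exponent survives: the majorant is a
    multiple of the normal density of variance 2. *)
Let J_le r s : 0 < r -> J r s <= expR (r ^+ 2) * (normal_peak (Num.sqrt 2))^-1 * normal_pdf 0 (Num.sqrt 2) s.
Proof.
move=> r0; have s2 : Num.sqrt 2 != 0 :> R by rewrite sqrtr_eq0 -ltNge.
have := normal_peak_gt0 s2; set pk := normal_peak _ => pk0.
rewrite normal_pdfE// -/pk mulrA mulfVK ?gt_eqF//.
rewrite /normal_fun subr0 sqr_sqrtr// -expRD /J.
have [->|sn0] := eqVneq s 0.
  by rewrite normr0 powR0 ?gt_eqF// mul0r expR_ge0.
rewrite /powR normr_eq0 (negbTE sn0) -expRD ler_expR.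
have ls : ln `|s| <= `|s|.
  rewrite -ler_expR lnK ?posrE ?normr_gt0//.
  by rewrite (le_trans _ (expR_ge1Dx _))// lerDr.
have : r * ln `|s| <= r * `|s| by rewrite ler_pM2l.
have : r * `|s| <= r ^+ 2 + s ^+ 2 / 4.
  rewrite -[s ^+ 2](real_normK (num_real s)).
  have := sqr_ge0 (r - `|s| / 2).
  nra.
by lra.
Qed.

Lemma integrable_gauss_moment r : 0 < r ->
  (@lebesgue_measure R).-integrable setT (EFin \o J r).
Proof.
move=> r0; set K := expR (r ^+ 2) * (normal_peak (Num.sqrt 2))^-1.
have iK : (@lebesgue_measure R).-integrable setT
    (fun s => K%:E * (normal_pdf 0 (Num.sqrt 2) s)%:E)%E.
  exact: integrableZl (integrable_normal_pdf _ _).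
apply: le_integrable iK => //.
  by apply/measurable_EFinP; exact: measurable_J.
by move=> s _ /=; rewrite lee_fin !ger0_norm ?J_le ?(le_trans _ (J_le _ _))// J_ge0.
Qed.

Lemma gauss_momentE r : 0 < r ->
  (\int[lebesgue_measure]_s ((normal_pdf 0 1 s)%:E * (`|s| `^ r)%:E))%E =
  (gauss_moment r `^ r)%:E.
Proof.
move=> r0; have iJ := integrable_gauss_moment r0.
rewrite /gauss_moment -powRrM mulVf ?gt_eqF// powRr1; last first.
  by rewrite mulr_ge0 ?powR_ge0// Rintegral_ge0.
rewrite EFinM /Rintegral fineK; last exact: integrable_fin_num.
rewrite -ge0_integralZl//=.
- by apply: eq_integral => s _; rewrite normal_pdf01 -!EFinM mulrAC mulrA.
- by apply/measurable_EFinP; exact: measurable_J.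
- by rewrite lee_fin powR_ge0.
Qed.

(** On [1, 2] the integrand is at least e^(-2). Strict positivity matters: it keeps the inequality
    strict in [mehler_gradient_dual_bound]. *)
Lemma gauss_moment_gt0 r : 0 < r -> 0 < gauss_moment r.
Proof.
move=> r0; have iJ := integrable_gauss_moment r0.
rewrite /gauss_moment powR_gt0// mulr_gt0//.
  by rewrite powR_gt0// mulr_gt0// pi_gt0.
apply: (@lt_le_trans _ _ (expR (- 2))); first exact: expR_gt0.
rewrite -lee_fin /Rintegral fineK; last exact: integrable_fin_num.
apply: (@le_trans _ _ (\int[lebesgue_measure]_(s in `[1%R, 2%R]) (J r s)%:E)%E).
  apply: (@le_trans _ _ (\int[lebesgue_measure]_(s in `[1%R, 2%R]) (expR (- 2))%:E)%E).
    rewrite integral_cst//= lebesgue_measure_itv/= lte_fin ltr1n.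
    by rewrite -EFinD -EFinM lee_fin; lra.
  apply: ge0_le_integral => //=.
  - by apply/measurable_EFinP/measurable_funTS; exact: measurable_J.
  - move=> s; rewrite in_itv/= => /andP[s1 s2].
    rewrite lee_fin /J ger0_norm ?(le_trans ler01)//.
    rewrite -[leLHS]mul1r ler_pM ?expR_ge0//.
      by rewrite -[leLHS](powRr0 s) ler_powR// ltW.
    by rewrite ler_expR; nra.
apply: ge0_subset_integral => //=.
- by apply/measurable_EFinP; exact: measurable_J.
- by move=> s _; rewrite lee_fin J_ge0.
Qed.

(** The origin of the constant C(r), and the reason why it does not depend on the dimension. *)
Lemma ge0_integral_gauss_dotr_powR n (a : 'rV[R]_n) r : 0 < r ->
  (\int[gauss_rV R n]_v (`|dotr v a| `^ r)%:E =
   ((gauss_moment r * enorm a) `^ r)%:E)%E.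
Proof.
move=> r0.
have mh : measurable_fun setT (fun x : R => (`|x| `^ r)%:E).
  apply/measurable_EFinP.
  exact: (measurableT_comp (measurable_powR r) (@normr_measurable R setT)).
rewrite (ge0_integral_gauss_dotr a mh) => [|x]; last by rewrite lee_fin powR_ge0.
rewrite powRM ?enorm_ge0 ?(ltW (gauss_moment_gt0 r0))// EFinM -gauss_momentE//.
rewrite -ge0_integralZr; last 4 first.
- exact: measurableT.
- by apply: emeasurable_funM => //; exact: measurable_normal_pdf01.
- by move=> t _; rewrite mule_ge0// lee_fin ?normal_pdf_ge0 ?powR_ge0.
- by rewrite lee_fin powR_ge0.
apply: eq_integral => t _; rewrite -!EFinM; congr EFin.
by rewrite normrM powRM// (ger0_norm (enorm_ge0 a)); ring.
Qed.

End gauss_moment.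

Section probability_integrals.
Context d (T : measurableType d) (R : realType) (P : probability T R).

Lemma integrable_bounded (f : T -> R) (M : R) : measurable_fun setT f ->
  (forall x, `|f x| <= M) -> P.-integrable setT (EFin \o f).
Proof.
move=> mf fM; apply: (@le_integrable _ _ _ P _ measurableT _ (cst M%:E)).
- exact/measurable_EFinP.
- by move=> x _ /=; rewrite lee_fin (le_trans (fM x))// ler_norm.
- apply/integrableP; split; first exact: measurable_cst.
  rewrite integral_cst//= [X in (_ * X)%E](_ : _ = 1%E) ?mule1 ?ltry//.
  exact: probability_setT.
Qed.

End probability_integrals.

(** * Translations of the Gaussian measure and integration by parts *)

Section cameron_martin.
Context {R : realType} {n : nat}.
Local Notation V := 'rV[R]_n.
Local Notation g := (gauss_rV R n).
Implicit Types b x y : V.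

Definition cm_density b y : R := expR (dotr y b - sumsq b / 2).

Lemma measurable_cm_density b : measurable_fun setT (cm_density b).
Proof.
apply: measurableT_comp => //; apply: measurable_funB => //.
exact: measurable_dotr.
Qed.

Lemma gauss_rV_pdf_shift b y : gauss_rV_pdf (y - b) = gauss_rV_pdf y * cm_density b y.
Proof.
rewrite /gauss_rV_pdf /cm_density -mulrA -expRD; congr (_ * expR _).
rewrite !enorm_sqr /sumsq /dotr.
have -> : \sum_(i < n) (y - b) ord0 i ^+ 2 = \sum_(i < n) y ord0 i ^+ 2
    - 2 * \sum_(i < n) y ord0 i * b ord0 i + \sum_(i < n) b ord0 i ^+ 2.
  rewrite mulr_sumr -sumrB -big_split/=; apply: eq_bigr => i _.
  by rewrite !mxE; ring.
by field.
Qed.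

Lemma ge0_integral_gauss_shift b (F : V -> \bar R) : measurable_fun setT F ->
  (forall x, 0 <= F x)%E ->
  (\int[g]_y F (y + b)%R = \int[g]_y (F y * (cm_density b y)%:E))%E.
Proof.
move=> mF F0.
have mD c : measurable_fun setT (fun y : V => y + c).
  have := @measurable_rV_affine R n _ _ 1 1 _ _ (@measurable_id _ V setT) (measurable_cst c).
  by under eq_fun do rewrite !scale1r.
have mFb : measurable_fun setT (fun y => F (y + b)) := measurableT_comp mF (mD b).
have mp : measurable_fun setT (fun x : V => (gauss_rV_pdf x)%:E).
  by apply/measurable_EFinP; exact: measurable_gauss_rV_pdf.
have mcm : measurable_fun setT (fun x : V => (cm_density b x)%:E).
  by apply/measurable_EFinP; exact: measurable_cm_density.
rewrite (ge0_integral_gauss mFb (fun y => F0 _)).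
have mFc := emeasurable_funM mF mcm.
rewrite (ge0_integral_gauss mFc) => [|y]; last by rewrite mule_ge0// lee_fin expR_ge0.
rewrite -(ge0_integral_rV_shift (- b) (emeasurable_funM mFb mp)); last first.
  by move=> y; rewrite mule_ge0// lee_fin gauss_rV_pdf_ge0.
apply: eq_integral => y _; rewrite subrK gauss_rV_pdf_shift EFinM.
by rewrite [RHS]muleAC muleA.
Qed.

Lemma integral_gauss_shift b (F : V -> \bar R) : measurable_fun setT F ->
  (\int[g]_y F (y + b)%R = \int[g]_y (F y * (cm_density b y)%:E))%E.
Proof.
move=> mF; rewrite [LHS]integralE [RHS]integralE.
have cm0 y : (0 <= (cm_density b y)%:E)%E by rewrite lee_fin expR_ge0.
have -> : (\int[g]_x ((fun y => F (y + b)%R)^\+ x) =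
    \int[g]_x (F^\+ x * (cm_density b x)%:E))%E.
  rewrite -(ge0_integral_gauss_shift b (measurable_funepos mF))//.
  by apply: eq_integral => y _; rewrite !funeposE.
have -> : (\int[g]_x ((fun y => F (y + b)%R)^\- x) =
    \int[g]_x (F^\- x * (cm_density b x)%:E))%E.
  rewrite -(ge0_integral_gauss_shift b (measurable_funeneg mF))//.
  by apply: eq_integral => y _; rewrite !funenegE.
congr (_ - _)%E; apply: eq_integral => x _.
  by rewrite !funeposE maxe_pMl// mul0e.
by rewrite !funenegE maxe_pMl// mul0e mulNe.
Qed.

Lemma Rintegral_gauss_shift b (F : V -> R) : measurable_fun setT F ->
  \int[g]_y F (y + b) = \int[g]_y (F y * cm_density b y).
Proof.
move=> mF; rewrite /Rintegral; congr fine.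
have /(integral_gauss_shift b) := (measurable_EFinP _ _).2 mF.
by move=> ->; apply: eq_integral => y _; rewrite EFinM.
Qed.

End cameron_martin.

Section bounded_support.
Context {R : realType} {n : nat}.
Implicit Types f : 'rV[R]_n -> R.

Lemma continuous_bounded_support f : continuous f -> bounded_support f ->
  exists2 M : R, 0 <= M & forall x, `|f x| <= M.
Proof.
move=> cf [N fN].
have cK : compact [set x : 'rV[R]_n | `|x| <= N].
  apply: bounded_closed_compact.
    exists N; split; first exact: num_real.
    by move=> M /ltW NM x /= xN; exact: le_trans NM.
  rewrite (_ : [set _ | _] = Num.norm @^-1` [set r | r <= N])//.
  by apply: closed_comp => [x _|]; [exact: norm_continuous|exact: closed_le].
have [M [_ MP]] := compact_bounded (continuous_compact (continuous_subspaceT cf) cK).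
exists (`|M| + 1) => [|x]; first by rewrite addr_ge0.
have [->|fx] := eqVneq (f x) 0; first by rewrite normr0 addr_ge0.
apply: MP; first by rewrite ltr_pwDr// ler_norm.
by exists x => //; exact: fN.
Qed.

Lemma bounded_support_partial f i : bounded_support f -> bounded_support (partial i f).
Proof.
move=> [N fN]; exists N => x; apply: contra_neqT; rewrite -ltNge => Nx.
have E : \forall y \near x, (fun=> 0 : R) y = f y.
  have oN : open [set y : 'rV[R]_n | N < `|y|].
    rewrite (_ : [set _ | _] = Num.norm @^-1` [set r | N < r])//.
    by apply: open_comp => [y _|]; [exact: norm_continuous|exact: open_gt].
  have := open_nbhs_nbhs (conj oN Nx); apply: filterS => y /= Ny.
  by apply/esym/eqP; apply: contraTT Ny => fy; rewrite -leNgt fN.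
by have [_] := near_eq_is_derive E (is_derive_cst (0 : R) x (delta_mx ord0 i)).
Qed.

End bounded_support.

Lemma is_derive_Rintegral {R : realType} d (T : measurableType d)
    (mu : {measure set T -> \bar R}) (f f' : R -> T -> R) (G : T -> R) (a : R) :
  (forall t, mu.-integrable setT (EFin \o f t)) ->
  (forall (t : R) y, is_derive t 1 (f ^~ y) (f' t y)) ->
  mu.-integrable setT (EFin \o G) ->
  (forall t y, `|t - a| < 1 -> `|f' t y| <= G y) ->
  is_derive a 1 (fun t => \int[mu]_y f t y) (\int[mu]_y f' a y).
Proof.
move=> intf df intG f'G.
have Ia : `](a - 1), (a + 1)[%classic a by rewrite /= in_itv/= ltrBlDr !ltrDl ltr01.
have G0 y : 0 <= G y by apply: le_trans (f'G a y _); rewrite ?subrr ?normr0.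
have intf' t : `](a - 1), (a + 1)[%classic t -> mu.-integrable setT (EFin \o f t).
  by move=> _; exact: intf.
have df' t y : `](a - 1), (a + 1)[%classic t -> setT y -> derivable (f ^~ y) t 1.
  by move=> _ _; have [] := df t y.
have E t y : partial1of2 f t y = f' t y.
  by rewrite partial1of2E; have [] := df t y.
have ub t y : `](a - 1), (a + 1)[%classic t -> setT y -> `|partial1of2 f t y| <= G y.
  rewrite /= in_itv/= => /andP[t1 t2] _; rewrite E; apply: f'G.
  by rewrite ltr_distl t1 t2.
apply: DeriveDef.
  exact: (derivable_under_integral measurableT Ia intf' df' G0 intG ub).
rewrite -derive1E (differentiation_under_integral measurableT Ia intf' df' G0 intG ub).
by apply: eq_Rintegral => y _; rewrite E.
Qed.

Lemma is_derive_expR_quad {R : realType} (k a t : R) :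
  is_derive t 1 (fun s : R => k * expR (s * a - s ^+ 2 / 2))
    (k * (expR (t * a - t ^+ 2 / 2) * (a - t))).
Proof.
have dq : is_derive t 1 (fun s : R => s * a - s ^+ 2 / 2) (a - t).
  have := is_deriveD (is_derive_affine_real 0 a t)
    (is_deriveZ (- 2^-1) (is_deriveM (is_derive_id t 1) (is_derive_id t 1))).
  have -> : (fun s : R => 0 + a * s) + - 2^-1 \*: (@id R * @id R) =
            (fun s : R => s * a - s ^+ 2 / 2).
    by apply/funext => s; change (0 + a * s + - 2^-1 * (s * s) = s * a - s ^+ 2 / 2); field.
  move=> d; apply: (is_derive_eq d).
  by change (a + - 2^-1 * (t * 1 + t * 1) = a - t); field.
exact: (is_deriveZ k (is_derive1_comp (is_derive_expR _) dq)).
Qed.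

Lemma dotr_delta {R : realType} {n : nat} (y : 'rV[R]_n) (t : R) i :
  dotr y (t *: delta_mx ord0 i) = t * y ord0 i.
Proof.
rewrite /dotr (bigD1 i)//= !mxE !eqxx mulr1 big1 ?addr0 1?mulrC// => j ji.
by rewrite !mxE (negbTE ji) andbF !mulr0.
Qed.

Lemma sumsq_delta {R : realType} {n : nat} (t : R) (i : 'I_n) :
  sumsq (t *: delta_mx ord0 i : 'rV[R]_n) = t ^+ 2.
Proof.
rewrite /sumsq (bigD1 i)//= !mxE !eqxx mulr1 big1 ?addr0// => j ji.
by rewrite !mxE (negbTE ji) andbF mulr0 expr0n.
Qed.

Section integration_by_parts.
Context {R : realType} {n : nat}.
Local Notation V := 'rV[R]_n.
Local Notation g := (gauss_rV R n).
Implicit Types (psi : V -> R) (i : 'I_n).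

Let e_ i : V := delta_mx ord0 i.

(** Cameron-Martin equates the means of psi(y + t e_i) and of psi(y) exp(t y_i - t^2/2); both sides
    are differentiated under the integral at t = 0. *)
Lemma Rintegral_gauss_by_parts psi i : smooth psi -> bounded_support psi ->
  \int[g]_y partial i psi y = \int[g]_y (y ord0 i * psi y).
Proof.
move=> spsi bpsi.
have [N' psiN'] := bpsi.
pose N := Num.max N' 0.
have N0 : 0 <= N by rewrite le_max lexx orbT.
have psiN y : psi y != 0 -> `|y| <= N by move=> /psiN' yN; rewrite le_max yN.
have cpsi := smooth_continuous spsi.
have mpsi := continuous_measurable_rV cpsi.
have [M M0 psiM] := continuous_bounded_support cpsi bpsi.
have [M' M'0 psiM'] := continuous_bounded_support
  (smooth_continuous (smooth_partial i spsi)) (bounded_support_partial i bpsi).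
pose f1 (t : R) (y : V) := psi (y + t *: e_ i).
pose f2 (t : R) (y : V) := psi y * expR (t * y ord0 i - t ^+ 2 / 2).
have mD (c : V) : measurable_fun setT (fun y : V => y + c).
  have := @measurable_rV_affine R n _ _ 1 1 _ _ (@measurable_id _ V setT) (measurable_cst c).
  by under eq_fun do rewrite !scale1r.
have mf1 t : measurable_fun setT (f1 t) := measurableT_comp mpsi (mD _).
have mf2 t : measurable_fun setT (f2 t).
  apply: measurable_funM => //; apply: measurableT_comp => //.
  apply: measurable_funB => //; apply: measurable_funM => //; exact: measurable_coor.
have f12 t : \int[g]_y f1 t y = \int[g]_y f2 t y.
  rewrite (Rintegral_gauss_shift (t *: e_ i) mpsi); apply: eq_Rintegral => y _.
  by rewrite /f2 /cm_density dotr_delta sumsq_delta.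
have d1 (t : R) y : is_derive t 1 (f1 ^~ y) (partial i psi (y + t *: e_ i)).
  exact: (is_derive_line y t (fun z => @smooth_derivable _ _ _ spsi i z)).
have d2 (t : R) y : is_derive t 1 (f2 ^~ y)
    (psi y * (expR (t * y ord0 i - t ^+ 2 / 2) * (y ord0 i - t))).
  exact: is_derive_expR_quad.
have q_le (t : R) (y : V) : `|y ord0 i| <= N -> t * y ord0 i - t ^+ 2 / 2 <= `|t| * N.
  move=> yN; rewrite (@le_trans _ _ (t * y ord0 i))//.
    by rewrite gerBl divr_ge0// sqr_ge0.
  by rewrite (le_trans (ler_norm _))// normrM ler_wpM2l.
have f2_le (t : R) y : `|f2 t y| <= M * expR (`|t| * N).
  have [psi0|psi0] := eqVneq (psi y) 0.
    by rewrite /f2 psi0 mul0r normr0 mulr_ge0// expR_ge0.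
  rewrite normrM ler_pM// ger0_norm ?expR_ge0// ler_expR; apply: q_le => //.
  exact: le_trans (ler_coor_norm _ _) (psiN _ psi0).
have ig1 t : g.-integrable setT (EFin \o f1 t).
  by apply: (integrable_bounded (M := M) g (mf1 t)) => y; exact: psiM.
have igc (c : R) : g.-integrable setT (EFin \o (cst c : V -> R)).
  exact: (integrable_bounded (M := `|c|) g (measurable_cst c)).
have F1 := is_derive_Rintegral (a := 0) ig1 d1 (igc M') (fun t y _ => psiM' _).
have {}F1 : is_derive (0 : R) 1 (fun t => \int[g]_y f1 t y) (\int[g]_y partial i psi y).
  apply: (is_derive_eq F1); apply: eq_Rintegral => y _.
  by rewrite scale0r addr0.
have ig2 t : g.-integrable setT (EFin \o f2 t).
  apply: (integrable_bounded (M := M * expR (`|t| * N)) g (mf2 t)) => y.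
  exact: f2_le.
have d2_le (t : R) y : `|t - 0| < 1 ->
    `|psi y * (expR (t * y ord0 i - t ^+ 2 / 2) * (y ord0 i - t))| <=
    M * (expR N * (N + 1)).
  rewrite subr0 => t1.
  have [psi0|psi0] := eqVneq (psi y) 0.
    by rewrite psi0 mul0r normr0 !mulr_ge0 ?expR_ge0// addr_ge0.
  have yN : `|y ord0 i| <= N by exact: le_trans (ler_coor_norm _ _) (psiN _ psi0).
  rewrite normrM; apply: ler_pM => //; rewrite normrM; apply: ler_pM => //.
    rewrite ger0_norm ?expR_ge0// ler_expR (le_trans (q_le _ _ yN))//.
    by rewrite ler_piMl// ltW.
  by rewrite (le_trans (ler_normB _ _))// lerD// ltW.
have F2 := is_derive_Rintegral (a := 0) ig2 d2 (igc _) d2_le.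
have {}F2 : is_derive (0 : R) 1 (fun t => \int[g]_y f2 t y) (\int[g]_y (y ord0 i * psi y)).
  apply: (is_derive_eq F2); apply: eq_Rintegral => y _.
  by rewrite !(mul0r, expr0n, subr0, mul0r, expR0, mul1r) mulrC.
have [_ <-] := F1; have [_ <-] := F2.
by have -> : (fun t => \int[g]_y f1 t y) = (fun t => \int[g]_y f2 t y) by apply/funext.
Qed.

End integration_by_parts.

(** * Generalized gradients *)

Section generalized_gradient.
Context {R : realType} {n : nat}.
Local Notation V := 'rV[R]_n.
Local Notation g := (gauss_rV R n).
Local Notation lam := (lebesgue_rV R n).
Implicit Types (psi phi u : V -> R) (G : V -> V).

Lemma test_functionP phi : test_function phi <-> smooth phi /\ bounded_support phi.
Proof. by split=> -[sphi /compact_support_bounded]. Qed.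

Lemma is_derive_expR_sumsq (a : R) i x : is_derive x (delta_mx ord0 i)
  (fun x : V => expR (a * sumsq x)) (expR (a * sumsq x) * (a * (2 * x ord0 i))).
Proof.
exact: (is_derive_comp_real (is_derive_expR _) (is_deriveZ a (partial_sumsq i x))).
Qed.

Lemma smooth_expR_sumsq (a : R) : smooth (fun x : V => expR (a * sumsq x)).
Proof. exact: (smooth_expR (smoothM (smooth_cst a) smooth_sumsq)). Qed.

Lemma gauss_rV_pdfE : @gauss_rV_pdf R n =
  fun x => (2 * pi) `^ (- (n%:R / 2)) * expR (- 2^-1 * sumsq x).
Proof.
apply/funext => x; rewrite /gauss_rV_pdf enorm_sqr; congr (_ * expR _).
by rewrite mulNr mulrC.
Qed.

Lemma smooth_gauss_rV_pdf : smooth (@gauss_rV_pdf R n).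
Proof.
by rewrite gauss_rV_pdfE; exact: (smoothM (smooth_cst _) (smooth_expR_sumsq _)).
Qed.

Lemma is_derive_gauss_rV_pdf i x : is_derive x (delta_mx ord0 i) (@gauss_rV_pdf R n)
  (- x ord0 i * gauss_rV_pdf x).
Proof.
rewrite gauss_rV_pdfE.
apply: (is_derive_eq (is_deriveZ _ (is_derive_expR_sumsq (- 2^-1) i x))).
by rewrite /GRing.scale /=; field.
Qed.

Lemma partial_gauss_mul psi i x : smooth psi ->
  partial i (fun x => psi x * gauss_rV_pdf x) x =
  (partial i psi x - x ord0 i * psi x) * gauss_rV_pdf x.
Proof.
move=> spsi.
have [_] := is_deriveM (is_derive_partial i x spsi) (is_derive_gauss_rV_pdf i x).
by move=> d; rewrite [LHS]d /GRing.scale /=; ring.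
Qed.

Lemma Rintegral_gauss (F : V -> R) : measurable_fun setT F ->
  \int[g]_x F x = \int[lam]_x (F x * gauss_rV_pdf x).
Proof.
move=> mF; rewrite /Rintegral (integral_gauss ((measurable_EFinP _ _).2 mF)).
by congr fine; apply: eq_integral => x _; rewrite EFinM.
Qed.

Lemma smooth_measurable phi : smooth phi -> measurable_fun setT phi.
Proof. by move=> sphi; apply: continuous_measurable_rV; exact: smooth_continuous. Qed.

Lemma loc_integrable_measurable u : loc_integrable u -> measurable_fun setT u.
Proof.
move=> lu; pose K (N : nat) : set V := [set x | `|x| <= N%:R].
have KT : \bigcup_N K N = setT.
  rewrite -subTset => x _; exists (Num.truncn `|x|).+1 => //=.
  by rewrite /K /= ltW// truncnS_gt.
have cK N : compact (K N).
  apply: bounded_closed_compact.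
    exists N%:R; split; first exact: num_real.
    by move=> M /ltW NM x /= xN; exact: le_trans NM.
  rewrite (_ : K N = Num.norm @^-1` [set r | r <= N%:R])//.
  by apply: closed_comp => [x _|]; [exact: norm_continuous|exact: closed_le].
rewrite -KT; apply/measurable_fun_bigcup => [N|N]; first exact: compact_measurable_rV.
by have /integrableP[/measurable_EFinP] := lu _ (cK N).
Qed.

(** On a compact set the Gaussian density is bounded below by a positive constant, since |x|^2 <= n
    B^2 when all coordinates are bounded by B; the Lebesgue integral is then at most a multiple of
    the Gaussian one. *)
Lemma gauss_integrable_loc u : g.-integrable setT (EFin \o u) -> loc_integrable u.
Proof.
move=> iu K cK; have mK := compact_measurable_rV cK.
have /integrableP[/measurable_EFinP mu iu'] := iu.
have [M [_ KM]] := compact_bounded cK.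
pose B : R := `|M| + 1.
have KB x : K x -> `|x| <= B by apply: KM; rewrite ltr_pwDr// ler_norm.
pose del : R := (2 * pi) `^ (- (n%:R / 2)) * expR (- 2^-1 * (n%:R * B ^+ 2)).
have del0 : 0 < del.
  by rewrite mulr_gt0 ?expR_gt0// powR_gt0// mulr_gt0// pi_gt0.
have delP x : K x -> del <= gauss_rV_pdf x.
  move=> Kx; rewrite gauss_rV_pdfE ler_wpM2l ?powR_ge0// ler_expR.
  rewrite !mulNr lerN2 ler_pM2l ?invr_gt0//.
  have -> : n%:R * B ^+ 2 = \sum_(i < n) B ^+ 2.
    by rewrite sumr_const card_ord mulr_natl.
  apply: ler_sum => i _; rewrite -(real_normK (num_real _)) lerXn2r ?nnegrE//.
    by rewrite addr_ge0.
  exact: le_trans (ler_coor_norm _ _) (KB _ Kx).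
apply/integrableP; split; first exact/measurable_EFinP/measurable_funTS.
have mabs : measurable_fun setT (fun x => `|(EFin \o u) x|%E).
  by apply: measurableT_comp => //; exact/measurable_EFinP.
have mpdf : measurable_fun setT (fun x : V => (gauss_rV_pdf x)%:E).
  by apply/measurable_EFinP; exact: measurable_gauss_rV_pdf.
rewrite (@le_lt_trans _ _ (\int[lam]_(x in K)
    (del^-1%:E * (`|(EFin \o u) x| * (gauss_rV_pdf x)%:E)))%E)//.
  apply: ge0_le_integral => //.
  - exact: measurable_funTS.
  - apply: measurable_funTS; apply: emeasurable_funM => //.
    exact: (emeasurable_funM mabs mpdf).
  - move=> x Kx; rewrite /= -!EFinM lee_fin ler_pdivlMl//.
    by rewrite mulrC ler_wpM2l// delP.
rewrite ge0_integralZl//; last 3 first.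
- by apply: measurable_funTS; exact: (emeasurable_funM mabs mpdf).
- by move=> x _; rewrite mule_ge0// lee_fin gauss_rV_pdf_ge0.
- by rewrite lee_fin invr_ge0 ltW.
rewrite lte_mul_pinfty ?lee_fin ?invr_ge0 ?(ltW del0)//.
apply: le_lt_trans iu'; rewrite [leRHS](ge0_integral_gauss mabs)//.
apply: ge0_subset_integral => //; first exact: (emeasurable_funM mabs mpdf).
by move=> x _; rewrite mule_ge0// lee_fin gauss_rV_pdf_ge0.
Qed.

(** The weak gradient is defined through Lebesgue measure. Testing it on psi times the Gaussian
    density brings out the Gaussian adjoint of the partial derivative. *)
Lemma generalized_gradient_gauss u G i psi : generalized_gradient u G ->
  smooth psi -> bounded_support psi ->
  \int[g]_x (u x * (partial i psi x - x ord0 i * psi x)) =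
  - \int[g]_x (G x ord0 i * psi x).
Proof.
move=> [lu lG uG] spsi [N psiN].
have mu := loc_integrable_measurable lu.
have mG : measurable_fun setT (fun x => G x ord0 i).
  exact: (loc_integrable_measurable (lG i)).
have mpsi := smooth_measurable spsi.
have mdpsi := smooth_measurable (smooth_partial i spsi).
pose phi x := psi x * gauss_rV_pdf x.
have tphi : test_function phi.
  apply/test_functionP; split; first exact: (smoothM spsi smooth_gauss_rV_pdf).
  exists N => x phi0; apply: psiN; apply: contraNneq phi0 => /eqP.
  by rewrite /phi => /eqP ->; rewrite mul0r.
have := uG i phi tphi.
have mcoor : measurable_fun setT (fun x : V => x ord0 i) := measurable_coor i.
rewrite Rintegral_gauss; last first.
  apply: measurable_funM => //; apply: measurable_funB => //.
  exact: measurable_funM.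
rewrite Rintegral_gauss; last exact: measurable_funM.
rewrite (_ : (fun x => u x * partial i phi x) =
  (fun x => u x * (partial i psi x - x ord0 i * psi x) * gauss_rV_pdf x)); last first.
  by apply/funext => x; rewrite partial_gauss_mul// mulrA.
move=> ->; congr (- _); apply: eq_Rintegral => x _; by rewrite mulrA.
Qed.

(** The reverse passage: a test function phi is written as psi times the density, and psi is again
    smooth with bounded support because the reciprocal of the density is smooth. *)
Lemma gauss_generalized_gradient u G :
  g.-integrable setT (EFin \o u) ->
  (forall i, g.-integrable setT (EFin \o component i G)) ->
  (forall i psi, smooth psi -> bounded_support psi ->
    \int[g]_x (u x * (partial i psi x - x ord0 i * psi x)) =
    - \int[g]_x (G x ord0 i * psi x)) ->
  generalized_gradient u G.
Proof.
move=> iu iG H; split => [|i|i phi /test_functionP[sphi [N phiN]]].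
- exact: gauss_integrable_loc.
- exact: gauss_integrable_loc.
have /integrableP[/measurable_EFinP mu _] := iu.
have /integrableP[/measurable_EFinP mG _] := iG i.
pose k : R := (2 * pi) `^ (- (n%:R / 2)).
have k0 : 0 < k by rewrite powR_gt0// mulr_gt0// pi_gt0.
pose psi x := phi x * (k^-1 * expR (2^-1 * sumsq x)).
have psiE x : psi x * gauss_rV_pdf x = phi x.
  rewrite gauss_rV_pdfE /psi -/k.
  have := expRxMexpNx_1 (2^-1 * sumsq x); rewrite -mulNr.
  move: (expR _) (expR _) => a b ab.
  transitivity (phi x * (k^-1 * k) * (a * b)); first by ring.
  by rewrite [a * b]mulrC ab mulVf ?gt_eqF// !mulr1.
have spsi : smooth psi.
  apply: (smoothM sphi (smoothM (smooth_cst _) (smooth_expR_sumsq _))).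
have bpsi : bounded_support psi.
  exists N => x psi0; apply: phiN; apply: contraNneq psi0 => phi0.
  by rewrite /psi phi0 mul0r.
have mpsi := smooth_measurable spsi.
have mdpsi := smooth_measurable (smooth_partial i spsi).
have mcoor : measurable_fun setT (fun x : V => x ord0 i) := measurable_coor i.
have := H i psi spsi bpsi.
rewrite Rintegral_gauss; last first.
  apply: measurable_funM => //; apply: measurable_funB => //.
  exact: measurable_funM.
rewrite Rintegral_gauss; last exact: measurable_funM.
rewrite (_ : (fun x => _ * gauss_rV_pdf x) = (fun x => u x * partial i phi x)).
  by move=> ->; congr (- _); apply: eq_Rintegral => x _; rewrite -mulrA psiE.
apply/funext => x; rewrite -mulrA -partial_gauss_mul//; congr (_ * partial i _ x).
exact/funext.
Qed.

End generalized_gradient.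

(** * Lebesgue norms on product spaces *)

Lemma lee_poweR (R : realType) (r : R) (x y : \bar R) : (0 <= r)%R -> (0 <= x)%E -> (x <= y)%E -> (x `^ r <= y `^ r)%E.
Proof.
move=> r0 x0 xy; apply: gt0_ler_poweR => //; rewrite in_itv/= ?andbT.
by rewrite x0 leey.
by rewrite (le_trans x0 xy) leey.
Qed.

Section Lnorm_tools.
Context d (T : measurableType d) (R : realType).
Variable mu : {measure set T -> \bar R}.
Local Open Scope ereal_scope.
Implicit Types (f h : T -> R) (p q A B : R).

Lemma Lnorm_EFinE f p : 'N[mu]_p%:E[EFin \o f] = (\int[mu]_x (`|f x| `^ p)%:E) `^ p^-1.
Proof. by rewrite unlock. Qed.

Lemma measurable_abs_powR f p : measurable_fun setT f ->
  measurable_fun setT (fun x => (`|f x| `^ p)%:E).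
Proof.
move=> mf; apply/measurable_EFinP.
exact: (measurableT_comp (measurable_powR p) (measurableT_comp (@normr_measurable R setT) mf)).
Qed.

Lemma Lnorm_leP f p A : (0 < p)%R -> (0 <= A)%R ->
  'N[mu]_p%:E[EFin \o f] <= A%:E <-> \int[mu]_x (`|f x| `^ p)%:E <= (A `^ p)%:E.
Proof.
move=> p0 A0; rewrite Lnorm_EFinE.
have I0 : 0 <= \int[mu]_x (`|f x| `^ p)%:E.
  by apply: integral_ge0 => x _; rewrite lee_fin powR_ge0.
split=> [IA|IA].
  have : ((\int[mu]_x (`|f x| `^ p)%:E) `^ p^-1) `^ p <= A%:E `^ p.
    by apply: lee_poweR IA; rewrite ?poweR_ge0// ltW.
  by rewrite -poweRrM mulVf ?gt_eqF// poweRe1// poweR_EFin.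
have : (\int[mu]_x (`|f x| `^ p)%:E) `^ p^-1 <= (A `^ p)%:E `^ p^-1.
  by apply: lee_poweR IA; rewrite ?I0// invr_ge0 ltW.
by rewrite poweR_EFin -powRrM mulfV ?gt_eqF// powRr1.
Qed.

Lemma Lnorm_le f h p : (0 < p)%R -> measurable_fun setT f -> measurable_fun setT h ->
  (forall x, `|f x| <= `|h x|)%R ->
  'N[mu]_p%:E[EFin \o f] <= 'N[mu]_p%:E[EFin \o h].
Proof.
move=> p0 mf mh fh; rewrite !Lnorm_EFinE.
have I0 k : 0 <= \int[mu]_x (`|k x| `^ p)%:E.
  by apply: integral_ge0 => x _; rewrite lee_fin powR_ge0.
apply: lee_poweR; [by rewrite invr_ge0 ltW|exact: I0|].
apply: ge0_le_integral => //.
- exact: measurable_abs_powR.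
- exact: measurable_abs_powR.
- by move=> x _; rewrite lee_fin ge0_ler_powR// ?nnegrE ?(ltW p0).
Qed.

Lemma hoelder_Rintegral f h p q A B : (0 < p)%R -> (0 < q)%R -> (p^-1 + q^-1 = 1)%R ->
  measurable_fun setT f -> measurable_fun setT h ->
  'N[mu]_p%:E[EFin \o f] <= A%:E -> 'N[mu]_q%:E[EFin \o h] <= B%:E ->
  mu.-integrable setT (EFin \o (fun x => f x * h x)%R) /\
  (`| \int[mu]_x (f x * h x) | <= A * B)%R.
Proof.
move=> p0 q0 pq mf mh fA hB.
have H : \int[mu]_x `|(f x * h x)%:E| <= (A * B)%:E.
  have := hoelder mu mf mh p0 q0 pq; rewrite Lnorm1 => /le_trans; apply.
  by rewrite EFinM lee_pmul// Lnorm_ge0.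
have I : mu.-integrable setT (EFin \o (fun x => f x * h x)%R).
  apply/integrableP; split; first exact/measurable_EFinP/measurable_funM.
  by rewrite (le_lt_trans H)// ltry.
split => //; rewrite -lee_fin; apply: le_trans H.
rewrite -abse_EFin /Rintegral fineK; last exact: integrable_fin_num.
by apply: le_abse_integral => //; have /integrableP[] := I.
Qed.

End Lnorm_tools.

Section Lnorm_probability.
Context d (T : measurableType d) (R : realType) (P : probability T R).
Local Open Scope ereal_scope.

Lemma Lnorm_bounded (f : T -> R) (r M : R) : (0 < r)%R -> measurable_fun setT f ->
  (forall x, `|f x| <= M)%R -> 'N[P]_r%:E[EFin \o f] <= M%:E.
Proof.
move=> r0 mf fM.
(* The sign of [M] is read off at a point of [T]; an empty [T] would have measure 0 instead of 1. *)
have [x0|T0] := pselect (exists x : T, True); last first.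
  have P0 : P setT = 0 by rewrite (_ : setT = set0) ?measure0//; apply/seteqP; split=> // x _; apply: T0; exists x.
  by move: (probability_setT P); rewrite P0 => /eqP; rewrite eq_sym onee_eq0.
have M0 : (0 <= M)%R by have [x _] := x0; exact: le_trans (fM x).
apply/Lnorm_leP => //.
rewrite (@le_trans _ _ (\int[P]_x (cst (M `^ r)%:E x)))//.
  apply: ge0_le_integral => //.
  - exact: measurable_abs_powR.
  - by move=> x _; rewrite lee_fin ge0_ler_powR// ?nnegrE// ltW.
rewrite integral_cst// [X in _ * X](_ : _ = 1) ?mule1//; exact: probability_setT.
Qed.

Lemma Lnorm1_le_Lnorm (f : T -> R) (p q : R) : (0 < p)%R -> (0 < q)%R -> (p^-1 + q^-1 = 1)%R ->
  measurable_fun setT f -> \int[P]_x `|(f x)%:E| <= 'N[P]_p%:E[EFin \o f].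
Proof.
move=> p0 q0 pq mf.
have mc : measurable_fun setT (fun _ : T => 1 : R)%R by exact: measurable_cst.
have := hoelder P mf mc p0 q0 pq.
rewrite Lnorm1; under eq_integral do rewrite /= mulr1.
move=> /le_trans; apply; rewrite -[leRHS]mule1; apply: lee_wpmul2l; first exact: Lnorm_ge0.
by apply: Lnorm_bounded => // x; rewrite normr1.
Qed.

End Lnorm_probability.

Section Lnorm_product.
Context d1 d2 (X : measurableType d1) (Y : measurableType d2) (R : realType).
Variables (Q : {sigma_finite_measure set X -> \bar R}) (P : probability Y R).
Local Open Scope ereal_scope.

(** Jensen in the second variable, in the form L^1 <= L^p for a probability, then Tonelli. Every
    contraction estimate for averages over y comes from here. *)
Lemma Lnorm_section_le (K : X * Y -> R) (u : X -> R) (p q A : R) :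
  (0 < p)%R -> (0 < q)%R -> (p^-1 + q^-1 = 1)%R -> (0 <= A)%R ->
  measurable_fun setT K -> measurable_fun setT u ->
  (forall x, (`|u x|)%:E <= \int[P]_y `|(K (x, y))%:E|) ->
  'N[Q \x P]_p%:E[EFin \o K] <= A%:E -> 'N[Q]_p%:E[EFin \o u] <= A%:E.
Proof.
move=> p0 q0 pq A0 mK mu uK /Lnorm_leP -/(_ p0 A0) KA; apply/Lnorm_leP => //.
apply: le_trans KA.
have mKp := measurable_abs_powR p mK.
have Kp0 z : 0 <= (`|K z| `^ p)%:E by rewrite lee_fin powR_ge0.
rewrite (fubini_tonelli1 _ mKp Kp0).
apply: ge0_le_integral => //.
- exact: measurable_abs_powR.
- exact: (measurable_fun_fubini_tonelli_F _ mKp Kp0).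
move=> x _; rewrite /fubini_F.
have mKx : measurable_fun setT (fun y => K (x, y)).
  exact: (measurableT_comp mK (measurable_pair1 x)).
have := le_trans (uK x) (Lnorm1_le_Lnorm P p0 q0 pq mKx).
move=> /(lee_poweR (ltW p0)); rewrite lee_fin normr_ge0 => /(_ isT).
rewrite poweR_EFin => /le_trans; apply.
by rewrite poweR_Lnorm// ?gt_eqF.
Qed.

Lemma Lnorm_fst (f : X -> R) (p : R) : (0 < p)%R -> measurable_fun setT f ->
  'N[Q \x P]_p%:E[EFin \o (fun z => f z.1)] = 'N[Q]_p%:E[EFin \o f].
Proof.
move=> p0 mf; rewrite !Lnorm_EFinE.
have mfp := measurable_abs_powR p mf.
have mfp1 : measurable_fun setT (fun z : X * Y => (`|f z.1| `^ p)%:E).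
  exact: (measurableT_comp mfp measurable_fst).
rewrite (fubini_tonelli1 _ mfp1) => [|z]; last by rewrite lee_fin powR_ge0.
congr (_ `^ _); apply: eq_integral => x _; rewrite /fubini_F /=.
rewrite integral_cst// [X in _ * X](_ : _ = 1) ?mule1//; exact: probability_setT.
Qed.

End Lnorm_product.

Section Fubini_real.
Local Open Scope ereal_scope.
Context d1 d2 (X : measurableType d1) (Y : measurableType d2) (R : realType).
Variables (m1 : {sigma_finite_measure set X -> \bar R})
          (m2 : {sigma_finite_measure set Y -> \bar R}).
Variable (F : X * Y -> R).
Hypothesis iF : (m1 \x m2).-integrable setT (EFin \o F).

(** The real integral is [fine] of the extended one, and Fubini grants integrable sections, hence
    equality of the two, almost everywhere only. *)
Lemma ae_fubini_fineK : {ae m1, forall x,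
  (\int[m2]_y F (x, y))%R%:E = fubini_F m2 (EFin \o F) x}.
Proof.
have := ae_integrable1 iF; apply: filterS => x ix.
by rewrite /fubini_F /Rintegral fineK//; exact: integrable_fin_num.
Qed.

Lemma measurable_Rintegral1 : measurable_fun setT (fun x => \int[m2]_y F (x, y))%R.
Proof.
apply: (measurableT_comp (f := fine)); first exact: fine_measurable.
exact: (measurable_fubini_F iF).
Qed.

Lemma integrable_Rintegral1 :
  m1.-integrable setT (EFin \o (fun x => \int[m2]_y F (x, y))%R).
Proof.
apply: le_integrable (integrable_fubini_F iF) => //.
  by apply/measurable_EFinP; exact: measurable_Rintegral1.
move=> x _; rewrite /fubini_F /= /Rintegral.
by case: (\int[m2]_y _) => [r| |] //=; rewrite normr0 leey.
Qed.

Lemma Rintegral_fubini1 :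
  (\int[m1]_x \int[m2]_y F (x, y) = \int[m1 \x m2]_z F z)%R.
Proof.
rewrite /Rintegral -(integral12_prod_meas1 iF); congr fine.
apply: ae_eq_integral => //.
- by apply/measurable_EFinP; exact: measurable_Rintegral1.
- exact: (measurable_fubini_F iF).
- by have := ae_fubini_fineK; apply: filterS => x + _.
Qed.

Lemma Rintegral_fubini2 :
  (\int[m2]_y \int[m1]_x F (x, y) = \int[m1 \x m2]_z F z)%R.
Proof.
rewrite /Rintegral -(integral21_prod_meas1 iF); congr fine.
have mG := measurable_fubini_G iF.
apply: ae_eq_integral => //.
- by apply/measurable_EFinP; apply: (measurableT_comp (f := fine)) => //; exact: fine_measurable.
have := ae_integrable2 iF; apply: filterS => y iy _.
by rewrite /fubini_G /= fineK//; exact: integrable_fin_num.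
Qed.

End Fubini_real.

(** * Mehler kernels *)

Section mehler.
Context {R : realType} {n : nat}.
Local Notation V := 'rV[R]_n.
Local Notation g := (gauss_rV R n).
Local Notation gg := ((gauss_rV R n) \x (gauss_rV R n))%E.
Implicit Types (f phi : V -> R) (k K : V * V -> R) (Phi : V -> V) (c s p q r : R).

Lemma rotK c s z : c ^+ 2 + s ^+ 2 = 1 -> rot c (- s) (rot c s z) = z :> V * V.
Proof.
case: z => x y cs1; rewrite /rot /= opprK; congr pair; apply/rowP => i; rewrite !mxE.
- transitivity ((c ^+ 2 + s ^+ 2) * x ord0 i); first by ring.
  by rewrite cs1 mul1r.
- transitivity ((c ^+ 2 + s ^+ 2) * y ord0 i); first by ring.
  by rewrite cs1 mul1r.
Qed.

Lemma Lnorm_rot c s K r : s != 0 -> c ^+ 2 + s ^+ 2 = 1 -> measurable_fun setT K ->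
  'N[gg]_r%:E[EFin \o (K \o rot c s)]%E = 'N[gg]_r%:E[EFin \o K]%E.
Proof.
move=> s0 cs1 mK; rewrite !Lnorm_EFinE; apply: (congr1 (fun x => x `^ r^-1)%E).
apply: (ge0_integral_rot (F := fun z => (`|K z| `^ r)%:E) s0 cs1).
  exact: measurable_abs_powR.
by move=> z; rewrite lee_fin powR_ge0.
Qed.

(** * Mixing, rotation and duality *)

Definition mix c s f (z : V * V) : R := f (c *: z.1 + s *: z.2).

Lemma measurable_mix c s f : measurable_fun setT f ->
  measurable_fun setT (mix c s f).
Proof.
move=> mf; have := measurableT_comp (measurableT_comp mf measurable_fst) (measurable_rot c s).
exact.
Qed.

Lemma Lnorm_mix c s f r : 0 < r -> s != 0 -> c ^+ 2 + s ^+ 2 = 1 -> measurable_fun setT f ->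
  'N[gg]_r%:E[EFin \o mix c s f]%E = 'N[g]_r%:E[EFin \o f]%E.
Proof.
move=> r0 s0 cs1 mf.
have := @Lnorm_rot c s (fun z => f z.1) r s0 cs1 (measurableT_comp mf measurable_fst).
by rewrite (Lnorm_fst _ _ r0 mf).
Qed.

Lemma enorm_delta i : enorm (delta_mx ord0 i : V) = 1.
Proof.
have := @sumsq_delta R n 1 i; rewrite scale1r expr1n => h.
by rewrite /enorm -/(sumsq _) h sqrtr1.
Qed.

Lemma Lnorm_coor i r : 0 < r ->
  ('N[g]_r%:E[EFin \o (fun x : V => x ord0 i)] <= (gauss_moment r)%:E)%E.
Proof.
move=> r0; apply/Lnorm_leP => //; first exact/ltW/gauss_moment_gt0.
have := ge0_integral_gauss_dotr_powR (delta_mx ord0 i : V) r0.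
rewrite enorm_delta mulr1 => <-; rewrite le_eqVlt; apply/orP; left; apply/eqP.
apply: eq_integral => x _; have := @dotr_delta R n x 1 i; rewrite scale1r mul1r => ->.
by [].
Qed.

Lemma integrable_coor i : g.-integrable setT (EFin \o (fun x : V => x ord0 i)).
Proof.
have h : measurable_fun setT (fun x : V => x ord0 i) := measurable_coor i.
have m1 : measurable_fun setT (fun _ : V => 1 : R) by exact: measurable_cst.
have [] := hoelder_Rintegral (p := 2) (q := 2) _ _ _ h m1 (Lnorm_coor i _)
  (Lnorm_bounded (M := 1) g _ m1 _) => //.
- by lra.
- by move=> x; rewrite normr1.
- by move=> + _; congr (_.-integrable _ (EFin \o _)); apply/funext => x; rewrite mulr1.
Qed.

Lemma measurable_field_component Phi : measurable_fun setT Phi ->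
  forall i, measurable_fun setT (component i Phi).
Proof. by move=> mPhi i; exact: (measurableT_comp (measurable_coor i) mPhi). Qed.

Lemma measurable_dotr_field Phi : measurable_fun setT Phi ->
  measurable_fun setT (fun z : V * V => dotr z.2 (Phi z.1)).
Proof.
move=> mPhi; apply: measurable_sum => i; apply: measurable_funM.
  exact: (measurableT_comp (measurable_coor i) measurable_snd).
exact: (measurableT_comp (measurable_field_component mPhi i) measurable_fst).
Qed.

(** For fixed x the function y -> <y, Phi(x)> is normal with deviation |Phi(x)|, so its L^r norm in
    y is exactly C(r)|Phi(x)|. Both C(p) and C(q) enter the theorem through this bound. *)
Lemma Lnorm_dotr_field Phi r A : 0 < r -> 0 <= A -> measurable_fun setT Phi ->
  (Lnorm_field r Phi <= A%:E)%E ->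
  ('N[gg]_r%:E[EFin \o (fun z => dotr z.2 (Phi z.1))] <= (gauss_moment r * A)%:E)%E.
Proof.
move=> r0 A0 mPhi /Lnorm_leP -/(_ r0 A0) PhiA.
have C0 := ltW (gauss_moment_gt0 r0).
have mK := measurable_dotr_field mPhi.
have menorm : measurable_fun setT (enorm \o Phi) := measurableT_comp measurable_enorm mPhi.
apply/Lnorm_leP; rewrite ?mulr_ge0//.
rewrite (fubini_tonelli1 _ (measurable_abs_powR r mK)) => [|z]; last by rewrite lee_fin powR_ge0.
apply: (@le_trans _ _ (\int[g]_x ((gauss_moment r `^ r)%:E * (`|(enorm \o Phi) x| `^ r)%:E))%E).
  rewrite le_eqVlt; apply/orP; left; apply/eqP; apply: eq_integral => x _.
  rewrite /fubini_F /= (ge0_integral_gauss_dotr_powR (Phi x) r0).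
  by rewrite powRM ?enorm_ge0// EFinM (ger0_norm (enorm_ge0 _)).
rewrite ge0_integralZl//; last 2 first.
- exact: (measurable_abs_powR r menorm).
- by rewrite lee_fin powR_ge0.
by rewrite powRM// EFinM lee_wpmul2l// lee_fin powR_ge0.
Qed.

Lemma Rintegral_rot c s K : s != 0 -> c ^+ 2 + s ^+ 2 = 1 -> measurable_fun setT K ->
  \int[gg]_z K (rot c s z) = \int[gg]_z K z.
Proof.
move=> s0 cs1 mK; rewrite /Rintegral; congr fine.
exact: (integral_rot s0 cs1 ((measurable_EFinP _ _).2 mK)).
Qed.

Lemma integrable_mix_mul c s f k p q A B : 0 < p -> 0 < q -> p^-1 + q^-1 = 1 ->
  s != 0 -> c ^+ 2 + s ^+ 2 = 1 -> measurable_fun setT f -> measurable_fun setT k ->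
  ('N[g]_p%:E[EFin \o f] <= A%:E)%E -> ('N[gg]_q%:E[EFin \o k] <= B%:E)%E ->
  gg.-integrable setT (EFin \o (fun z => mix c s f z * k z)).
Proof.
move=> p0 q0 pq s0 cs1 mf mk fA kB.
rewrite -(Lnorm_mix p0 s0 cs1 mf) in fA.
by have [] := hoelder_Rintegral p0 q0 pq (measurable_mix c s mf) mk fA kB.
Qed.

(** A rotation moves the mixing from f to the kernel, which is then taken at the inverse rotation.
    The kernel depends on both variables in order to include <y, Phi(x)>, needed for the gradient of
    T_t f. Integrability for every x allows f(x) to leave the inner integral. *)
Lemma mehler_duality c s f k p q A B : 0 < p -> 0 < q -> p^-1 + q^-1 = 1 ->
  s != 0 -> c ^+ 2 + s ^+ 2 = 1 -> measurable_fun setT f -> measurable_fun setT k ->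
  ('N[g]_p%:E[EFin \o f] <= A%:E)%E -> ('N[gg]_q%:E[EFin \o k] <= B%:E)%E ->
  (forall x, g.-integrable setT (EFin \o (fun y => k (rot c (- s) (x, y))))) ->
  \int[g]_x \int[g]_y (f (c *: x + s *: y) * k (x, y)) =
  \int[g]_x (f x * \int[g]_y k (rot c (- s) (x, y))).
Proof.
move=> p0 q0 pq s0 cs1 mf mk fA kB ik.
have iF := integrable_mix_mul p0 q0 pq s0 cs1 mf mk fA kB.
rewrite (Rintegral_fubini1 iF).
pose H z := f z.1 * k (rot c (- s) z).
have ns0 : - s != 0 by rewrite oppr_eq0.
have cns1 : c ^+ 2 + (- s) ^+ 2 = 1 by rewrite sqrrN.
have mkr : measurable_fun setT (k \o rot c (- s)) := measurableT_comp mk (measurable_rot c (- s)).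
have mH : measurable_fun setT H.
  by apply: measurable_funM => //; exact: (measurableT_comp mf measurable_fst).
transitivity (\int[gg]_z H (rot c s z)).
  by apply: eq_Rintegral => -[x y] _; rewrite /H rotK.
rewrite (Rintegral_rot s0 cs1 mH).
have iH : gg.-integrable setT (EFin \o H).
  have fA' := fA; rewrite -(Lnorm_fst g g p0 mf) in fA'.
  rewrite -(Lnorm_rot q ns0 cns1 mk) in kB.
  by have [] := hoelder_Rintegral p0 q0 pq (measurableT_comp mf measurable_fst) mkr fA' kB.
rewrite -(Rintegral_fubini1 iH); apply: eq_Rintegral => x _.
by rewrite /H /= RintegralZl.
Qed.

End mehler.

Section integrable_products.
Context {R : realType}.

Lemma integrable_mul_bounded d (T : measurableType d) (mu : {measure set T -> \bar R})
    (u w : T -> R) (M : R) : mu.-integrable setT (EFin \o u) ->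
  measurable_fun setT w -> (forall x, `|w x| <= M) ->
  mu.-integrable setT (EFin \o (fun x => u x * w x)).
Proof.
move=> iu mw wM; have /integrableP[/measurable_EFinP mu' _] := iu.
apply: (le_integrable measurableT _ _ (integrableZl measurableT M iu)).
  by apply/measurable_EFinP; exact: measurable_funM.
move=> x _ /=; rewrite lee_fin !normrM mulrC ler_wpM2r//.
by rewrite (le_trans (wM x))// ler_norm.
Qed.

Lemma integrable_prod d1 d2 (X : measurableType d1) (Y : measurableType d2)
    (m1 : {sigma_finite_measure set X -> \bar R})
    (m2 : {sigma_finite_measure set Y -> \bar R})
    (u : X -> R) (v : Y -> R) :
  m1.-integrable setT (EFin \o u) -> m2.-integrable setT (EFin \o v) ->
  (m1 \x m2)%E.-integrable setT (EFin \o (fun z => u z.1 * v z.2)).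
Proof.
move=> iu iv.
have /integrableP[/measurable_EFinP mu' ui] := iu.
have /integrableP[/measurable_EFinP mv' vi] := iv.
have muv : measurable_fun setT (fun z : X * Y => u z.1 * v z.2).
  apply: measurable_funM.
  - exact: (measurableT_comp mu' measurable_fst).
  - exact: (measurableT_comp mv' measurable_snd).
apply/integrable12ltyP; first exact/measurable_EFinP.
have mun : measurable_fun setT (fun x => (`|u x|)%:E).
  by apply/measurable_EFinP; exact: (measurableT_comp (@normr_measurable R setT) mu').
have mvn : measurable_fun setT (fun y => (`|v y|)%:E).
  by apply/measurable_EFinP; exact: (measurableT_comp (@normr_measurable R setT) mv').
rewrite (eq_integral (fun x => (`|u x|)%:E * \int[m2]_y (`|v y|)%:E)%E); last first.
  move=> x _; rewrite -ge0_integralZl//.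
  by apply: eq_integral => y _; rewrite /= normrM EFinM.
rewrite ge0_integralZr//; last exact: integral_ge0.
by rewrite lte_mul_pinfty// ?ge0_fin_numE// ?integral_ge0.
Qed.

Lemma integrable_Rsum d (T : measurableType d) (mu : {measure set T -> \bar R})
    (I : Type) (s : seq I) (F : I -> T -> R) :
  (forall i, mu.-integrable setT (EFin \o F i)) ->
  mu.-integrable setT (EFin \o (fun x => \sum_(i <- s) F i x)).
Proof.
move=> iF; have := integrable_sum measurableT s (P := xpredT) (fun i _ => iF i).
congr (_.-integrable _ _); apply/funext => x /=; by rewrite sumEFin.
Qed.

Lemma Rintegral_sum d (T : measurableType d) (mu : {measure set T -> \bar R})
    (I : Type) (s : seq I) (F : I -> T -> R) :
  (forall i, mu.-integrable setT (EFin \o F i)) ->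
  \int[mu]_x (\sum_(i <- s) F i x) = \sum_(i <- s) \int[mu]_x F i x.
Proof.
move=> iF; elim: s => [|i s IH].
  rewrite big_nil /Rintegral integral0_eq// => x _; by rewrite big_nil.
rewrite big_cons -IH -RintegralD//; last exact: integrable_Rsum.
by apply: eq_Rintegral => x _; rewrite big_cons.
Qed.

Lemma le_abs_Rintegral d (T : measurableType d) (mu : {measure set T -> \bar R})
    (u : T -> R) : measurable_fun setT u ->
  ((`|\int[mu]_x u x|)%:E <= \int[mu]_x `|(u x)%:E|)%E.
Proof.
move=> mu'; apply: le_trans (le_abse_integral mu measurableT _).
  (* If the extended integral is infinite, [fine] returns 0 and the bound is trivial. *)
  by rewrite /Rintegral; case: (\int[mu]_(x in setT) _)%E => [r| |] //=; rewrite normr0 leey.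
exact/measurable_EFinP.
Qed.

End integrable_products.

Section dotr_enorm.
Context {R : realType} {n : nat}.
Implicit Types x y : 'rV[R]_n.

Lemma sumsqB x y (a b : R) : sumsq (a *: x - b *: y) =
  a ^+ 2 * sumsq x - 2 * a * b * dotr x y + b ^+ 2 * sumsq y.
Proof.
rewrite /sumsq /dotr !mulr_sumr -sumrB -big_split/=.
by apply: eq_bigr => i _; rewrite !mxE; ring.
Qed.

(** With S = |y|^2 and D = <x, y>, the square |S x - D y|^2 equals S (S |x|^2 - D^2). *)
Lemma dotr_le_enorm x y : `|dotr x y| <= enorm x * enorm y.
Proof.
rewrite -(@ler_pXn2r _ 2)// ?nnegrE ?mulr_ge0 ?enorm_ge0//.
rewrite real_normK ?num_real// exprMn !enorm_sqr.
have [y0|y0] := eqVneq (sumsq y) 0.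
  rewrite (sumsq_eq0 y0) /dotr big1; first by rewrite expr0n mulr_ge0 ?sumsq_ge0.
  by move=> i _; rewrite mxE mulr0.
have yp : 0 < sumsq y by rewrite lt0r y0 sumsq_ge0.
rewrite -(ler_pM2l yp) -subr_ge0.
have := sumsq_ge0 (sumsq y *: x - dotr x y *: y).
set S := sumsq y; set D := dotr x y.
rewrite sumsqB -/D -/S; congr (0 <= _); ring.
Qed.

Lemma dotr_self x : dotr x x = enorm x ^+ 2.
Proof. by rewrite enorm_sqr; apply: eq_bigr => i _; rewrite expr2. Qed.

Lemma ler_enorm_sum x : enorm x <= \sum_(i < n) `|x ord0 i|.
Proof.
have S0 : 0 <= \sum_(i < n) `|x ord0 i| by exact: sumr_ge0.
rewrite -(@ler_pXn2r _ 2)// ?nnegrE ?enorm_ge0//.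
rewrite enorm_sqr expr2 mulr_sumr; apply: ler_sum => i _.
rewrite -(real_normK (num_real _)) expr2 ler_wpM2r//.
by rewrite (bigD1 i)//= lerDl sumr_ge0.
Qed.

End dotr_enorm.

Section vector_integral.
Context {R : realType} {n : nat} d (T : measurableType d) (mu : {measure set T -> \bar R}).

(** Pair the mean vector m with itself: |m|^2 is the integral of <m, w>, at most |m| times the
    integral of |w|; then divide by |m|. *)
Lemma enorm_Rintegral_le (w : T -> 'rV[R]_n) : measurable_fun setT w ->
  (forall i, mu.-integrable setT (EFin \o (fun x => w x ord0 i))) ->
  ((enorm (\row_i \int[mu]_x w x ord0 i))%:E <= \int[mu]_x (enorm (w x))%:E)%E.
Proof.
move=> mw iw; set m := \row_i _.
have me : measurable_fun setT (fun x => enorm (w x)) := measurableT_comp measurable_enorm mw.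
have ie : mu.-integrable setT (EFin \o (fun x => enorm (w x))).
  have : mu.-integrable setT (fun x => \sum_(i < n) (`|w x ord0 i|)%:E)%E.
    by apply: integrable_sum => // i _; exact: (integrable_norm (iw i)).
  apply: le_integrable => //; first exact/measurable_EFinP.
  move=> x _ /=; rewrite sumEFin /= lee_fin ger0_norm ?enorm_ge0//.
  by rewrite ger0_norm ?sumr_ge0// ler_enorm_sum.
rewrite (_ : \int[mu]_x _ = (\int[mu]_x enorm (w x))%:E)%E; last first.
  by rewrite /Rintegral fineK//; exact: integrable_fin_num.
rewrite lee_fin.
have [->|m0] := eqVneq (enorm m) 0.
  by apply: Rintegral_ge0 => x _; exact: enorm_ge0.
have mp : 0 < enorm m by rewrite lt0r m0 enorm_ge0.
rewrite -(ler_pM2r mp) -expr2 -dotr_self.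
have idm i : mu.-integrable setT (EFin \o (fun x => m ord0 i * w x ord0 i)).
  exact: (integrableZl measurableT (m ord0 i) (iw i)).
have -> : dotr m m = \int[mu]_x dotr m (w x).
  rewrite /dotr Rintegral_sum//.
  apply: eq_bigr => i _.
  by rewrite RintegralZl//; congr (_ * _); rewrite mxE.
rewrite mulrC -RintegralZl//.
apply: le_Rintegral => //.
- exact: integrable_Rsum.
- exact: (integrableZl measurableT (enorm m) ie).
- by move=> x _; rewrite (le_trans (ler_norm _))// dotr_le_enorm.
Qed.

End vector_integral.

Section mehler_operator.
Context {R : realType} {n : nat}.
Local Notation V := 'rV[R]_n.
Local Notation g := (gauss_rV R n).
Local Notation gg := ((gauss_rV R n) \x (gauss_rV R n))%E.
Implicit Types (f phi : V -> R) (Phi : V -> V) (c s p q A B : R).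

Definition mehler c s f (x : V) : R := \int[g]_y f (c *: x + s *: y).

Lemma OU_mehlerE (t : R) f : OU t f = mehler (expR (- t)) (Num.sqrt (1 - expR (- (2 * t)))) f.
Proof. by []. Qed.

Lemma integrable_Lnorm f p q A : 0 < p -> 0 < q -> p^-1 + q^-1 = 1 ->
  measurable_fun setT f -> ('N[g]_p%:E[EFin \o f] <= A%:E)%E ->
  g.-integrable setT (EFin \o f).
Proof.
move=> p0 q0 pq mf fA.
have m1 : measurable_fun setT (fun _ : V => 1 : R) by exact: measurable_cst.
have n1 (x : V) : `|1 : R| <= 1 by rewrite normr1.
have N1 := Lnorm_bounded (M := 1) g q0 m1 n1.
have [] := hoelder_Rintegral p0 q0 pq mf m1 fA N1.
move=> + _; congr (_.-integrable _ (EFin \o _)); apply/funext => x; exact: mulr1.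
Qed.

Lemma integrable_mix c s f : s != 0 -> c ^+ 2 + s ^+ 2 = 1 ->
  g.-integrable setT (EFin \o f) -> gg.-integrable setT (EFin \o mix c s f).
Proof.
move=> s0 cs1 iF; have icst : g.-integrable setT (EFin \o (fun _ : V => 1 : R)).
  apply: (integrable_bounded (M := 1) g (measurable_cst _)) => x.
  by rewrite normr1.
have := integrable_rot s0 cs1 (integrable_prod iF icst).
congr (_.-integrable _ _); apply/funext => z /=; by rewrite mulr1.
Qed.

Lemma measurable_mehler c s f : s != 0 -> c ^+ 2 + s ^+ 2 = 1 ->
  g.-integrable setT (EFin \o f) -> measurable_fun setT (mehler c s f).
Proof. by move=> s0 cs1 iF; exact: (measurable_Rintegral1 (integrable_mix s0 cs1 iF)). Qed.

Lemma Lnorm_mehler c s f p q A : 0 < p -> 0 < q -> p^-1 + q^-1 = 1 -> 0 <= A ->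
  s != 0 -> c ^+ 2 + s ^+ 2 = 1 -> measurable_fun setT f ->
  ('N[g]_p%:E[EFin \o f] <= A%:E)%E -> ('N[g]_p%:E[EFin \o mehler c s f] <= A%:E)%E.
Proof.
move=> p0 q0 pq A0 s0 cs1 mf fA.
have iF := integrable_Lnorm p0 q0 pq mf fA.
have mm := measurable_mix c s mf.
apply: (Lnorm_section_le p0 q0 pq A0 mm (measurable_mehler s0 cs1 iF)).
- move=> x; apply: le_abs_Rintegral.
  exact: (measurableT_comp mm (measurable_pair1 x)).
- by rewrite (Lnorm_mix p0 s0 cs1 mf).
Qed.

Lemma measurable_affine_section c s f (x : V) : measurable_fun setT f ->
  measurable_fun setT (fun y : V => f (c *: x + s *: y)).
Proof. by move=> mf; exact: (measurableT_comp (measurable_mix c s mf) (measurable_pair1 x)). Qed.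

Lemma bounded_mehler c s f (M : R) : measurable_fun setT f -> (forall x, `|f x| <= M) ->
  forall x, `|mehler c s f x| <= M.
Proof.
move=> mf fM x; have mfx := measurable_affine_section c s x mf.
rewrite -lee_fin (le_trans (le_abs_Rintegral g mfx))//.
rewrite -[leRHS](@integral_gauss_cst R n); apply: ge0_le_integral => //.
- by apply: measurableT_comp => //; exact/measurable_EFinP.
- by move=> y _; rewrite lee_fin (le_trans _ (fM (c *: x + s *: y))).
Qed.

(** The case of a kernel phi(x) constant in y. The sign of [- s] in the adjoint is that of the
    inverse rotation. *)
Lemma mehler_duality_bounded c s f phi p q A (M : R) : 0 < p -> 0 < q -> p^-1 + q^-1 = 1 ->
  s != 0 -> c ^+ 2 + s ^+ 2 = 1 -> measurable_fun setT f -> measurable_fun setT phi ->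
  ('N[g]_p%:E[EFin \o f] <= A%:E)%E -> (forall x, `|phi x| <= M) ->
  \int[g]_x (mehler c s f x * phi x) = \int[g]_x (f x * mehler c (- s) phi x).
Proof.
move=> p0 q0 pq s0 cs1 mf mphi fA phiM.
have phiB : ('N[gg]_q%:E[EFin \o (fun z => phi z.1)] <= M%:E)%E.
  by rewrite (Lnorm_fst g g q0 mphi); exact: Lnorm_bounded.
have m1 : measurable_fun setT (fun z : V * V => phi z.1) :=
  measurableT_comp mphi measurable_fst.
have iphi x : g.-integrable setT (EFin \o (fun y => phi (rot c (- s) (x, y)).1)).
  apply: (integrable_bounded (M := M) g) => //.
  exact: (measurable_affine_section c (- s) x mphi).
apply: (etrans _ (mehler_duality p0 q0 pq s0 cs1 mf m1 fA phiB iphi)).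
have fA' := fA; rewrite -(Lnorm_mix p0 s0 cs1 mf) in fA'.
have iF := integrable_mix s0 cs1 (integrable_Lnorm p0 q0 pq mf fA).
have iFp := integrable_mix_mul p0 q0 pq s0 cs1 mf m1 fA phiB.
rewrite /Rintegral; congr fine; apply: ae_eq_integral => //.
- apply/measurable_EFinP; apply: measurable_funM => //.
  exact: (measurable_mehler s0 cs1 (integrable_Lnorm p0 q0 pq mf fA)).
- by apply/measurable_EFinP; exact: (measurable_Rintegral1 iFp).
(* The factor [phi x] leaves the inner integral at those x where the section of f is integrable,
   that is almost everywhere. *)
have := ae_integrable1 iF; apply: filterS => x ix _.
have ix' : g.-integrable setT (EFin \o (fun y : V => f (c *: x + s *: y))) by exact: ix.
exact: (congr1 EFin (esym (RintegralZr (phi x) measurableT ix'))).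
Qed.

End mehler_operator.

(** * Upper bound on V *)

Lemma Rintegral_eq0 {R : realType} d (T : measurableType d) (mu : {measure set T -> \bar R})
    (u : T -> R) : (forall x, u x = 0) -> \int[mu]_x u x = 0.
Proof.
move=> u0; have -> : u = cst 0 by apply/funext.
by rewrite Rintegral_cst // mul0r.
Qed.

(** * Integration by parts in the two rotated variables *)

Section rotation_by_parts.
Context {R : realType} {n : nat}.
Local Notation V := 'rV[R]_n.
Local Notation g := (gauss_rV R n).
Local Notation gg := ((gauss_rV R n) \x (gauss_rV R n))%E.
Implicit Types (h w phi : V -> R) (G : V -> V) (c s : R) (i : 'I_n).

Lemma bounded_support_affine phi (a : V) (b : R) : b != 0 -> bounded_support phi ->
  bounded_support (fun x => phi (a + b *: x)).
Proof.
move=> b0 [N phiN]; exists (`|b|^-1 * (N + `|a|)) => x /phiN xN.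
rewrite ler_pdivlMl ?normr_gt0// -normrZ.
have -> : b *: x = (a + b *: x) - a by rewrite addrC addKr.
by rewrite (le_trans (ler_normB _ _))// lerD2r.
Qed.

Lemma smooth_bounded phi : smooth phi -> bounded_support phi ->
  exists2 M : R, 0 <= M & forall x, `|phi x| <= M.
Proof. by move=> sphi; exact: (continuous_bounded_support (smooth_continuous sphi)). Qed.

Lemma smooth_partial_bounded phi i : smooth phi -> bounded_support phi ->
  exists2 M : R, 0 <= M & forall x, `|partial i phi x| <= M.
Proof.
move=> sphi bphi; apply: smooth_bounded; first exact: smooth_partial.
exact: bounded_support_partial.
Qed.

Let integrable_one : g.-integrable setT (EFin \o (fun _ : V => 1 : R)).
Proof.
apply: (integrable_bounded (M := 1) g (measurable_cst _)) => x.
by rewrite normr1.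
Qed.

Lemma integrable_fst w : g.-integrable setT (EFin \o w) ->
  gg.-integrable setT (EFin \o (fun z => w z.1)).
Proof.
move=> iw; have := integrable_prod iw integrable_one.
by congr (_.-integrable _ (EFin \o _)); apply/funext => z; rewrite mulr1.
Qed.

Lemma partial_affine phi (a : V) (b : R) i x : smooth phi ->
  partial i (fun x => phi (a + b *: x)) x = b * partial i phi (a + b *: x).
Proof. by move=> sphi; have [_ <-] := is_derive_affine a b i x sphi. Qed.

Let integrable_mul_mix (u v : V -> R) phi c s : smooth phi -> bounded_support phi ->
  g.-integrable setT (EFin \o u) -> g.-integrable setT (EFin \o v) ->
  gg.-integrable setT (EFin \o (fun z => u z.1 * v z.2 * mix c s phi z)).
Proof.
move=> sphi bphi iu iv; have [M M0 phiM] := smooth_bounded sphi bphi.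
apply: (integrable_mul_bounded (integrable_prod iu iv) _ (M := M)).
  exact: (measurable_mix c s (smooth_measurable sphi)).
by move=> z; exact: phiM.
Qed.

Lemma integrable_ibp_snd w phi c s i : smooth phi -> bounded_support phi ->
  g.-integrable setT (EFin \o w) ->
  gg.-integrable setT (EFin \o (fun z : V * V => w z.1 * (s * mix c s (partial i phi) z -
     z.2 ord0 i * mix c s phi z))).
Proof.
move=> sphi bphi iw.
have i1 := integrable_mul_mix c s (smooth_partial i sphi) (bounded_support_partial i bphi)
  iw integrable_one.
have i2 := integrable_mul_mix c s sphi bphi iw (integrable_coor i).
have := integrableB measurableT (integrableZl measurableT s i1) i2.
congr (_.-integrable _ _); apply/funext => z /=; rewrite -EFinM -EFinB; congr EFin; ring.
Qed.

Lemma integrable_ibp_fst h w phi c s i : smooth phi -> bounded_support phi ->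
  g.-integrable setT (EFin \o h) -> g.-integrable setT (EFin \o w) ->
  g.-integrable setT (EFin \o (fun x => h x * x ord0 i)) ->
  gg.-integrable setT (EFin \o (fun z : V * V => h z.1 * w z.2 *
    (c * mix c s (partial i phi) z - z.1 ord0 i * mix c s phi z))).
Proof.
move=> sphi bphi ih iw ihi.
have i1 := integrable_mul_mix c s (smooth_partial i sphi) (bounded_support_partial i bphi)
  ih iw.
have i2 := integrable_mul_mix c s sphi bphi ihi iw.
have := integrableB measurableT (integrableZl measurableT c i1) i2.
congr (_.-integrable _ _); apply/funext => z /=; rewrite -EFinM -EFinB; congr EFin; ring.
Qed.

(** For fixed x, the partial derivative of phi at cx + sy, times s, is the derivative in y_i of y ->
    phi(cx + sy). The Gaussian formula makes the inner integral vanish, w(x) being a constant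
    there. *)
Lemma Rintegral_ibp_snd w phi c s i : smooth phi -> bounded_support phi -> s != 0 ->
  g.-integrable setT (EFin \o w) ->
  \int[gg]_z (w z.1 * (s * mix c s (partial i phi) z - z.2 ord0 i * mix c s phi z)) = 0.
Proof.
move=> sphi bphi s0 iw.
have iI := integrable_ibp_snd c s i sphi bphi iw.
apply: (etrans (esym (Rintegral_fubini1 iI))).
apply: Rintegral_eq0 => x; rewrite /mix /=.
pose psi (y : V) := phi (c *: x + s *: y).
have spsi : smooth psi := smooth_affine (c *: x) s sphi.
have bpsi : bounded_support psi := bounded_support_affine (c *: x) s0 bphi.
have [M M0 psiM] := smooth_bounded spsi bpsi.
have [M' M'0 psiM'] := smooth_partial_bounded i spsi bpsi.
have ia : g.-integrable setT (EFin \o partial i psi).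
  exact: (integrable_bounded g (smooth_measurable (smooth_partial i spsi)) psiM').
have ib : g.-integrable setT (EFin \o (fun y : V => y ord0 i * psi y)).
  exact: (integrable_mul_bounded (integrable_coor i) (smooth_measurable spsi) psiM).
have E (y : V) : s * partial i phi (c *: x + s *: y) = partial i psi y.
  by rewrite (partial_affine (c *: x) s i y sphi).
have -> : (fun y : V => w x * (s * partial i phi (c *: x + s *: y) - y ord0 i * phi (c *: x + s *: y))) =
   (fun y : V => w x * (partial i psi y - y ord0 i * psi y)).
  by apply/funext => y; rewrite E.
have iab : g.-integrable setT (EFin \o (fun y : V => partial i psi y - y ord0 i * psi y)).
  exact: (integrableB measurableT ia ib).
rewrite (RintegralZl (w x) measurableT iab) (RintegralB measurableT ia ib).
by rewrite (Rintegral_gauss_by_parts i spsi bpsi) subrr mulr0.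
Qed.

(** For fixed y, the weak gradient of h is tested on x -> phi(cx + sy), which has bounded support
    because c is nonzero; here w(y) is the constant factor. *)
Lemma Rintegral_ibp_fst h G w phi c s i : smooth phi -> bounded_support phi -> c != 0 ->
  g.-integrable setT (EFin \o h) -> g.-integrable setT (EFin \o w) ->
  g.-integrable setT (EFin \o (fun x => h x * x ord0 i)) ->
  g.-integrable setT (EFin \o component i G) ->
  (forall psi, smooth psi -> bounded_support psi ->
    \int[g]_x (h x * (partial i psi x - x ord0 i * psi x)) = - \int[g]_x (G x ord0 i * psi x)) ->
  \int[gg]_z (h z.1 * w z.2 * (c * mix c s (partial i phi) z - z.1 ord0 i * mix c s phi z) +
    G z.1 ord0 i * w z.2 * mix c s phi z) = 0.
Proof.
move=> sphi bphi c0 ih iw ihi iG hG.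
have iI := integrable_ibp_fst c s sphi bphi ih iw ihi.
have iJ := integrable_mul_mix c s sphi bphi iG iw.
have iIJ := integrableD measurableT iI iJ.
apply: (etrans (esym (Rintegral_fubini2 iIJ))).
apply: Rintegral_eq0 => y; rewrite /mix /=.
pose psi (x : V) := phi (s *: y + c *: x).
have spsi : smooth psi := smooth_affine (s *: y) c sphi.
have bpsi : bounded_support psi := bounded_support_affine (s *: y) c0 bphi.
have [M M0 psiM] := smooth_bounded spsi bpsi.
have [M' M'0 psiM'] := smooth_partial_bounded i spsi bpsi.
have mpsi := smooth_measurable spsi.
have E (x : V) : c * partial i phi (c *: x + s *: y) = partial i psi x.
  by rewrite addrC (partial_affine (s *: y) c i x sphi).
have -> : (fun x : V => h x * w y * (c * partial i phi (c *: x + s *: y) -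
      x ord0 i * phi (c *: x + s *: y)) + G x ord0 i * w y * phi (c *: x + s *: y)) =
   (fun x : V => w y * (h x * (partial i psi x - x ord0 i * psi x) + G x ord0 i * psi x)).
  by apply/funext => x; rewrite E /psi [c *: x + _]addrC; ring.
have ia : g.-integrable setT (EFin \o (fun x : V => h x * partial i psi x)).
  exact: (integrable_mul_bounded ih (smooth_measurable (smooth_partial i spsi)) psiM').
have ib := integrable_mul_bounded ihi mpsi psiM.
have ic : g.-integrable setT (EFin \o (fun x : V => G x ord0 i * psi x)) :=
  integrable_mul_bounded iG mpsi psiM.
have iab : g.-integrable setT (EFin \o (fun x : V => h x * (partial i psi x - x ord0 i * psi x))).
  have := integrableB measurableT ia ib.
  congr (_.-integrable _ _); apply/funext => x /=; rewrite -EFinB; congr EFin; ring.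
have iabc : g.-integrable setT (EFin \o (fun x : V => h x * (partial i psi x - x ord0 i * psi x) +
    G x ord0 i * psi x)) := integrableD measurableT iab ic.
rewrite (RintegralZl (w y) measurableT iabc) (RintegralD measurableT iab ic).
by rewrite (hG psi spsi bpsi) addNr mulr0.
Qed.

End rotation_by_parts.

Section rotation_estimate.
Context {R : realType} {n : nat}.
Local Notation V := 'rV[R]_n.
Local Notation g := (gauss_rV R n).
Local Notation gg := ((gauss_rV R n) \x (gauss_rV R n))%E.
Variables (h phi : V -> R) (G : V -> V) (p q H A B : R).
Hypotheses (p0 : 0 < p) (q0 : 0 < q) (pq : p^-1 + q^-1 = 1) (A0 : 0 <= A).
Hypotheses (mh : measurable_fun setT h) (hH : ('N[g]_p%:E[EFin \o h] <= H%:E)%E).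
Hypotheses (mG : measurable_fun setT G) (GA : (Lnorm_field p G <= A%:E)%E).
Hypotheses (sphi : smooth phi) (bphi : bounded_support phi).
Hypothesis phiB : ('N[g]_q%:E[EFin \o phi] <= B%:E)%E.
Hypothesis hG : forall i psi, smooth psi -> bounded_support psi ->
  \int[g]_x (h x * (partial i psi x - x ord0 i * psi x)) = - \int[g]_x (G x ord0 i * psi x).

Lemma integrable_component : forall i, g.-integrable setT (EFin \o component i G).
Proof.
move=> i; apply: (integrable_Lnorm (A := A) p0 q0 pq (measurable_field_component mG i)).
apply: le_trans GA; apply: Lnorm_le => //.
- exact: (measurable_field_component mG i).
- exact: (measurableT_comp measurable_enorm mG).
- by move=> x; rewrite [leRHS]ger0_norm ?enorm_ge0//; exact: ler_coor_enorm.
Qed.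

Let ih : g.-integrable setT (EFin \o h) := integrable_Lnorm p0 q0 pq mh hH.

Let ihi i : g.-integrable setT (EFin \o (fun x => h x * x ord0 i)).
Proof.
by have [] := hoelder_Rintegral p0 q0 pq mh (measurable_coor i) hH (Lnorm_coor i q0).
Qed.

Lemma integrable_dotr_mix c s : s != 0 -> c ^+ 2 + s ^+ 2 = 1 ->
  gg.-integrable setT (EFin \o (fun z => dotr z.2 (G z.1) * mix c s phi z)) /\
  `|\int[gg]_z (dotr z.2 (G z.1) * mix c s phi z)| <= gauss_moment p * A * B.
Proof.
move=> s0 cs1; have mphi := smooth_measurable sphi.
have hB : ('N[gg]_q%:E[EFin \o mix c s phi] <= B%:E)%E by rewrite Lnorm_mix.
exact: (hoelder_Rintegral p0 q0 pq (measurable_dotr_field mG) (measurable_mix c s mphi)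
  (Lnorm_dotr_field p0 A0 mG GA) hB).
Qed.

Lemma Rintegral_rotation_derivative c s : c != 0 -> s != 0 -> c ^+ 2 + s ^+ 2 = 1 ->
  \int[gg]_z (h z.1 * \sum_(i < n) (s * z.1 ord0 i - c * z.2 ord0 i) *
     mix c s (partial i phi) z) =
  \int[gg]_z (dotr z.2 (G z.1) * mix c s phi z).
Proof.
move=> c0 s0 cs1.
(* Both families have integral 0, [S] by parts in the second variable and [K] by parts in the first.
   In S - K the terms h x_i y_i phi cancel, and what remains is the integrand minus y_i G_i phi. *)
pose S i (z : V * V) := h z.1 * z.1 ord0 i * (s * mix c s (partial i phi) z -
  z.2 ord0 i * mix c s phi z).
pose K i (z : V * V) := h z.1 * z.2 ord0 i * (c * mix c s (partial i phi) z -
  z.1 ord0 i * mix c s phi z) + G z.1 ord0 i * z.2 ord0 i * mix c s phi z.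
have iS i : gg.-integrable setT (EFin \o S i) := integrable_ibp_snd c s i sphi bphi (ihi i).
have iK i : gg.-integrable setT (EFin \o K i).
  have i1 := integrable_ibp_fst c s sphi bphi ih (integrable_coor i) (ihi i).
  have [M _ phiM] := smooth_bounded sphi bphi.
  have i2 : gg.-integrable setT (EFin \o (fun z : V * V => G z.1 ord0 i * z.2 ord0 i * mix c s phi z)).
    apply: (integrable_mul_bounded (integrable_prod (integrable_component i) (integrable_coor i)) _ (M := M)).
      exact: (measurable_mix c s (smooth_measurable sphi)).
    by move=> z; exact: phiM.
  exact: (integrableD measurableT i1 i2).
have iSK i : gg.-integrable setT (EFin \o (fun z => S i z - K i z)) :=
  integrableB measurableT (iS i) (iK i).
have [iD _] := integrable_dotr_mix s0 cs1.
have E : (fun z : V * V => h z.1 * \sum_(i < n) (s * z.1 ord0 i - c * z.2 ord0 i) *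
     mix c s (partial i phi) z) =
   (fun z => \sum_(i < n) (S i z - K i z) + dotr z.2 (G z.1) * mix c s phi z).
  apply/funext => z; rewrite mulr_sumr /dotr mulr_suml -big_split /=.
  by apply: eq_bigr => i _; rewrite /S /K; ring.
rewrite E (RintegralD measurableT (integrable_Rsum _ iSK) iD) (Rintegral_sum _ iSK).
rewrite big1 ?add0r// => i _.
rewrite (RintegralB measurableT (iS i) (iK i)).
rewrite (Rintegral_ibp_snd c i sphi bphi s0 (ihi i)).
by rewrite (Rintegral_ibp_fst s sphi bphi c0 ih (integrable_coor i) (ihi i)
  (integrable_component i) (@hG i)) subrr.
Qed.

Let F (t : R) (z : V * V) : R := h z.1 * mix (cos t) (- sin t) phi z.

Let F' (t : R) (z : V * V) : R := h z.1 * \sum_(i < n)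
  ((- sin t) * z.1 ord0 i - cos t * z.2 ord0 i) *
  mix (cos t) (- sin t) (partial i phi) z.

Let is_derive_F (t : R) (z : V * V) : is_derive t 1 (F ^~ z) (F' t z).
Proof.
have d := @is_derive_curve R n phi (fun s => cos s *: z.1 + (- sin s) *: z.2)
  ((- sin t) *: z.1 - cos t *: z.2) t (@smooth_derivable _ _ _ sphi)
  (fun i => smooth_continuous (smooth_partial i sphi)).
have d' : is_derive t 1 (phi \o (fun s => cos s *: z.1 + (- sin s) *: z.2))
    (\sum_(i < n) ((- sin t) *: z.1 - cos t *: z.2) ord0 i *
      partial i phi (cos t *: z.1 + (- sin t) *: z.2)).
  apply: d => i.
  have e := is_deriveB (is_deriveZ (z.1 ord0 i) (is_derive_cos t))
    (is_deriveZ (z.2 ord0 i) (is_derive_sin t)).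
  have -> : (fun s : R => (cos s *: z.1 + - sin s *: z.2) ord0 i) =
    z.1 ord0 i \*: cos - z.2 ord0 i \*: sin.
    apply/funext => s; rewrite !mxE.
    change (cos s * z.1 ord0 i + - sin s * z.2 ord0 i = z.1 ord0 i * cos s - z.2 ord0 i * sin s).
    by ring.
  apply: (is_derive_eq e); rewrite !mxE /GRing.scale /=; ring.
apply: (is_derive_eq (is_deriveZ (h z.1) d')).
rewrite /F' /GRing.scale /=; congr (_ * _); apply: eq_bigr => i _.
by rewrite !mxE /mix.
Qed.

Let integrable_F (t : R) : gg.-integrable setT (EFin \o F t).
Proof.
have [M _ phiM] := smooth_bounded sphi bphi.
apply: (integrable_mul_bounded (integrable_fst ih) _ (M := M)).
  exact: (measurable_mix _ _ (smooth_measurable sphi)).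
by move=> z; exact: phiM.
Qed.

Let is_derive_int_F (t : R) :
  is_derive t 1 (fun t => \int[gg]_z F t z) (\int[gg]_z F' t z).
Proof.
have [M MP] := choice (fun i =>
  let: ex_intro2 M M0 MP := smooth_partial_bounded i sphi bphi in
  ex_intro (fun M : R => 0 <= M /\ forall x, `|partial i phi x| <= M) M (conj M0 MP)).
(* A majorant independent of the angle, since |sin| and |cos| are at most 1. The first product is
   integrable by Hoelder, the second as a product of functions of separate variables. *)
pose D (z : V * V) := \sum_(i < n) M i * (`|h z.1 * z.1 ord0 i| + `|h z.1 * z.2 ord0 i|).
apply: (@is_derive_Rintegral R _ _ gg F F' D t integrable_F is_derive_F).
  apply: integrable_Rsum => i.
  have i1 := integrable_norm (integrable_fst (ihi i)).
  have i2 := integrable_norm (integrable_prod ih (integrable_coor i)).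
  have := integrableZl measurableT (M i) (integrableD measurableT i1 i2).
  by congr (_.-integrable _ _); apply/funext => z /=; rewrite -EFinD.
move=> u z _; rewrite /F' normrM; apply: (@le_trans _ _ (`|h z.1| *
  \sum_(i < n) (`|z.1 ord0 i| + `|z.2 ord0 i|) * M i)).
  apply: ler_wpM2l => //; apply: le_trans (ler_norm_sum _ _ _) _.
  apply: ler_sum => i _; rewrite normrM; apply: ler_pM => //; last first.
    by have [_] := MP i; apply.
  apply: le_trans (ler_normB _ _) _; rewrite !normrM; apply: lerD; apply: ler_piMl => //.
    by rewrite normrN ler_norml sin_geN1 sin_le1.
  by rewrite ler_norml cos_geN1 cos_le1.
rewrite /D mulr_sumr; apply: ler_sum => i _; rewrite !normrM.
by rewrite le_eqVlt; apply/orP; left; apply/eqP; ring.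
Qed.

(** Used at angle 0, where it yields the weak convergence of T_t f to f as t tends to 0. *)
Lemma continuous_rotation :
  continuous (fun t : R => \int[gg]_z (h z.1 * mix (cos t) (- sin t) phi z)).
Proof.
move=> t; apply: differentiable_continuous; apply/derivable1_diffP.
exact: (@ex_derive _ _ _ _ _ _ _ (is_derive_int_F t)).
Qed.

Lemma Rintegral_rotation0 :
  \int[gg]_z (h z.1 * mix (cos 0) (- sin 0) phi z) = \int[g]_x (h x * phi x).
Proof.
have [M _ phiM] := smooth_bounded sphi bphi.
have mphi := smooth_measurable sphi.
have i0 : gg.-integrable setT (EFin \o (fun z => (h \* phi) z.1)).
  apply: integrable_fst; exact: (integrable_mul_bounded ih mphi phiM).
have -> : (fun z => h z.1 * mix (cos 0) (- sin 0) phi z) = (fun z => (h \* phi) z.1).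
  by apply/funext => z; rewrite /mix cos0 sin0 oppr0 scale1r scale0r addr0.
rewrite -(Rintegral_fubini1 i0); apply: eq_Rintegral => x _ /=.
exact: (congr1 fine (integral_gauss_cst n (h x * phi x)%:E)).
Qed.

(* The derivative in the angle is computed by parts in both variables; the terms
   without the gradient [G] of [h] cancel. *)
Lemma rotation_estimate (theta : R) : 0 < theta -> theta < pi / 2 ->
  `|\int[g]_x (h x * phi x) -
    \int[gg]_z (h z.1 * mix (cos theta) (- sin theta) phi z)| <=
  theta * (gauss_moment p * A * B).
Proof.
move=> t0 tpi.
have [xi + E] := MVT t0 (fun t _ => is_derive_int_F t)
  (derivable_within_continuous (fun t _ => @ex_derive _ _ _ _ _ _ _ (is_derive_int_F t))).
rewrite in_itv/= => /andP[xi0 xit].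
rewrite -Rintegral_rotation0.
rewrite distrC E subr0 normrM mulrC (gtr0_norm t0) ler_wpM2l ?(ltW t0)//.
(* The intermediate angle lies strictly between 0 and pi/2: neither cosine nor sine vanishes, as the
   integrations by parts in x and y require. *)
have xipi := lt_trans xit tpi.
have c0 : cos xi != 0.
  by rewrite gt_eqF// cos_gt0_pihalf// xipi andbT (lt_trans _ xi0)// oppr_lt0 divr_gt0// pi_gt0.
have s0 : - sin xi != 0.
  rewrite oppr_eq0 gt_eqF// sin_gt0_pi// xi0 (lt_trans xipi)//.
  by rewrite ltr_pdivrMr// ltr_pMr ?pi_gt0// ltr1n.
have cs1 : cos xi ^+ 2 + (- sin xi) ^+ 2 = 1 by rewrite sqrrN cos2Dsin2.
rewrite /F' (Rintegral_rotation_derivative c0 s0 cs1).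
by have [_] := integrable_dotr_mix s0 cs1.
Qed.

End rotation_estimate.

(** * Trigonometric and exponential inequalities *)

Section trigonometry.
Context {R : realType}.
Implicit Types t u : R.

Lemma ler_mul_cos_sin t : 0 <= t -> t <= pi -> t * cos t <= sin t.
Proof.
rewrite le_eqVlt => /predU1P[<- _|t0 tpi]; first by rewrite mul0r sin0.
pose F (s : R) := sin s - s * cos s.
have dF (s : R) : is_derive s 1 F (s * sin s).
  have := is_deriveB (is_derive_sin s) (is_deriveM (is_derive_id s 1) (is_derive_cos s)).
  by move=> d; apply: (is_derive_eq d); rewrite /GRing.scale /=; ring.
have [xi + E] := MVT t0 (fun s _ => dF s)
  (derivable_within_continuous (fun s _ => @ex_derive _ _ _ _ _ _ _ (dF s))).
rewrite in_itv/= => /andP[xi0 xit].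
rewrite -subr_ge0; move: E; rewrite /F sin0 mul0r subr0 subr0 subr0 => ->.
rewrite !mulr_ge0 ?(ltW t0)// ?(ltW xi0)// sin_ge0_pi// (ltW xi0)/=.
by rewrite ltW// (lt_le_trans xit).
Qed.

(** The product e^(t^2/2) cos t starts at 1 and decreases: its derivative has the sign of t cos t -
    sin t, which is nonpositive. *)
Lemma cos_le_expR t : 0 <= t -> t <= pi / 2 -> cos t <= expR (- (t ^+ 2 / 2)).
Proof.
rewrite le_eqVlt => /predU1P[<- _|t0 tpi]; first by rewrite cos0 expr0n mul0r oppr0 expR0.
have tpi' : t <= pi by rewrite (le_trans tpi)// ler_pdivrMr// ler_pMr ?pi_gt0// ler1n.
pose F (s : R) := expR (s ^+ 2 / 2) * cos s.
have dF (s : R) : is_derive s 1 F (expR (s ^+ 2 / 2) * (s * cos s - sin s)).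
  have dq : is_derive s 1 (fun s : R => s ^+ 2 / 2) s.
    have := is_deriveZ (2^-1) (is_deriveM (is_derive_id s 1) (is_derive_id s 1)).
    have -> : 2^-1 \*: (@id R * @id R) = (fun s : R => s ^+ 2 / 2).
      by apply/funext => x; change (2^-1 * (x * x) = x ^+ 2 / 2); field.
    by move=> d; apply: (is_derive_eq d); change (2^-1 * (s * 1 + s * 1) = s); field.
  have := is_deriveM (is_derive1_comp (is_derive_expR _) dq) (is_derive_cos s).
  by move=> d; apply: (is_derive_eq d); rewrite /GRing.scale /=; ring.
have [xi + E] := MVT t0 (fun s _ => dF s)
  (derivable_within_continuous (fun s _ => @ex_derive _ _ _ _ _ _ _ (dF s))).
rewrite in_itv/= => /andP[xi0 xit].
have F1 : F t <= 1.
  have <- : F 0 = 1 by rewrite /F cos0 mulr1 expr0n mul0r expR0.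
  rewrite -subr_le0 E subr0 mulr_le0_ge0 ?(ltW t0)// mulr_ge0_le0 ?expR_ge0//.
  by rewrite subr_le0 ler_mul_cos_sin ?(ltW xi0)// (le_trans (ltW xit)).
rewrite expRN -[leRHS]mul1r ler_pdivlMr ?expR_gt0// mulrC; exact: F1.
Qed.

(** The angle of the Mehler rotation at time u. Its bound is cos t <= e^(-t^2/2) read at cos t =
    e^(-u). *)
Lemma acos_expR u : 0 < u -> exists t : R,
  [/\ 0 < t, t < pi / 2, t <= Num.sqrt (2 * u), cos t = expR (- u) &
      sin t = Num.sqrt (1 - expR (- (2 * u)))].
Proof.
move=> u0; have e0 : 0 < expR (- u) by exact: expR_gt0.
have e1 : expR (- u) < 1 by rewrite -[ltRHS]expR0 ltr_expR oppr_lt0.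
have e11 : -1 <= expR (- u) <= 1 by rewrite (ltW e1) andbT (le_trans _ (ltW e0))// lerN10.
have t0 : 0 < acos (expR (- u)).
  by apply: acos_gt0; rewrite e1 andbT; case/andP: e11.
have cE : cos (acos (expR (- u))) = expR (- u) by have [] := acos_def e11.
have tpi : acos (expR (- u)) < pi / 2.
  rewrite -acos0 ltNge; apply/negP => h.
  have : cos (acos (expR (- u))) <= cos (acos 0).
    rewrite leNgt; apply/negP; rewrite ltr_cos; first by rewrite ltNge h.
    - by rewrite in_itv/= (ltW t0) acos_lepi.
    - by rewrite in_itv/= acos_ge0 ?acos_lepi ?lerN10 ?ler01.
  by rewrite cE acosK ?in_itv/= ?lerN10 ?ler01// leNgt e0.
exists (acos (expR (- u))); split => //.
- have := cos_le_expR (ltW t0) (ltW tpi).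
  rewrite cE ler_expR lerN2 => h.
  rewrite -(ger0_norm (ltW t0)) -sqrtr_sqr ler_sqrt ?mulr_ge0 ?(ltW u0)//.
  by rewrite -ler_pdivrMl// mulrC.
- rewrite sin_acos//; congr (Num.sqrt (1 - _)).
  by rewrite expr2 -expRD; congr expR; ring.
Qed.

(* This is where the constant 4 of the theorem comes from. *)
Lemma ln2_ge : Num.sqrt 6 / 4 <= ln 2 :> R.
Proof.
have s6 : Num.sqrt 6 / 4 <= 49 / 80 :> R.
  have : Num.sqrt 6 <= 49 / 20 :> R.
    rewrite -(@ger0_norm R (49 / 20)) ?divr_ge0// -sqrtr_sqr ler_sqrt ?sqr_ge0//; lra.
  lra.
apply: (le_trans s6); rewrite -ler_expR lnK ?posrE//.
(* It remains to see e^(49/80) <= 2, where 49/20 is slightly above sqrt 6. The tangent bound 1 - x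
   <= e^(-x) is too weak at 49/80, but suffices at a quarter of it, raised to the fourth power. *)
have h : (1 / 2 <= expR (- (49 / 320)) ^+ 4 :> R).
  apply: (@le_trans _ _ ((1 - 49 / 320) ^+ 4)); first by lra.
  have h1 : 1 - 49 / 320 <= expR (- (49 / 320)) :> R by exact: expR_ge1Dx.
  have h0 : 0 <= 1 - 49 / 320 :> R by rewrite subr_ge0; lra.
  by apply: lerXn2r h1; rewrite nnegrE ?expR_ge0.
have e : expR (49 / 80) * expR (- (49 / 320)) ^+ 4 = 1 :> R.
  rewrite -expRM_natl -expRD -[RHS]expR0; congr expR; lra.
have := expR_gt0 (49 / 80 : R); nra.
Qed.

End trigonometry.

(** * Composition, duality and small times for the Ornstein-Uhlenbeck semigroup *)

Section OU_semigroup.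
Context {R : realType} {n : nat}.
Local Notation V := 'rV[R]_n.
Local Notation g := (gauss_rV R n).
Local Notation gg := ((gauss_rV R n) \x (gauss_rV R n))%E.
Implicit Types (f h phi : V -> R) (G Phi : V -> V) (c s u t p q F A B M : R).

Lemma Rintegral_mix_mehler h phi c s M : g.-integrable setT (EFin \o h) ->
  measurable_fun setT phi -> (forall x, `|phi x| <= M) ->
  \int[gg]_z (h z.1 * mix c s phi z) = \int[g]_x (h x * mehler c s phi x).
Proof.
move=> ih mphi phiM.
have iI : gg.-integrable setT (EFin \o (fun z => h z.1 * mix c s phi z)).
  apply: (integrable_mul_bounded (integrable_fst ih) (measurable_mix c s mphi) (M := M)).
  by move=> z; exact: phiM.
rewrite -(Rintegral_fubini1 iI); apply: eq_Rintegral => x _.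
apply: (RintegralZl (h x) measurableT).
apply: (integrable_bounded (M := M) g (measurable_affine_section c s x mphi)) => y.
exact: phiM.
Qed.

(** The two noises combine into c2 s1 y + s2 z = s (a y + b z) with a^2 + b^2 = 1, the first
    component of a rotation, which is distributed as y. *)
Lemma mehler_comp phi (c1 s1 c2 s2 s : R) M : s != 0 -> s2 != 0 ->
  (c2 * s1) ^+ 2 + s2 ^+ 2 = s ^+ 2 ->
  measurable_fun setT phi -> (forall x, `|phi x| <= M) ->
  mehler c1 s1 (mehler c2 s2 phi) = mehler (c1 * c2) s phi.
Proof.
move=> s0 s20 ss mphi phiM; apply/funext => x.
pose a := c2 * s1 / s; pose b := s2 / s.
have b0 : b != 0 by rewrite mulf_neq0// invr_eq0.
have ab1 : a ^+ 2 + b ^+ 2 = 1.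
  by rewrite /a /b [X in X + _]exprMn [X in _ + X]exprMn -mulrDl ss -exprMn mulfV// expr1n.
pose k (w : V) := phi ((c1 * c2) *: x + s *: w).
have mk : measurable_fun setT k := measurable_affine_section (c1 * c2) s x mphi.
have mk1 : measurable_fun setT (fun z : V * V => k z.1) := measurableT_comp mk measurable_fst.
have ik : g.-integrable setT (EFin \o k).
  by apply: (integrable_bounded (M := M) g mk) => w; exact: phiM.
have E := Rintegral_rot b0 ab1 mk1.
have i1 : gg.-integrable setT (EFin \o (fun z => k z.1)) := integrable_fst ik.
have i2 : gg.-integrable setT (EFin \o (fun z => k (rot a b z).1)).
  exact: (integrable_rot b0 ab1 i1).
transitivity (\int[gg]_z k (rot a b z).1).
  rewrite -(Rintegral_fubini1 i2) /mehler; apply: eq_Rintegral => y _.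
  apply: eq_Rintegral => z _; rewrite /k /rot /=; congr phi.
  apply/rowP => i; rewrite !mxE /a /b; field.
  exact: s0.
rewrite E -(Rintegral_fubini1 i1) /mehler; apply: eq_Rintegral => y _.
exact: (congr1 fine (integral_gauss_cst n (k y)%:E)).
Qed.

Lemma OU_coef u : 0 < u -> 0 < Num.sqrt (1 - expR (- (2 * u))) /\
  expR (- u) ^+ 2 + Num.sqrt (1 - expR (- (2 * u))) ^+ 2 = 1.
Proof.
move=> u0.
have e1 : expR (- (2 * u)) < 1 by rewrite -[ltRHS]expR0 ltr_expR oppr_lt0 mulr_gt0.
rewrite sqrtr_gt0 subr_gt0; split => //; rewrite sqr_sqrtr ?subr_ge0 ?(ltW e1)//.
have -> : expR (- u) ^+ 2 = expR (- (2 * u)) by rewrite expr2 -expRD; congr expR; ring.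
by rewrite addrC subrK.
Qed.

(** The adjoint of T_u, as delivered by the inverse rotation. *)
Let Q u phi : V -> R := mehler (expR (- u)) (- Num.sqrt (1 - expR (- (2 * u)))) phi.

(** The semigroup law is proved on the adjoint side, for bounded functions, where all integrals
    converge at every point; duality then transfers it to f, which is only in L^p. *)
Lemma OU_adjoint_comp u v phi M : 0 < u -> 0 < v ->
  measurable_fun setT phi -> (forall x, `|phi x| <= M) ->
  Q u (Q v phi) = Q (u + v) phi.
Proof.
move=> u0 v0 mphi phiM.
have uv0 : 0 < u + v by rewrite addr_gt0.
have [su0 cu] := OU_coef u0; have [sv0 cv] := OU_coef v0; have [suv0 cuv] := OU_coef uv0.
rewrite /Q.
have E : expR (- u) * expR (- v) = expR (- (u + v)) by rewrite -expRD opprD.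
rewrite -[in RHS]E; apply: (@mehler_comp phi _ _ _ _ _ M) => //.
- by rewrite oppr_eq0 gt_eqF.
- by rewrite oppr_eq0 gt_eqF.
- have key (su sv suv a b : R) : a ^+ 2 + su ^+ 2 = 1 -> b ^+ 2 + sv ^+ 2 = 1 ->
      (a * b) ^+ 2 + suv ^+ 2 = 1 -> (b * - su) ^+ 2 + (- sv) ^+ 2 = (- suv) ^+ 2.
    move=> h1 h2 h3.
    have -> : (- suv) ^+ 2 = 1 - (a * b) ^+ 2 by rewrite -h3; ring.
    have -> : (- sv) ^+ 2 = 1 - b ^+ 2 by rewrite -h2; ring.
    have -> : (b * - su) ^+ 2 = b ^+ 2 * (1 - a ^+ 2) by rewrite -h1; ring.
    ring.
  by apply: key cu cv _; rewrite E.
Qed.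

Section with_f.
Variables (f : V -> R) (p q F : R).
Hypotheses (p0 : 0 < p) (q0 : 0 < q) (pq : p^-1 + q^-1 = 1).
Hypotheses (mf : measurable_fun setT f) (fF : ('N[g]_p%:E[EFin \o f] <= F%:E)%E).

Let F0 : 0 <= F.
Proof. by rewrite -lee_fin (le_trans _ fF)// Lnorm_ge0. Qed.

Lemma measurable_OU u : 0 < u -> measurable_fun setT (OU u f).
Proof.
move=> u0; have [s0 cs1] := OU_coef u0; rewrite OU_mehlerE.
by apply: measurable_mehler => //; [rewrite gt_eqF|exact: (integrable_Lnorm p0 q0 pq mf fF)].
Qed.

Lemma Lnorm_OU u : 0 < u -> ('N[g]_p%:E[EFin \o OU u f] <= F%:E)%E.
Proof.
move=> u0; have [s0 cs1] := OU_coef u0; rewrite OU_mehlerE.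
by apply: (Lnorm_mehler p0 q0 pq F0 _ cs1 mf fF); rewrite gt_eqF.
Qed.

Lemma OU_duality u phi M : 0 < u -> measurable_fun setT phi -> (forall x, `|phi x| <= M) ->
  \int[g]_x (OU u f x * phi x) = \int[g]_x (f x * Q u phi x).
Proof.
move=> u0 mphi phiM; have [s0 cs1] := OU_coef u0; rewrite OU_mehlerE.
by apply: (mehler_duality_bounded p0 q0 pq _ cs1 mf mphi fF phiM); rewrite gt_eqF.
Qed.

Lemma measurable_OU_adjoint u phi M : 0 < u -> measurable_fun setT phi ->
  (forall x, `|phi x| <= M) -> measurable_fun setT (Q u phi).
Proof.
move=> u0 mphi phiM; have [s0 cs1] := OU_coef u0.
apply: measurable_mehler; first by rewrite oppr_eq0 gt_eqF.
  by rewrite sqrrN.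
exact: (integrable_bounded g mphi phiM).
Qed.

(** The rotation by theta with cos theta = e^(-3u) acts on phi as the adjoint of T_3u; paired with
    T_u f this gives T_4u f paired with phi. The factor sqrt(6u) bounds theta. *)
Lemma OU_step u G phi A B : 0 < u -> 0 <= A -> generalized_gradient (OU u f) G ->
  (Lnorm_field p G <= A%:E)%E -> smooth phi -> bounded_support phi ->
  ('N[g]_q%:E[EFin \o phi] <= B%:E)%E ->
  `|\int[g]_x (OU u f x * phi x) - \int[g]_x (OU (4 * u) f x * phi x)| <=
  Num.sqrt (6 * u) * (gauss_moment p * A * B).
Proof.
move=> u0 A0 hG GA sphi bphi phiB.
have u30 : 0 < 3 * u by rewrite mulr_gt0.
have u40 : 0 < 4 * u by rewrite mulr_gt0.
have [M M0 phiM] := smooth_bounded sphi bphi.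
have mphi := smooth_measurable sphi.
have [t [t0 tpi tu ct st]] := acos_expR u30.
have mG : measurable_fun setT G.
  by apply: measurable_fun_rVP => i; have [_ lG _] := hG; exact: (loc_integrable_measurable (lG i)).
have mh := measurable_OU u0.
have ih := integrable_Lnorm p0 q0 pq mh (Lnorm_OU u0).
have := rotation_estimate p0 q0 pq A0 mh (Lnorm_OU u0) mG GA sphi bphi phiB
  (fun i psi => @generalized_gradient_gauss _ _ _ _ i psi hG) t0 tpi.
rewrite ct st (Rintegral_mix_mehler _ _ ih mphi phiM).
rewrite (@OU_duality _ (Q (3 * u) phi) M u0 (measurable_OU_adjoint u30 mphi phiM)); last first.
  by apply: bounded_mehler.
have uE : u + 3 * u = 4 * u by ring.
have QE : Q u (Q (3 * u) phi) = Q (4 * u) phi :=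
  etrans (OU_adjoint_comp u0 u30 mphi phiM) (congr1 (fun v => Q v phi) uE).
have E := etrans (OU_duality u40 mphi phiM)
  (congr1 (fun w => \int[g]_x (f x * w x)) (esym QE)).
have main (a b b' k k' : R) : `|a - b| <= k -> b' = b -> k <= k' -> `|a - b'| <= k'.
  by move=> le1 ->; exact: le_trans.
move=> le1; apply: (main _ _ _ _ _ le1 E).
apply: ler_wpM2r; last by move: tu; have -> : 2 * (3 * u) = 6 * u by ring.
have B0 : 0 <= B by rewrite -lee_fin (le_trans _ phiB)// Lnorm_ge0.
by rewrite !mulr_ge0// ltW// gauss_moment_gt0.
Qed.

(** The angles attached to the times t/4^k are at most sqrt(2t)/2^k, so the claim is the continuity
    of the rotated pairing at angle 0. *)
Lemma OU_cvg0 t phi : 0 < t -> smooth phi -> bounded_support phi ->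
  (fun k : nat => \int[g]_x (OU (t / 4 ^+ k) f x * phi x)) @ \oo --> \int[g]_x (f x * phi x).
Proof.
move=> t0 sphi bphi.
have [M M0 phiM] := smooth_bounded sphi bphi.
have mphi := smooth_measurable sphi.
have tk0 k : 0 < t / 4 ^+ k by rewrite divr_gt0// exprn_gt0.
have [th thP] := choice (fun k => acos_expR (tk0 k)).
have i_f := integrable_Lnorm p0 q0 pq mf fF.
have -> : (fun k : nat => \int[g]_x (OU (t / 4 ^+ k) f x * phi x)) =
  (fun t : R => \int[gg]_z (f z.1 * mix (cos t) (- sin t) phi z)) \o th.
  apply/funext => k /=; have [_ _ _ -> ->] := thP k.
  by rewrite (Rintegral_mix_mehler _ _ i_f mphi phiM) (OU_duality (tk0 k) mphi phiM).
rewrite -(Rintegral_rotation0 p0 q0 pq mf fF sphi bphi).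
have cr := continuous_rotation p0 q0 pq mf fF sphi bphi.
have c0 := cr (0 : R).
suff th0 : th k @[k --> \oo] --> (0 : R) by exact: (cvg_comp _ _ th0 c0).
apply: (@squeeze_cvgr _ _ _ _ (fun=> 0) (fun k => Num.sqrt (2 * t) * 2^-1 ^+ k)).
- near=> k; have [tk1 _ tk2 _ _] := thP k; rewrite (ltW tk1) (le_trans tk2)//.
  rewrite mulrA sqrtrM ?mulr_ge0 ?(ltW t0)// ler_wpM2l ?sqrtr_ge0//.
  have -> : (4 ^+ k)^-1 = (2^-1 ^+ k) ^+ 2 :> R.
    by rewrite -exprM mulnC exprM -exprVn; congr (_ ^+ k); lra.
  by rewrite sqrtr_sqr ger0_norm// exprn_ge0.
- exact: cvg_cst.
- rewrite -(mulr0 (Num.sqrt (2 * t))); apply: cvgMr; apply: cvg_expr.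
  by rewrite ger0_norm//; lra.
Unshelve. all: by end_near. Qed.

End with_f.
End OU_semigroup.

Section gradient_pairing.
Context {R : realType} {n : nat}.
Local Notation V := 'rV[R]_n.
Local Notation g := (gauss_rV R n).
Implicit Types (u : V -> R) (G Phi : V -> V) (p q F A B : R).

Lemma smooth_div_gauss Phi : (forall i, smooth (component i Phi)) -> smooth (div_gauss Phi).
Proof.
move=> sPhi; apply: smooth_sum => i.
have -> : (fun x => partial i (component i Phi) x - x ord0 i * Phi x ord0 i) =
  partial i (component i Phi) \+ (fun _ => -1) \* ((fun x : V => x ord0 i) \* component i Phi).
  apply/funext => x; change (partial i (component i Phi) x - x ord0 i * Phi x ord0 i =
    partial i (component i Phi) x + -1 * (x ord0 i * Phi x ord0 i)); ring.
exact: (smoothD (smooth_partial i (sPhi i))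
  (smoothM (smooth_cst _) (smoothM (smooth_coor i) (sPhi i)))).
Qed.

Lemma test_fieldP Phi : test_field Phi <-> (forall i, smooth (component i Phi)) /\
  (exists M : R, forall x, Phi x != 0 -> `|x| <= M).
Proof. by split=> -[sPhi /compact_support_bounded]. Qed.

Lemma bounded_support_component Phi i : (exists M : R, forall x, Phi x != 0 -> `|x| <= M) ->
  bounded_support (component i Phi).
Proof.
move=> [M PhiM]; exists M => x Phix; apply: PhiM; apply: contraNneq Phix => Phi0.
by rewrite /component Phi0 mxE.
Qed.

Lemma bounded_support_div_gauss Phi : (exists M : R, forall x, Phi x != 0 -> `|x| <= M) ->
  bounded_support (div_gauss Phi).
Proof.
move=> bPhi.
have [N NP] := choice (fun i => bounded_support_partial i (bounded_support_component i bPhi)).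
have [M PhiM] := bPhi.
exists (`|M| + \sum_i `|N i|) => x; apply: contraNle => xM; apply/eqP.
apply: big1 => i _.
have NM : \sum_i `|N i| >= `|N i| by rewrite (bigD1 i)//= lerDl sumr_ge0.
have -> : partial i (component i Phi) x = 0.
  apply/eqP; apply: contraTT xM => /NP xN; rewrite -leNgt (le_trans xN)//.
  by rewrite (le_trans (ler_norm _))// (le_trans NM)// lerDr.
have -> : Phi x ord0 i = 0.
  apply/eqP; apply: contraTT xM => Phix; rewrite -leNgt (@le_trans _ _ `|M|) ?lerDl ?sumr_ge0//.
  rewrite (le_trans _ (ler_norm M))// PhiM//; apply: contraNneq Phix => ->.
  by rewrite mxE.
by rewrite mulr0 subrr.
Qed.

Lemma field_measurable Phi : (forall i, smooth (component i Phi)) -> measurable_fun setT Phi.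
Proof. by move=> sPhi; apply: measurable_fun_rVP => i; exact: (smooth_measurable (sPhi i)). Qed.

Lemma gradient_measurable u G : generalized_gradient u G -> measurable_fun setT G.
Proof.
by move=> [_ lG _]; apply: measurable_fun_rVP => i; exact: (loc_integrable_measurable (lG i)).
Qed.

(** Testing coordinate by coordinate turns the left side into minus the mean of <G, Phi>;
    Cauchy-Schwarz at each point and Hoelder finish. *)
Lemma gradient_pairing u G Phi p q F A B : 0 < p -> 0 < q -> p^-1 + q^-1 = 1 ->
  measurable_fun setT u -> ('N[g]_p%:E[EFin \o u] <= F%:E)%E ->
  generalized_gradient u G -> (Lnorm_field p G <= A%:E)%E -> 0 <= A ->
  test_field Phi -> (Lnorm_field q Phi <= B%:E)%E ->
  `|\int[g]_x (u x * div_gauss Phi x)| <= A * B.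
Proof.
move=> p0 q0 pq mu uF hG GA A0 /test_fieldP[sPhi bPhi] PhiB.
have mG := gradient_measurable hG.
have mPhi := field_measurable sPhi.
have bPhii i := bounded_support_component i bPhi.
have iu := integrable_Lnorm p0 q0 pq mu uF.
have iG i := integrable_component p0 q0 pq mG GA i.
have iui i : g.-integrable setT (EFin \o (fun x => u x * x ord0 i)).
  by have [] := hoelder_Rintegral p0 q0 pq mu (measurable_coor i) uF (Lnorm_coor i q0).
have iD i : g.-integrable setT (EFin \o (fun x : V =>
    u x * (partial i (component i Phi) x - x ord0 i * Phi x ord0 i))).
  have [M _ PM] := smooth_bounded (sPhi i) (bPhii i).
  have [M' _ PM'] := smooth_partial_bounded i (sPhi i) (bPhii i).
  have i1 := integrable_mul_bounded iu (smooth_measurable (smooth_partial i (sPhi i))) PM'.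
  have i2 := integrable_mul_bounded (iui i) (smooth_measurable (sPhi i)) PM.
  have := integrableB measurableT i1 i2.
  congr (_.-integrable _ _); apply/funext => x /=; rewrite /component -EFinB; congr EFin; ring.
have iGP i : g.-integrable setT (EFin \o (fun x : V => G x ord0 i * Phi x ord0 i)).
  have [M _ PM] := smooth_bounded (sPhi i) (bPhii i).
  exact: (integrable_mul_bounded (iG i) (smooth_measurable (sPhi i)) PM).
have -> : \int[g]_x (u x * div_gauss Phi x) = - \int[g]_x dotr (G x) (Phi x).
  transitivity (\sum_i \int[g]_x (u x * (partial i (component i Phi) x - x ord0 i * Phi x ord0 i))).
    rewrite -(Rintegral_sum _ iD); apply: eq_Rintegral => x _.
    by rewrite /div_gauss mulr_sumr.
  transitivity (\sum_i - \int[g]_x (G x ord0 i * Phi x ord0 i)).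
    apply: eq_bigr => i _; exact (@generalized_gradient_gauss _ _ _ _ i _ hG (sPhi i) (bPhii i)).
  by rewrite sumrN -(Rintegral_sum _ iGP).
rewrite normrN.
have meG : measurable_fun setT (enorm \o G) := measurableT_comp measurable_enorm mG.
have meP : measurable_fun setT (enorm \o Phi) := measurableT_comp measurable_enorm mPhi.
have [iH H] := hoelder_Rintegral p0 q0 pq meG meP GA PhiB.
apply: le_trans H; apply: le_trans (ler_norm _).
have md : measurable_fun setT (fun x => dotr (G x) (Phi x)).
  apply: measurable_sum => i; apply: measurable_funM.
    exact: (measurable_field_component mG i).
  exact: (measurable_field_component mPhi i).
rewrite -lee_fin (le_trans (le_abs_Rintegral g md))//.
rewrite /Rintegral fineK; last exact: (integrable_fin_num measurableT iH).
apply: ge0_le_integral => //.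
- by apply: measurableT_comp => //; exact/measurable_EFinP.
- exact/measurable_EFinP/measurable_funM.
- by move=> x _; rewrite lee_fin dotr_le_enorm.
Qed.

End gradient_pairing.

(** * Summation over the times t/4^k and optimisation in t *)

(** With x = alpha ln 2 this is e^(-x) <= (1 - e^(-x))/x, that is 1 + x <= e^x. It bounds the
    geometric sum r/(1 - r) by 1/(alpha ln 2). *)
Lemma powR4_ratio {R : realType} (alpha : R) : 0 < alpha ->
  4^-1 `^ (alpha / 2) <= (alpha * ln 2)^-1 * (1 - 4^-1 `^ (alpha / 2)) :> R.
Proof.
move=> a0; have ln20 : 0 < ln 2 :> R by apply: ln_gt0; lra.
have -> : 4^-1 `^ (alpha / 2) = expR (- (alpha * ln 2)) :> R.
  rewrite /powR invr_eq0 pnatr_eq0 /= lnV ?posrE// (_ : 4 = 2 ^+ 2 :> R); last by lra.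
  by rewrite lnXn// mulr2n; congr expR; field.
rewrite ler_pdivlMl ?mulr_gt0// expRN.
set x := alpha * ln 2; have x0 : 0 < x by rewrite mulr_gt0.
rewrite ler_pdivrMr ?expR_gt0// mulrBl mul1r mulVf ?gt_eqF ?expR_gt0//.
by rewrite lerBrDl expR_ge1Dx.
Qed.

Lemma sqrt6_ln2 {R : realType} (alpha : R) : 0 < alpha ->
  Num.sqrt 6 * (alpha * ln 2)^-1 <= 4 * alpha^-1 :> R.
Proof.
move=> a0; have ln20 : 0 < ln 2 :> R by apply: ln_gt0; lra.
have h := @ln2_ge R.
have n0 : alpha != 0 by rewrite gt_eqF.
rewrite ler_pdivrMr ?mulr_gt0//.
have -> : 4 * alpha^-1 * (alpha * ln 2) = 4 * ln 2 :> R by field.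
lra.
Qed.

Section upper_bound.
Context {R : realType} {n : nat}.
Local Notation V := 'rV[R]_n.
Local Notation g := (gauss_rV R n).
Variables (f : V -> R) (p q F alpha U : R).
Hypotheses (p0 : 0 < p) (q0 : 0 < q) (pq : p^-1 + q^-1 = 1).
Hypotheses (alpha0 : 0 < alpha) (U0 : 0 <= U).
Hypotheses (mf : measurable_fun setT f) (fF : ('N[g]_p%:E[EFin \o f] <= F%:E)%E).
Hypothesis fU : forall t : R, 0 < t -> exists2 G, generalized_gradient (OU t f) G &
  (Lnorm_field p G <= (U * t `^ (- ((1 - alpha) / 2)))%:E)%E.
Variables (Phi : V -> V) (A B : R).
Hypotheses (tPhi : test_field Phi) (PhiA : (Lnorm_field q Phi <= A%:E)%E).
Hypothesis PhiB : ('N[g]_q%:E[EFin \o div_gauss Phi] <= B%:E)%E.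

Let B0 : 0 <= B.
Proof. by rewrite -lee_fin (le_trans _ PhiB)// Lnorm_ge0. Qed.

Let sdiv : smooth (div_gauss Phi).
Proof. by have [sPhi _] := tPhi; exact: smooth_div_gauss. Qed.

Let bdiv : bounded_support (div_gauss Phi).
Proof. by have /test_fieldP[_ bPhi] := tPhi; exact: bounded_support_div_gauss. Qed.

Let I (t : R) := \int[g]_x (OU t f x * div_gauss Phi x).

Lemma Rintegral_OU_div (t : R) : 0 < t -> `|I t| <= U * t `^ (- ((1 - alpha) / 2)) * A.
Proof.
move=> t0; have [G hG GA] := fU t0.
have [s0 cs1] := OU_coef t0.
apply: (gradient_pairing p0 q0 pq (measurable_OU p0 q0 pq mf fF t0)
  (Lnorm_OU p0 q0 pq mf fF t0) hG GA _ tPhi PhiA).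
by rewrite mulr_ge0 ?powR_ge0.
Qed.

Lemma Rintegral_OU_step (u : R) : 0 < u ->
  `|I u - I (4 * u)| <= Num.sqrt 6 * (gauss_moment p * U * B) * u `^ (alpha / 2).
Proof.
move=> u0; have [G hG GA] := fU u0.
have A0 : 0 <= U * u `^ (- ((1 - alpha) / 2)) by rewrite mulr_ge0 ?powR_ge0.
have := OU_step p0 q0 pq mf fF u0 A0 hG GA sdiv bdiv PhiB.
move=> /le_trans; apply.
(* The factor sqrt(u) from the angle turns the exponent -(1 - alpha)/2 of the gradient bound into
   alpha/2. *)
have -> : u `^ (alpha / 2) = Num.sqrt u * u `^ (- ((1 - alpha) / 2)).
  have -> : alpha / 2 = 2^-1 + - ((1 - alpha) / 2) by lra.
  by rewrite powRD ?powR12_sqrt ?(ltW u0)// (gt_eqF u0) implybT.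
rewrite sqrtrM// le_eqVlt; apply/orP; left; apply/eqP; ring.
Qed.

Lemma Rintegral_div_gauss_le (t : R) : 0 < t ->
  `|\int[g]_x (f x * div_gauss Phi x)| <=
  U * (t `^ (- ((1 - alpha) / 2)) * A + 4 * gauss_moment p * alpha^-1 * (B * t `^ (alpha / 2))).
Proof.
move=> t0.
have key (x y z : R) : 0 <= z -> x <= y * (1 - x) -> x * z + y * (1 - z) <= y * (1 - x * z).
  move=> z0 xy; rewrite -subr_ge0.
  have -> : y * (1 - x * z) - (x * z + y * (1 - z)) = (y * (1 - x) - x) * z by ring.
  by rewrite mulr_ge0// subr_ge0.
(* Telescoping along the times t / 4^k gives a geometric series of ratio r. *)
pose r : R := 4^-1 `^ (alpha / 2); pose D : R := (alpha * ln 2)^-1.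
pose K : R := Num.sqrt 6 * (gauss_moment p * U * B) * t `^ (alpha / 2).
have Cp0 := ltW (gauss_moment_gt0 p0).
have K0 : 0 <= K by rewrite /K !mulr_ge0 ?powR_ge0 ?sqrtr_ge0.
have ln20 : 0 < ln 2 :> R by apply: ln_gt0; lra.
have D0 : 0 <= D by rewrite invr_ge0 mulr_ge0 ?ltW.
have r0 : 0 <= r by exact: powR_ge0.
have rD : r <= D * (1 - r) by exact: powR4_ratio.
have tk0 (k : nat) : 0 < t / 4 ^+ k by rewrite divr_gt0// exprn_gt0.
(* The accumulated error is kept in the form D (1 - r^k), which one more step of size r^(k+1)
   respects because r <= D (1 - r). *)
have step (k : nat) : `|I (t / 4 ^+ k)| <= `|I t| + K * (D * (1 - r ^+ k)).
  elim: k => [|k IH]; first by rewrite !expr0 divr1 subrr !mulr0 addr0.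
  have := Rintegral_OU_step (tk0 k.+1).
  have -> : 4 * (t / 4 ^+ k.+1) = t / 4 ^+ k.
    by rewrite exprS; field; rewrite expf_neq0.
  have -> : Num.sqrt 6 * (gauss_moment p * U * B) * (t / 4 ^+ k.+1) `^ (alpha / 2) = K * r ^+ k.+1.
    rewrite powRM ?invr_ge0 ?exprn_ge0 ?(ltW t0)// mulrA -/K; congr (_ * _).
    rewrite -exprVn -(powR_mulrn k.+1 (_ : 0 <= 4^-1)) ?invr_ge0//.
    by rewrite -powRrM [k.+1%:R * _]mulrC powRrM powR_mulrn ?powR_ge0.
  move=> h; have := ler_normD (I (t / 4 ^+ k.+1) - I (t / 4 ^+ k)) (I (t / 4 ^+ k)).
  rewrite subrK => /le_trans; apply.
  apply: (le_trans (lerD h IH)).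
  rewrite addrCA lerD2l -mulrDr ler_wpM2l// !exprS.
  have rk : 0 <= r ^+ k by exact: exprn_ge0.
  exact: key rk rD.
have lim : `|I (t / 4 ^+ k)| @[k --> \oo] --> `|\int[g]_x (f x * div_gauss Phi x)|.
  exact: cvg_norm (OU_cvg0 p0 q0 pq mf fF t0 sdiv bdiv).
have bd (k : nat) : `|I (t / 4 ^+ k)| <= `|I t| + K * D.
  apply: (le_trans (step k)); rewrite lerD2l ler_wpM2l// ler_piMr//.
  by rewrite gerBl exprn_ge0.
apply: (@le_trans _ _ (`|I t| + K * D)).
  rewrite -(cvg_lim _ lim)//; apply: limr_le.
    by apply/cvg_ex; eexists; exact: lim.
  by near=> k; exact: bd.
rewrite mulrDr; apply: lerD.
  by rewrite mulrA; exact: Rintegral_OU_div.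
have := sqrt6_ln2 alpha0; rewrite -/D => h.
have Y0 : 0 <= gauss_moment p * U * B * t `^ (alpha / 2) by rewrite !mulr_ge0 ?powR_ge0.
apply: le_trans (le_trans (ler_wpM2r Y0 h) _); rewrite le_eqVlt; apply/orP; left; apply/eqP.
  by rewrite /K; ring.
by ring.
Unshelve. all: by end_near. Qed.

End upper_bound.

Lemma powR_optimization {R : realType} (X U c A B alpha : R) :
  0 <= U -> 0 <= c -> 0 <= A -> 0 <= B -> 0 < alpha -> alpha <= 1 ->
  (forall t : R, 0 < t ->
     X <= U * (t `^ (- ((1 - alpha) / 2)) * A + c * (B * t `^ (alpha / 2)))) ->
  X <= (c + 1) * U * (A `^ alpha * B `^ (1 - alpha)).
Proof.
move=> U0 c0 A0 B0 a0 a1 H.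
have small (k : R) : 0 <= k -> (forall d : R, 0 < d -> X <= k * d) -> X <= 0.
  move=> k0 kX; rewrite leNgt; apply/negP => X0.
  have k10 : 0 < k + 1 by rewrite ltr_wpDl.
  have := kX (X / (k + 1)) (divr_gt0 X0 k10).
  by rewrite mulrA ler_pdivlMr// [X * _]mulrC ler_pM2r// leNgt ltrDl ltr01.
have [A00|A_neq0] := eqVneq A 0.
  rewrite A00 powR0 ?gt_eqF// mul0r mulr0.
  apply: (small (U * (c * B))) => [|d d0]; first by rewrite !mulr_ge0.
  (* For A = 0 let t tend to 0: at this t the remaining term is a fixed multiple of the arbitrary
     d. *)
  have := H (d `^ (2 / alpha)) (powR_gt0 _ d0).
  have an0 : alpha != 0 by rewrite gt_eqF.
  rewrite A00 mulr0 add0r -!powRrM.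
  have -> : 2 / alpha * (alpha / 2) = 1 by field.
  by rewrite powRr1 ?(ltW d0)// !mulrA.
have Ap : 0 < A by rewrite lt0r A_neq0.
have [B00|B_neq0] := eqVneq B 0.
  have [al1|aln1] := eqVneq alpha 1.
    (* Here 0^0 = 1, so the target keeps the factor A and t = 1 suffices. *)
    have := H 1 ltr01; rewrite B00 al1 subrr mul0r oppr0 !powRr0 mul0r mulr0 addr0 mul1r mulr1.
    move=> /le_trans; apply; rewrite powRr1// ler_wpM2r// ler_peMl//.
    by rewrite lerDr.
  have al0 : 1 - alpha != 0 by rewrite subr_eq0 eq_sym.
  rewrite B00 (powR0 al0) !mulr0.
  apply: (small (U * A)) => [|d d0]; first by rewrite mulr_ge0.
  (* For B = 0 and alpha < 1 let t tend to infinity: at this t the remaining term is again linear in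
     d. *)
  have := H (d `^ (- (2 / (1 - alpha)))) (powR_gt0 _ d0).
  rewrite B00 mul0r mulr0 addr0 -powRrM.
  have -> : - (2 / (1 - alpha)) * - ((1 - alpha) / 2) = 1 by field.
  by rewrite powRr1 ?(ltW d0)// [d * A]mulrC mulrA.
have Bp : 0 < B by rewrite lt0r B_neq0.
(* The right-hand side of the hypothesis is balanced at t = (A / B)^2. *)
have AB0 : 0 < A / B by exact: divr_gt0.
have := H ((A / B) `^ 2) (powR_gt0 _ AB0); rewrite -!powRrM.
have -> : 2 * - ((1 - alpha) / 2) = alpha - 1 by lra.
have -> : 2 * (alpha / 2) = alpha by lra.
have E1 : B * (A / B) `^ alpha = A `^ alpha * B `^ (1 - alpha).
  rewrite powRM ?invr_ge0 ?(ltW Ap) ?(ltW Bp)// powRB; last by rewrite (gt_eqF Bp) implybT.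
  rewrite powRr1 ?(ltW Bp)// -powR_inv1 ?(ltW Bp)// -powRrM mulN1r powRN.
  by rewrite mulrCA.
have E2 : (A / B) `^ (alpha - 1) * A = A `^ alpha * B `^ (1 - alpha).
  rewrite -E1 powRB ?(gt_eqF AB0) ?implybT// powRr1 ?(ltW AB0)//.
  by rewrite invf_div -mulrA divfK// mulrC.

rewrite E1 E2 => /le_trans; apply; rewrite le_eqVlt; apply/orP; left; apply/eqP; ring.
Qed.

Section upper_bound_V.
Context {R : realType} {n : nat}.
Local Notation V := 'rV[R]_n.
Local Notation g := (gauss_rV R n).
Variables (f : V -> R) (p q alpha : R).
Hypotheses (p1 : 1 < p) (pq : p^-1 + q^-1 = 1).
Hypotheses (alpha0 : 0 < alpha) (alpha1 : alpha <= 1).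
Hypothesis hf : f \in Lfun g p%:E.

Lemma conjugate_gt1 : 1 < q.
Proof.
have p0 : 0 < p by exact: lt_trans p1.
have h : 0 < q^-1 < 1.
  have -> : q^-1 = 1 - p^-1 by rewrite -pq addrC addKr.
  by rewrite subr_gt0 invf_lt1// p1 gtrBl invr_gt0.
case/andP: h; rewrite invr_gt0 => q0; rewrite invf_lt1//.
Qed.

Lemma Lfun_Lnorm : measurable_fun setT f /\
  ('N[g]_p%:E[EFin \o f] <= (fine 'N[g]_p%:E[EFin \o f])%:E)%E.
Proof.
move: hf; rewrite inE => /andP[]; rewrite !inE /= => mf fin; split => //.
rewrite fineK// ge0_fin_numE ?Lnorm_ge0//.
Qed.

Lemma Lnorm_test_field (r : R) (Phi : V -> V) : 0 < r -> test_field Phi ->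
  exists2 A : R, 0 <= A & Lnorm_field r Phi = A%:E.
Proof.
move=> r0 /test_fieldP[sPhi bPhi].
have [M MP] := choice (fun i =>
  let: ex_intro2 M M0 MP := smooth_bounded (sPhi i) (bounded_support_component i bPhi) in
  ex_intro (fun M : R => forall x, `|component i Phi x| <= M) M MP).
have N0 : (0 <= Lnorm_field r Phi)%E by exact: Lnorm_ge0.
have fin : Lnorm_field r Phi \is a fin_num.
  rewrite ge0_fin_numE//; apply: (@le_lt_trans _ _ (\sum_i M i)%:E); last exact: ltry.
  apply: Lnorm_bounded => //.
    exact: (measurableT_comp measurable_enorm (field_measurable sPhi)).
  move=> x; rewrite ger0_norm ?enorm_ge0//; apply: le_trans (ler_enorm_sum _) _.
  by apply: ler_sum => i _; exact: MP.
by exists (fine (Lnorm_field r Phi)); [exact: fine_ge0|rewrite fineK].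
Qed.

Lemma Lnorm_test_function (r : R) (phi : V -> R) : 0 < r -> smooth phi -> bounded_support phi ->
  exists2 B : R, 0 <= B & 'N[g]_r%:E[EFin \o phi]%E = B%:E.
Proof.
move=> r0 sphi bphi; have [M M0 MP] := smooth_bounded sphi bphi.
have fin : 'N[g]_r%:E[EFin \o phi]%E \is a fin_num.
  rewrite ge0_fin_numE ?Lnorm_ge0//; apply: (@le_lt_trans _ _ M%:E); last exact: ltry.
  exact: (Lnorm_bounded g r0 (smooth_measurable sphi) MP).
by exists (fine 'N[g]_r%:E[EFin \o phi]%E); [exact/fine_ge0/Lnorm_ge0|rewrite fineK].
Qed.

Lemma Ugauss_ge0 : (0 <= Ugauss p alpha f)%E.
Proof.
apply: (@le_trans _ _ ((1 `^ ((1 - alpha) / 2))%:E * Lnorm_gradient p (OU 1 f))%E).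
  rewrite mule_ge0 ?lee_fin ?powR_ge0//; apply/ereal_infP => _ [G _ <-].
  exact: Lnorm_ge0.
by apply: le_ereal_sup_tmp; eexists; [exists 1 => //=|exact: lexx].
Qed.

(** The hypothesis is strict because [Lnorm_gradient] is an infimum: strictly above it there is an
    actual weak gradient G below the bound. *)
Lemma Vgauss_le_fin (U : R) : (Ugauss p alpha f < U%:E)%E ->
  (Vgauss q alpha f <= ((4 * gauss_moment p * alpha^-1 + 1) * U)%:E)%E.
Proof.
move=> hU.
have p0 : 0 < p by exact: lt_trans p1.
have q0 : 0 < q by exact: lt_trans conjugate_gt1.
have U0 : 0 <= U by rewrite -lee_fin (le_trans Ugauss_ge0)// ltW.
have [mf fF] := Lfun_Lnorm.
have c0 : 0 <= 4 * gauss_moment p * alpha^-1.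
  by rewrite !mulr_ge0 ?invr_ge0 ?(ltW alpha0)// ltW// gauss_moment_gt0.
have fU (t : R) : 0 < t -> exists2 G, generalized_gradient (OU t f) G &
  (Lnorm_field p G <= (U * t `^ (- ((1 - alpha) / 2)))%:E)%E.
  move=> t0; have tp : 0 < t `^ ((1 - alpha) / 2) by exact: powR_gt0.
  have h : ((t `^ ((1 - alpha) / 2))%:E * Lnorm_gradient p (OU t f) < U%:E)%E.
    by apply: le_lt_trans hU; apply: le_ereal_sup_tmp; eexists; [exists t|exact: lexx].
  have : (Lnorm_gradient p (OU t f) < (U * t `^ (- ((1 - alpha) / 2)))%:E)%E.
    by rewrite powRN EFinM lte_pdivlMr// muleC.
  by move=> /ereal_inf_lt[_ [G hG <-] /ltW GU]; exists G.
apply: ge_ereal_inf; eexists; last exact: lexx.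
exists ((4 * gauss_moment p * alpha^-1 + 1) * U) => //; split.
  by rewrite mulr_ge0// addr_ge0.
move=> Phi tPhi.
have /test_fieldP[sPhi bPhi] := tPhi.
have sdiv := smooth_div_gauss sPhi; have bdiv := bounded_support_div_gauss bPhi.
have [A A0 PhiA] := Lnorm_test_field q0 tPhi.
have [B B0 PhiB] := Lnorm_test_function q0 sdiv bdiv.
have PhiA' : (Lnorm_field q Phi <= A%:E)%E by rewrite PhiA.
have PhiB' : ('N[g]_q%:E[EFin \o div_gauss Phi] <= B%:E)%E by rewrite PhiB.
have [iI _] := hoelder_Rintegral p0 q0 pq mf (smooth_measurable sdiv) fF PhiB'.
rewrite PhiA PhiB !poweR_EFin -!EFinM.
have -> : (\int[g]_x (f x * div_gauss Phi x)%:E = (\int[g]_x (f x * div_gauss Phi x))%:E)%E.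
  by rewrite /Rintegral fineK//; exact: (integrable_fin_num measurableT iI).
rewrite lee_fin; apply: powR_optimization => // t t0.
apply: le_trans (ler_norm _) _.
exact: (Rintegral_div_gauss_le p0 q0 pq alpha0 U0 mf fF fU tPhi PhiA' PhiB' t0).
Qed.

Lemma Vgauss_le_Ugauss :
  (Vgauss q alpha f <= (4 * gauss_moment p * alpha^-1 + 1)%:E * Ugauss p alpha f)%E.
Proof.
have p0 : 0 < p by exact: lt_trans p1.
set K := 4 * gauss_moment p * alpha^-1 + 1.
have K0 : 0 < K.
  by rewrite ltr_wpDl// !mulr_ge0 ?invr_ge0 ?(ltW alpha0)// ltW// gauss_moment_gt0.
have [Uoo|Ufin] := eqVneq (Ugauss p alpha f) +oo%E.
  by rewrite Uoo gt0_muley ?lte_fin// leey.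
have fin : Ugauss p alpha f \is a fin_num.
  by rewrite ge0_fin_numE ?Ugauss_ge0// ltey.
(* The slack e, divided by K, gives the strict inequality required by [Vgauss_le_fin]. *)
apply/lee_addgt0Pr => e e0.
rewrite -(fineK fin) -EFinM -EFinD.
have -> : K * fine (Ugauss p alpha f) + e = K * (fine (Ugauss p alpha f) + e / K).
  by field; rewrite gt_eqF.
apply: Vgauss_le_fin; rewrite EFinD fineK// lteDl// lte_fin divr_gt0//.
Qed.

End upper_bound_V.

(** * Upper bound on U *)

Section field_lemmas.
Context {R : realType} {n : nat}.
Local Notation V := 'rV[R]_n.
Implicit Types (x y : V) (Phi : V -> V) (a : R).

Lemma enormZ a x : enorm (a *: x) = `|a| * enorm x.
Proof.
rewrite /enorm -sqrtr_sqr -sqrtrM ?sqr_ge0// mulr_sumr; congr Num.sqrt.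
by apply: eq_bigr => i _; rewrite mxE exprMn.
Qed.

Lemma dotrZr a x y : dotr x (a *: y) = a * dotr x y.
Proof.
by rewrite /dotr mulr_sumr; apply: eq_bigr => i _; rewrite mxE mulrCA.
Qed.

Lemma measurable_scale_field a Phi : measurable_fun setT Phi ->
  measurable_fun setT (fun x => a *: Phi x).
Proof.
move=> mPhi; apply: measurable_fun_rVP => i.
have := measurable_funM (measurable_cst a) (measurable_field_component mPhi i).
by congr (measurable_fun _ _); apply/funext => x; rewrite mxE.
Qed.

Lemma Lnorm_field_bounded (r M : R) Phi : 0 < r -> measurable_fun setT Phi ->
  (forall x, enorm (Phi x) <= M) -> (Lnorm_field r Phi <= M%:E)%E.
Proof.
move=> r0 mPhi PhiM; apply: Lnorm_bounded => //.
  exact: (measurableT_comp measurable_enorm mPhi).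
by move=> x; rewrite ger0_norm ?enorm_ge0//; exact: PhiM.
Qed.

End field_lemmas.

Section OU_gradient.
Context {R : realType} {n : nat}.
Local Notation V := 'rV[R]_n.
Local Notation g := (gauss_rV R n).
Local Notation gg := ((gauss_rV R n) \x (gauss_rV R n))%E.
Variables (f : V -> R) (p q F c s : R).
Hypotheses (p0 : 0 < p) (q0 : 0 < q) (pq : p^-1 + q^-1 = 1).
Hypotheses (s0 : s != 0) (cs1 : c ^+ 2 + s ^+ 2 = 1).
Hypotheses (mf : measurable_fun setT f) (fF : ('N[g]_p%:E[EFin \o f] <= F%:E)%E).
Implicit Types (Phi : V -> V) (psi : V -> R).

Definition mehler_gradient (h : V -> R) (x : V) : V :=
  \row_i (c / s * \int[g]_y (h (c *: x + s *: y) * y ord0 i)).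

Let integrable_mix_coor i :
  gg.-integrable setT (EFin \o (fun z : V * V => mix c s f z * z.2 ord0 i)).
Proof.
have mi : measurable_fun setT (fun z : V * V => z.2 ord0 i).
  exact: (measurableT_comp (measurable_coor i) measurable_snd).
have mfs := measurable_mix c s mf.
have hf : ('N[gg]_p%:E[EFin \o mix c s f] <= F%:E)%E by rewrite Lnorm_mix.
pose e (x : V) : V := delta_mx ord0 i.
have me : measurable_fun setT e by exact: measurable_cst.
have e1 : (Lnorm_field q e <= 1%:E)%E.
  apply: Lnorm_bounded => //; first exact: (measurableT_comp measurable_enorm me).
  by move=> x; rewrite /e /= enorm_delta normr1.
have := Lnorm_dotr_field q0 ler01 me e1.
have -> : (fun z : V * V => dotr z.2 (e z.1)) = (fun z => z.2 ord0 i).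
  apply/funext => z; have := @dotr_delta R n z.2 1 i.
  by rewrite scale1r mul1r.
by move=> hi; have [] := hoelder_Rintegral p0 q0 pq mfs mi hf hi.
Qed.

Lemma measurable_mehler_gradient : measurable_fun setT (mehler_gradient f).
Proof.
apply: measurable_fun_rVP => i.
have := measurable_funM (measurable_cst (c / s)) (measurable_Rintegral1 (integrable_mix_coor i)).
by congr (measurable_fun _ _); apply/funext => x; rewrite mxE.
Qed.

Lemma integrable_mehler_gradient i :
  g.-integrable setT (EFin \o component i (mehler_gradient f)).
Proof.
have := integrableZl measurableT (c / s) (integrable_Rintegral1 (integrable_mix_coor i)).
by congr (_.-integrable _ _); apply/funext => x; rewrite /component /= mxE.
Qed.

Lemma integrable_dotr_rot Phi M x : measurable_fun setT Phi -> (forall x, enorm (Phi x) <= M) ->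
  g.-integrable setT (EFin \o (fun y => dotr (s *: x + c *: y) (Phi (c *: x - s *: y)))).
Proof.
move=> mPhi PhiM; apply: integrable_Rsum => i.
have i1 : g.-integrable setT (EFin \o (fun y : V => s * x ord0 i + c * y ord0 i)).
  have := integrableD measurableT (integrable_bounded (M := `|s * x ord0 i|) g
    (measurable_cst (s * x ord0 i)) (fun=> lexx _))
    (integrableZl measurableT c (integrable_coor i)).
  by congr (_.-integrable _ _); apply/funext => y /=.
have PhiiM (y : V) : `|component i Phi (c *: x + (- s) *: y)| <= M.
  exact: le_trans (ler_coor_enorm _ _) (PhiM _).
have := integrable_mul_bounded i1
  (measurable_affine_section c (- s) x (measurable_field_component mPhi i)) PhiiM.
by congr (_.-integrable _ _); apply/funext => y /=; rewrite !mxE scaleNr.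
Qed.

(** This is [mehler_duality] for the kernel <y, (c/s) Phi(x)>: under the inverse rotation x becomes
    cx - sy and y becomes sx + cy. *)
Lemma mehler_gradient_pairing Phi M : measurable_fun setT Phi -> (forall x, enorm (Phi x) <= M) ->
  \int[g]_x dotr (mehler_gradient f x) (Phi x) =
  \int[g]_x (f x * (c / s * \int[g]_y dotr (s *: x + c *: y) (Phi (c *: x - s *: y)))).
Proof.
move=> mPhi PhiM.
have M0 : 0 <= M by rewrite (le_trans _ (PhiM 0))// enorm_ge0.
pose Phi' (x : V) : V := (c / s) *: Phi x.
have mPhi' : measurable_fun setT Phi' := measurable_scale_field (c / s) mPhi.
have Phi'M x : enorm (Phi' x) <= `|c / s| * M by rewrite enormZ ler_wpM2l.
have N0 : 0 <= `|c / s| * M by rewrite mulr_ge0.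
have Phi'B : (Lnorm_field q Phi' <= (`|c / s| * M)%:E)%E := Lnorm_field_bounded q0 mPhi' Phi'M.
pose k (z : V * V) := dotr z.2 (Phi' z.1).
have mk : measurable_fun setT k := measurable_dotr_field mPhi'.
have kB := Lnorm_dotr_field q0 N0 mPhi' Phi'B.
have rotE (x y : V) : k (rot c (- s) (x, y)) = dotr (s *: x + c *: y) (Phi' (c *: x - s *: y)).
  by rewrite /k /rot /= opprK scaleNr.
have ik (x : V) : g.-integrable setT (EFin \o (fun y => k (rot c (- s) (x, y)))).
  have := integrable_dotr_rot x mPhi' Phi'M.
  by congr (_.-integrable _ (EFin \o _)); apply/funext => y; rewrite rotE.
have D := mehler_duality p0 q0 pq s0 cs1 mf mk fF kB ik.
transitivity (\int[g]_x (f x * \int[g]_y k (rot c (- s) (x, y)))); last first.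
  apply: eq_Rintegral => x _; congr (f x * _).
  rewrite -(RintegralZl (c / s) measurableT (integrable_dotr_rot x mPhi PhiM)).
  by apply: eq_Rintegral => y _; rewrite rotE /Phi' dotrZr.
rewrite -D; have iI := integrable_mix_mul p0 q0 pq s0 cs1 mf mk fF kB.
have md : measurable_fun setT (fun x => dotr (mehler_gradient f x) (Phi x)).
  apply: measurable_sum => i; apply: measurable_funM.
    exact: (measurable_field_component measurable_mehler_gradient i).
  exact: (measurable_field_component mPhi i).
rewrite /Rintegral; congr fine; apply: ae_eq_integral => //.
- exact/measurable_EFinP.
- by apply/measurable_EFinP; exact: (measurable_Rintegral1 iI).
(* The inner integral is split into coordinates only at those x where all n sections are integrable,
   which is almost every x. *)
have aei : {ae g, forall x i, g.-integrable setT (fun y => (mix c s f (x, y) * y ord0 i)%:E)}.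
  apply: filter_forall => i; exact: (ae_integrable1 (integrable_mix_coor i)).
apply: filterS aei => x ix _; congr EFin.
have ix' i : g.-integrable setT (EFin \o (fun y : V => f (c *: x + s *: y) * y ord0 i * Phi' x ord0 i)).
  exact: (integrableZr measurableT (Phi' x ord0 i) (ix i)).
transitivity (\sum_i \int[g]_y (f (c *: x + s *: y) * y ord0 i * Phi' x ord0 i)).
  apply: eq_bigr => i _; rewrite mxE.
  rewrite (RintegralZr (Phi' x ord0 i) measurableT (ix i)) /Phi' mxE.
  ring.
rewrite -(Rintegral_sum _ ix'); apply: eq_Rintegral => y _.
by rewrite /k /dotr /= mulr_sumr; apply: eq_bigr => i _; rewrite mulrA.
Qed.

End OU_gradient.

(** Here a, b stand for x_i, y_i and d for the derivative of h in y_i. The relation c^2 = 1 - s^2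
    isolates a multiple of d - b h, of Gaussian mean 0, and leaves the rotated coordinate s a + c
    b. *)
Lemma adjoint_identity {R : realType} (c s a b d h : R) : s != 0 -> c ^+ 2 + s ^+ 2 = 1 ->
  (- s)^-1 * d - (c * a + - s * b) * h =
  - s^-1 * (d - b * h) - c / s * ((s * a + c * b) * h).
Proof.
move=> s0 cs1; have c2 : c ^+ 2 = 1 - s ^+ 2 by rewrite -cs1 addrK.
transitivity (- s^-1 * (d - b * h) - c * a * h - c ^+ 2 / s * b * h).
  by rewrite c2; field.
by field.
Qed.

Section OU_generalized_gradient.
Context {R : realType} {n : nat}.
Local Notation V := 'rV[R]_n.
Local Notation g := (gauss_rV R n).
Variables (f : V -> R) (p q F c s : R).
Hypotheses (p0 : 0 < p) (q0 : 0 < q) (pq : p^-1 + q^-1 = 1).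
Hypotheses (s0 : s != 0) (cs1 : c ^+ 2 + s ^+ 2 = 1).
Hypotheses (mf : measurable_fun setT f) (fF : ('N[g]_p%:E[EFin \o f] <= F%:E)%E).

Lemma mehler_adjoint_by_parts (psi : V -> R) i x : smooth psi -> bounded_support psi ->
  mehler c (- s) (fun x => partial i psi x - x ord0 i * psi x) x =
  - (c / s * \int[g]_y ((s * x ord0 i + c * y ord0 i) * psi (c *: x - s *: y))).
Proof.
move=> spsi bpsi.
pose h (y : V) := psi (c *: x + (- s) *: y).
have ns0 : - s != 0 by rewrite oppr_eq0.
have sh : smooth h := smooth_affine (c *: x) (- s) spsi.
have bh : bounded_support h := bounded_support_affine (c *: x) ns0 bpsi.
have [M _ hM] := smooth_bounded sh bh.
have [M' _ hM'] := smooth_partial_bounded i sh bh.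
have mh := smooth_measurable sh.
have hE (y : V) : psi (c *: x - s *: y) = h y by rewrite /h scaleNr.
have dhE (y : V) : partial i psi (c *: x + (- s) *: y) = (- s)^-1 * partial i h y.
  by rewrite (partial_affine (c *: x) (- s) i y spsi) mulKf.
have i0 : g.-integrable setT (EFin \o h) := integrable_bounded g mh hM.
have i1 : g.-integrable setT (EFin \o (fun y : V => y ord0 i * h y)) :=
  integrable_mul_bounded (integrable_coor i) mh hM.
have i2 : g.-integrable setT (EFin \o partial i h).
  exact: (integrable_bounded g (smooth_measurable (smooth_partial i sh)) hM').
have i3 : g.-integrable setT (EFin \o (fun y : V => partial i h y - y ord0 i * h y)) :=
  integrableB measurableT i2 i1.
have i4 : g.-integrable setT (EFin \o (fun y : V => - s^-1 * (partial i h y - y ord0 i * h y))) :=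
  integrableZl measurableT (- s^-1) i3.
have i5 : g.-integrable setT (EFin \o (fun y : V => (s * x ord0 i + c * y ord0 i) * h y)).
  have := integrableD measurableT (integrableZl measurableT (s * x ord0 i) i0)
    (integrableZl measurableT c i1).
  by congr (_.-integrable _ _); apply/funext => y /=; rewrite -EFinD; congr EFin; ring.
have i6 : g.-integrable setT (EFin \o (fun y : V => c / s * ((s * x ord0 i + c * y ord0 i) * h y))) :=
  integrableZl measurableT (c / s) i5.
transitivity (\int[g]_y (- s^-1 * (partial i h y - y ord0 i * h y) -
    c / s * ((s * x ord0 i + c * y ord0 i) * h y))).
  by apply: eq_Rintegral => y _; rewrite dhE -/(h y) !mxE; exact: adjoint_identity.
rewrite (RintegralB measurableT i4 i6) (RintegralZl _ measurableT i3).
rewrite (RintegralB measurableT i2 i1) (Rintegral_gauss_by_parts i sh bh) subrr mulr0 sub0r.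
rewrite (RintegralZl _ measurableT i5).
apply: (congr1 (fun r => - (c / s * r))); apply: eq_Rintegral => y _.
by rewrite hE.
Qed.

(** Both sides of the defining identity are moved onto f by duality; there they agree pointwise by
    [mehler_adjoint_by_parts], so that f is never differentiated. *)
Lemma generalized_gradient_mehler :
  generalized_gradient (mehler c s f) (mehler_gradient c s f).
Proof.
have i_f := integrable_Lnorm p0 q0 pq mf fF.
apply: gauss_generalized_gradient.
- exact: (integrable_Rintegral1 (integrable_mix s0 cs1 i_f)).
- by move=> i; exact: (integrable_mehler_gradient p0 q0 pq s0 cs1 mf fF).
move=> i psi spsi bpsi.
have [M M0 psiM] := smooth_bounded spsi bpsi.
pose w (x : V) := partial i psi x - x ord0 i * psi x.
have [sw bw] : smooth w /\ bounded_support w.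
  split.
    have := smoothD (smooth_partial i spsi)
      (smoothM (smooth_cst (-1)) (smoothM (smooth_coor i) spsi)).
    congr smooth; apply/funext => x; rewrite /w.
    by change (partial i psi x + -1 * (x ord0 i * psi x) = partial i psi x - x ord0 i * psi x); ring.
  have [N1 H1] := bounded_support_partial i bpsi; have [N2 H2] := bpsi.
  exists (Num.max N1 N2) => x wx; rewrite le_max; apply/orP.
  have [d0|/H1] := eqVneq (partial i psi x) 0; last by left.
  right; apply: H2; apply: contraNneq wx => psi0.
  by rewrite /w d0 psi0 mulr0 subrr.
have [W W0 wW] := smooth_bounded sw bw.
rewrite (mehler_duality_bounded p0 q0 pq s0 cs1 mf (smooth_measurable sw) fF wW).
pose Phi (x : V) : V := psi x *: delta_mx ord0 i.
have PhiM x : enorm (Phi x) <= M by rewrite enormZ enorm_delta mulr1; exact: psiM.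
have mPhi : measurable_fun setT Phi.
  apply: measurable_fun_rVP => j.
  have := measurable_funM (smooth_measurable spsi) (measurable_cst ((delta_mx ord0 i : V) ord0 j)).
  by congr (measurable_fun _ _); apply/funext => x; rewrite /Phi [in RHS]mxE.
have dE x y : dotr x (Phi y) = x ord0 i * psi y by rewrite dotr_delta mulrC.
have P := mehler_gradient_pairing p0 q0 pq s0 cs1 mf fF mPhi PhiM.
have -> : \int[g]_x (mehler_gradient c s f x ord0 i * psi x) =
   \int[g]_x dotr (mehler_gradient c s f x) (Phi x).
  by apply: eq_Rintegral => x _; rewrite dE.
have ns0 : - s != 0 by rewrite oppr_eq0.
have ncs1 : c ^+ 2 + (- s) ^+ 2 = 1 by rewrite sqrrN.
have mw := smooth_measurable sw.
have mQw : measurable_fun setT (mehler c (- s) w).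
  exact: (measurable_mehler ns0 ncs1 (integrable_bounded g mw wW)).
have iQ := integrable_mul_bounded i_f mQw (bounded_mehler c (- s) mw wW).
rewrite P; apply: oppr_inj; rewrite opprK -mulN1r -(RintegralZl (-1) measurableT iQ).
apply: eq_Rintegral => x _; rewrite (mehler_adjoint_by_parts i x spsi bpsi) mulN1r mulrN opprK.
apply: (congr1 (fun r => f x * (c / s * r))); apply: eq_Rintegral => y _.
by rewrite dE !mxE.
Qed.

End OU_generalized_gradient.

(** * Smoothing by the Mehler kernel *)

Section laplace_transform.
Context {R : realType} {n : nat}.
Local Notation V := 'rV[R]_n.
Local Notation g := (gauss_rV R n).
Variable k : R.
Implicit Types (w : V -> R) (x y : V).

Definition laplace w (x : V) : R := \int[g]_y (w y * expR (k * dotr y x)).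

(** No continuity is asked: the functions are components of truncated extremal fields, which are
    only measurable. *)
Definition measurable_bounded_support w : Prop :=
  [/\ measurable_fun setT w, (exists M : R, forall y, `|w y| <= M) & bounded_support w].

Let dominated w (r : R) : measurable_bounded_support w -> 0 <= r ->
  exists2 C : R, 0 <= C & forall x y, `|x| <= r ->
    `|w y * expR (k * dotr y x)| <= C.
Proof.
move=> [mw [M wM] [N wN]] r0.
have M0 : 0 <= M by exact: le_trans (wM 0).
exists (M * expR (`|k| * (n%:R * (`|N| * r)))) => [|x y xr].
  by rewrite mulr_ge0 ?expR_ge0.
have [w0|w0] := eqVneq (w y) 0; first by rewrite w0 mul0r normr0 mulr_ge0 ?expR_ge0.
rewrite normrM ler_pM// ger0_norm ?expR_ge0// ler_expR (le_trans (ler_norm _))//.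
rewrite normrM ler_wpM2l//; apply: le_trans (ler_norm_sum _ _ _) _.
have -> : n%:R * (`|N| * r) = \sum_(i < n) `|N| * r by rewrite sumr_const card_ord mulr_natl.
apply: ler_sum => i _; rewrite normrM ler_pM//.
- by rewrite (le_trans (ler_coor_norm _ _))// (le_trans (wN _ w0))// ler_norm.
- by rewrite (le_trans (ler_coor_norm _ _)).
Qed.

Let measurable_integrand w x : measurable_fun setT w ->
  measurable_fun setT (fun y => w y * expR (k * dotr y x)).
Proof.
move=> mw; apply: measurable_funM => //; apply: measurableT_comp => //.
by apply: measurable_funM => //; exact: measurable_dotr.
Qed.

Lemma integrable_laplace w x : measurable_bounded_support w ->
  g.-integrable setT (EFin \o (fun y => w y * expR (k * dotr y x))).
Proof.
move=> bw; have [C C0 HC] := dominated bw (normr_ge0 x).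
have [mw _ _] := bw.
by apply: (integrable_bounded (M := C) g (measurable_integrand x mw)) => y; exact: HC.
Qed.

Lemma bounded_laplace w (r : R) : measurable_bounded_support w -> 0 <= r ->
  exists C : R, forall x, `|x| <= r -> `|laplace w x| <= C.
Proof.
move=> bw r0; have [C C0 HC] := dominated bw r0; have [mw _ _] := bw.
exists C => x xr; have mi := measurable_integrand x mw.
rewrite -lee_fin (le_trans (le_abs_Rintegral g mi))//.
rewrite -[leRHS](@integral_gauss_cst R n); apply: ge0_le_integral => //.
- by apply: measurableT_comp => //; exact/measurable_EFinP.
- by move=> y _; rewrite lee_fin HC.
Qed.

Lemma measurable_bounded_support_coor w i : measurable_bounded_support w ->
  measurable_bounded_support (fun y => k * y ord0 i * w y).
Proof.
move=> [mw [M wM] [N wN]].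
have mi : measurable_fun setT (fun y : V => y ord0 i) := measurable_coor i.
split.
- by apply: measurable_funM => //; exact: measurable_funM.
- exists (`|k| * `|N| * M) => y.
  have [w0|w0] := eqVneq (w y) 0.
    by rewrite w0 mulr0 normr0 !mulr_ge0// (le_trans _ (wM 0)).
  rewrite !normrM ler_pM// ler_wpM2l// (le_trans (ler_coor_norm _ _))//.
  by rewrite (le_trans (wN _ w0))// ler_norm.
- by exists N => y yw; apply: wN; apply: contraNneq yw => ->; rewrite mulr0.
Qed.

Lemma is_derive_laplace w i x : measurable_bounded_support w ->
  is_derive x (delta_mx ord0 i) (laplace w) (laplace (fun y => k * y ord0 i * w y) x).
Proof.
move=> bw; have bw' := measurable_bounded_support_coor i bw.
apply/is_derive_lineP.
have r0 : 0 <= `|x| + 1 by rewrite addr_ge0.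
have [C C0 HC] := dominated bw' r0.
have e1 : `|delta_mx ord0 i : V| <= 1.
  apply: ler_rV_norm => // j; rewrite mxE eqxx /=.
  by case: (_ == _); rewrite ?normr1 ?normr0.
have d0 (t : R) (y : V) : is_derive t 1
    (fun s : R => w y * expR (k * dotr y (x + s *: delta_mx ord0 i)))
    (k * y ord0 i * w y * expR (k * dotr y (x + t *: delta_mx ord0 i))).
  have E (s : R) : k * dotr y (x + s *: delta_mx ord0 i) = k * dotr y x + k * y ord0 i * s.
    have -> : dotr y (x + s *: delta_mx ord0 i) = dotr y x + dotr y (s *: delta_mx ord0 i).
      by rewrite /dotr -big_split; apply: eq_bigr => j _; rewrite mxE mulrDr.
    by rewrite dotr_delta; ring.
  have -> : (fun s : R => w y * expR (k * dotr y (x + s *: delta_mx ord0 i))) =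
    (fun s => w y * expR (k * dotr y x + k * y ord0 i * s)).
    by apply/funext => s; rewrite E.
  apply: (is_derive_eq (is_deriveZ (w y) (is_derive1_comp (is_derive_expR _)
    (is_derive_affine_real (k * dotr y x) (k * y ord0 i) t)))).
  by rewrite E /GRing.scale /=; ring.
have ig : g.-integrable setT (EFin \o (fun _ : V => C)).
  exact: (integrable_bounded (M := `|C|) g (measurable_cst C)).
have := @is_derive_Rintegral R _ _ g
  (fun (t : R) (y : V) => w y * expR (k * dotr y (x + t *: delta_mx ord0 i))) _ _ 0
  (fun t => integrable_laplace (x + t *: delta_mx ord0 i) bw) d0 ig.
move=> /(_ _)/is_derive_eq; apply.
  move=> t y; rewrite subr0 => t1; apply: HC.
  rewrite (le_trans (ler_normD _ _))// lerD2l normrZ -[leRHS]mulr1 ler_pM// ltW//.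
by rewrite scale0r addr0.
Qed.

(** The partial derivatives are again Laplace transforms, hence bounded on bounded sets; this gives
    continuity without knowing theirs, and avoids a circle. *)
Lemma continuous_laplace w : measurable_bounded_support w -> continuous (laplace w).
Proof.
move=> bw; apply: continuous_partial_locally_bounded => [i y|x].
  exact: (@ex_derive _ _ _ _ _ _ _ (is_derive_laplace i y bw)).
have r0 : 0 <= `|x| + 1 by rewrite addr_ge0.
have [C HC] := choice (fun i => bounded_laplace (measurable_bounded_support_coor i bw) r0).
exists (\sum_i `|C i|) => i y yx.
have [_] := is_derive_laplace i y bw; rewrite /partial => ->.
apply: (@le_trans _ _ (`|C i|)); last by rewrite (bigD1 i)//= lerDl sumr_ge0.
apply: le_trans (ler_norm _); apply: HC.
have -> : y = (y - x) + x by rewrite subrK.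
by rewrite (le_trans (ler_normD _ _))// addrC lerD2l.
Qed.

(** Differentiation in x multiplies w by k y_i, which stays in the class because the support is
    bounded. *)
Lemma smooth_laplace w : measurable_bounded_support w -> smooth (laplace w).
Proof.
move=> bw; apply: (@smooth_class _ _ (fun f => exists2 w, measurable_bounded_support w &
    f = laplace w)); last by exists w.
- by move=> _ [v bv ->]; exact: continuous_laplace.
- move=> _ i [v bv ->]; exists (laplace (fun y => k * y ord0 i * v y)).
    by exists (fun y => k * y ord0 i * v y) => //; exact: measurable_bounded_support_coor.
  by move=> x; exact: is_derive_laplace.
Qed.

End laplace_transform.

Section mehler_smooth.
Context {R : realType} {n : nat}.
Local Notation V := 'rV[R]_n.
Local Notation g := (gauss_rV R n).
Variables (c s : R).
Hypothesis s0 : s != 0.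
Implicit Types (phi : V -> R) (x : V).

Let scaled phi (y : V) : R := phi (s *: y).

Let bounded_scaled phi : measurable_bounded_support phi ->
  measurable_bounded_support (scaled phi).
Proof.
move=> [mphi [M phiM] bphi]; split.
- have := measurable_affine_section 0 s 0 mphi.
  by congr (measurable_fun _ _); apply/funext => y; rewrite /scaled scale0r add0r.
- by exists M => y; exact: phiM.
- have [N phiN] := bphi; exists (`|s|^-1 * N) => y /phiN yN.
  by rewrite ler_pdivlMl ?normr_gt0// -normrZ.
Qed.

(* Cameron-Martin turns translation in [x] into a Gaussian factor times a Laplace transform. *)
Lemma mehlerE phi x : measurable_bounded_support phi ->
  mehler c s phi x = expR (- ((c / s) ^+ 2 / 2) * sumsq x) * laplace (c / s) (scaled phi) x.
Proof.
move=> bphi; have [mphi _ _] := bphi; have bs := bounded_scaled bphi; have [ms _ _] := bs.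
transitivity (\int[g]_y scaled phi (y + (c / s) *: x)).
  apply: eq_Rintegral => y _; rewrite /scaled scalerDr scalerA addrC.
  by rewrite mulrCA mulfV// mulr1.
rewrite (Rintegral_gauss_shift _ ms) /laplace -(RintegralZl _ measurableT (integrable_laplace (c / s) x bs)).
apply: eq_Rintegral => y _; rewrite mulrCA; congr (_ * _).
rewrite /cm_density dotrZr -expRD addrC; congr expR; congr (_ + _).
have -> : sumsq ((c / s) *: x) = (c / s) ^+ 2 * sumsq x.
  by rewrite /sumsq mulr_sumr; apply: eq_bigr => i _; rewrite mxE exprMn.
by ring.
Qed.

Lemma smooth_mehler phi : measurable_bounded_support phi -> smooth (mehler c s phi).
Proof.
move=> bphi; have bs := bounded_scaled bphi.
have := smoothM (smooth_expR_sumsq (- ((c / s) ^+ 2 / 2))) (smooth_laplace (c / s) bs).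
by congr smooth; apply/funext => x; rewrite mehlerE.
Qed.

Lemma partial_mehler phi i x : measurable_bounded_support phi ->
  partial i (mehler c s phi) x = c / s * \int[g]_y (y ord0 i * phi (c *: x + s *: y)).
Proof.
move=> bphi; have bs := bounded_scaled bphi.
have [ms [M sM] bss] := bs.
pose k : R := c / s; pose a : R := - (k ^+ 2 / 2).
have -> : mehler c s phi = (fun x => expR (a * sumsq x)) \* laplace k (scaled phi).
  by apply/funext => z; rewrite mehlerE.
have [_] := is_deriveM (is_derive_expR_sumsq a i x) (is_derive_laplace k i x bs).
rewrite /partial => ->; rewrite /GRing.scale /=.
have mi : measurable_fun setT (fun y : V => y ord0 i) := measurable_coor i.
(* Chosen so that F(y + kx) = k y_i phi(cx + sy): the subtracted term compensates the shift.
   Cameron-Martin then brings back the two Laplace transforms of the product rule. *)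
pose F (y : V) := (k * y ord0 i - k * (k * x ord0 i)) * scaled phi y.
have mF : measurable_fun setT F.
  by apply: measurable_funM => //; apply: measurable_funB => //; exact: measurable_funM.
have E : k * \int[g]_y (y ord0 i * phi (c *: x + s *: y)) = \int[g]_y F (y + k *: x).
  have iy : g.-integrable setT (EFin \o (fun y : V => y ord0 i * phi (c *: x + s *: y))).
    have [mphi [M' phiM] _] := bphi.
    exact: (integrable_mul_bounded (integrable_coor i) (measurable_affine_section c s x mphi)
      (fun y => phiM _)).
  rewrite -(RintegralZl k measurableT iy).
  have skx : s *: (k *: x) = c *: x by rewrite scalerA /k mulrCA mulfV// mulr1.
  apply: eq_Rintegral => y _; rewrite /F /scaled scalerDr skx !mxE.
  by rewrite [s *: y + _]addrC; ring.
rewrite -/k E (Rintegral_gauss_shift _ mF).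
have i0 := integrable_laplace k x bs.
have i1 := integrable_laplace k x (measurable_bounded_support_coor k i bs).
set L1 := laplace k _ x; set L0 := laplace k _ x; set e := expR _.
transitivity (e * (L1 - k * (k * x ord0 i) * L0)).
  by rewrite /a; field.
rewrite /L0 /L1 /laplace -(RintegralZl (k * (k * x ord0 i)) measurableT i0).
have i2 := integrableZl measurableT (k * (k * x ord0 i)) i0.
rewrite -(RintegralB measurableT i1 i2).
rewrite -(RintegralZl e measurableT (integrableB measurableT i1 i2)).
apply: eq_Rintegral => y _; rewrite /F /cm_density dotrZr.
have -> : expR (k * dotr y x - sumsq (k *: x) / 2) = e * expR (k * dotr y x).
  rewrite /e -expRD addrC; congr expR; congr (_ + _).
  have -> : sumsq (k *: x) = k ^+ 2 * sumsq x.
    by rewrite /sumsq mulr_sumr; apply: eq_bigr => j _; rewrite mxE exprMn.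
  by rewrite /a; ring.
ring.
Qed.

End mehler_smooth.

Lemma Lnorm_scale_le {R : realType} d (T : measurableType d)
    (mu : {measure set T -> \bar R}) (u : T -> R) (r a B : R) :
  0 < r -> 0 <= a -> measurable_fun setT u -> ('N[mu]_r%:E[EFin \o u] <= B%:E)%E ->
  ('N[mu]_r%:E[EFin \o (fun x => a * u x)%R] <= (a * B)%:E)%E.
Proof.
move=> r0 a0 mu' uB.
have B0 : 0 <= B by rewrite -lee_fin (le_trans _ uB)// Lnorm_ge0.
apply/Lnorm_leP; rewrite ?mulr_ge0//.
have /(Lnorm_leP _ _ r0 B0) I := uB.
have -> : (\int[mu]_x (`|a * u x| `^ r)%:E = \int[mu]_x ((a `^ r)%:E * (`|u x| `^ r)%:E))%E.
  by apply: eq_integral => x _; rewrite normrM powRM// ger0_norm.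
rewrite ge0_integralZl_EFin ?powR_ge0//; last exact: measurable_abs_powR.
by rewrite powRM// EFinM lee_wpmul2l// lee_fin powR_ge0.
Qed.

Section adjoint_field.
Context {R : realType} {n : nat}.
Local Notation V := 'rV[R]_n.
Local Notation g := (gauss_rV R n).
Local Notation gg := ((gauss_rV R n) \x (gauss_rV R n))%E.
Variables (Phi : V -> V) (M A p q c s : R).
Hypotheses (p0 : 0 < p) (q0 : 0 < q) (pq : p^-1 + q^-1 = 1).
Hypotheses (c0 : 0 < c) (s0 : 0 < s) (cs1 : c ^+ 2 + s ^+ 2 = 1).
Hypotheses (mPhi : measurable_fun setT Phi) (PhiM : forall x, enorm (Phi x) <= M).
Hypothesis bPhi : exists N : R, forall x, Phi x != 0 -> `|x| <= N.
Hypotheses (A0 : 0 <= A) (PhiA : (Lnorm_field q Phi <= A%:E)%E).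

(** The factor c reflects the commutation relation between gradient and semigroup: the gradient of
    T_t f is c times T_t of the gradient of f. *)
Definition adjoint_field (x : V) : V := c *: \row_i mehler c (- s) (component i Phi) x.

Let ns0 : - s != 0. Proof. by rewrite oppr_eq0 gt_eqF. Qed.

Let ncs1 : c ^+ 2 + (- s) ^+ 2 = 1. Proof. by rewrite sqrrN. Qed.

Let qp : q^-1 + p^-1 = 1. Proof. by rewrite addrC. Qed.

Let bcomp i : measurable_bounded_support (component i Phi).
Proof.
split; first exact: measurable_field_component.
- by exists M => y; exact: le_trans (ler_coor_enorm _ _) (PhiM y).
- exact: bounded_support_component.
Qed.

Let Psi_i i : component i adjoint_field =
  (fun=> c) \* mehler c (- s) (component i Phi).
Proof. by apply/funext => x; rewrite /component /adjoint_field !mxE. Qed.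

Lemma smooth_adjoint_field i : smooth (component i adjoint_field).
Proof. by rewrite Psi_i; exact: (smoothM (smooth_cst c) (smooth_mehler c ns0 (bcomp i))). Qed.

Let integrable_shift x i : g.-integrable setT
  (EFin \o (fun y : V => Phi (c *: x + (- s) *: y) ord0 i)).
Proof.
have [mi [N iN] _] := bcomp i.
by apply: (integrable_bounded (M := N) g (measurable_affine_section c (- s) x mi)) => y; exact: iN.
Qed.

Let measurable_shift x : measurable_fun setT (fun y : V => Phi (c *: x + (- s) *: y)).
Proof.
apply: measurable_fun_rVP => i.
exact: (measurable_affine_section c (- s) x (measurable_field_component mPhi i)).
Qed.

Let c1 : c <= 1.
Proof. by rewrite -(@expr_le1 _ 2) ?(ltW c0)// -cs1 lerDl sqr_ge0. Qed.

Let enorm_adjoint_le x :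
  ((enorm (adjoint_field x))%:E <= \int[g]_y (enorm (Phi (c *: x + (- s) *: y)))%:E)%E.
Proof.
apply: le_trans (enorm_Rintegral_le (measurable_shift x) (integrable_shift x)).
by rewrite lee_fin enormZ gtr0_norm// ler_piMl// enorm_ge0.
Qed.

Lemma bounded_adjoint_field x : enorm (adjoint_field x) <= M.
Proof.
rewrite -lee_fin (le_trans (enorm_adjoint_le x))// -[leRHS](@integral_gauss_cst R n).
apply: ge0_le_integral => //.
- by move=> y _; rewrite lee_fin enorm_ge0.
- by apply/measurable_EFinP; exact: (measurableT_comp measurable_enorm (measurable_shift x)).
- by move=> y _; rewrite lee_fin PhiM.
Qed.

Lemma Lnorm_adjoint_field : (Lnorm_field q adjoint_field <= A%:E)%E.
Proof.
have me : measurable_fun setT (enorm \o Phi) := measurableT_comp measurable_enorm mPhi.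
have mA : measurable_fun setT (enorm \o adjoint_field).
  exact: (measurableT_comp measurable_enorm (field_measurable smooth_adjoint_field)).
apply: (Lnorm_section_le q0 p0 qp A0 (measurable_mix c (- s) me) mA).
- move=> x; rewrite ger0_norm ?enorm_ge0//; apply: (le_trans (enorm_adjoint_le x)).
  rewrite le_eqVlt; apply/orP; left; apply/eqP; apply: eq_integral => y _.
  by rewrite /mix /= ger0_norm ?enorm_ge0.
- by rewrite Lnorm_mix.
Qed.

(** The derivative falls on the Gaussian kernel and gives -(c/s) times c y_i, and the drift -x_i
    contributes -(c/s) times s x_i. Together they form the second component of the inverse rotation,
    so the integrand is <y, Phi(x)> after rotation. *)
Lemma div_gauss_adjoint_field x : div_gauss adjoint_field x =
  - (c / s * \int[g]_y dotr (s *: x + c *: y) (Phi (c *: x - s *: y))).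
Proof.
have i1 i : g.-integrable setT (EFin \o (fun y : V => y ord0 i * Phi (c *: x + (- s) *: y) ord0 i)).
  have [mi [N iN] _] := bcomp i.
  exact: (integrable_mul_bounded (integrable_coor i) (measurable_affine_section c (- s) x mi)
    (fun y => iN _)).
have ci i : g.-integrable setT (EFin \o (fun y : V =>
    (s *: x + c *: y) ord0 i * Phi (c *: x - s *: y) ord0 i)).
  have := integrableD measurableT (integrableZl measurableT (s * x ord0 i) (integrable_shift x i))
    (integrableZl measurableT c (i1 i)).
  congr (_.-integrable _ _); apply/funext => y /=; rewrite -EFinD !mxE scaleNr; congr EFin.
  ring.
rewrite /dotr (Rintegral_sum _ ci) mulr_sumr -sumrN; apply: eq_bigr => i _.
have -> : partial i (component i adjoint_field) x =
    c * partial i (mehler c (- s) (component i Phi)) x.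
  rewrite Psi_i; have := is_deriveZ c (is_derive_partial i x (smooth_mehler c ns0 (bcomp i))).
  by case=> _ e; exact: e.
rewrite (partial_mehler c ns0 i x (bcomp i)).
have -> : adjoint_field x ord0 i = c * \int[g]_y Phi (c *: x + (- s) *: y) ord0 i.
  by rewrite /adjoint_field !mxE.
have -> : \int[g]_y ((s *: x + c *: y) ord0 i * Phi (c *: x - s *: y) ord0 i) =
  s * x ord0 i * \int[g]_y Phi (c *: x + (- s) *: y) ord0 i +
  c * \int[g]_y (y ord0 i * Phi (c *: x + (- s) *: y) ord0 i).
  have j1 := integrableZl measurableT (s * x ord0 i) (integrable_shift x i).
  have j2 := integrableZl measurableT c (i1 i).
  rewrite -(RintegralZl (s * x ord0 i) measurableT (integrable_shift x i)).
  rewrite -(RintegralZl c measurableT (i1 i)) -(RintegralD measurableT j1 j2).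
  apply: eq_Rintegral => y _; rewrite !mxE scaleNr; ring.
rewrite /component; set I1 := \int[g]_y _; set I2 := \int[g]_y _.
by field; rewrite gt_eqF.
Qed.

Lemma Lnorm_div_adjoint_field :
  ('N[g]_q%:E[EFin \o div_gauss adjoint_field] <= (c / s * (gauss_moment q * A))%:E)%E.
Proof.
have k0 : 0 <= c / s by rewrite divr_ge0 ?ltW.
have C0 := ltW (gauss_moment_gt0 q0).
pose k (z : V * V) := dotr z.2 (Phi z.1).
have mk : measurable_fun setT k := measurable_dotr_field mPhi.
have mkr : measurable_fun setT (k \o rot c (- s)) := measurableT_comp mk (measurable_rot c (- s)).
have kB : ('N[gg]_q%:E[EFin \o (k \o rot c (- s))] <= (gauss_moment q * A)%:E)%E.
  by rewrite Lnorm_rot//; exact: Lnorm_dotr_field.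
have mdiv := smooth_measurable (smooth_div_gauss smooth_adjoint_field).
have CA0 := mulr_ge0 k0 (mulr_ge0 C0 A0).
apply: (Lnorm_section_le q0 p0 qp CA0 (measurable_funM (measurable_cst (c / s)) mkr) mdiv).
- move=> x; rewrite div_gauss_adjoint_field normrN.
  have mx : measurable_fun setT (fun y : V => dotr (s *: x + c *: y) (Phi (c *: x - s *: y))).
    have := measurableT_comp mkr (measurable_pair1 x).
    congr (measurable_fun _ _); apply/funext => y /=.
    by rewrite /k /rot /= opprK scaleNr.
  rewrite normrM (ger0_norm k0).
  apply: (@le_trans _ _ ((c / s)%:E * \int[g]_y `|(dotr (s *: x + c *: y) (Phi (c *: x - s *: y)))%:E|)%E).
    by rewrite EFinM lee_wpmul2l ?lee_fin//; exact: le_abs_Rintegral.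
  rewrite -ge0_integralZl_EFin//; last first.
    by apply: measurableT_comp => //; exact/measurable_EFinP.
  rewrite le_eqVlt; apply/orP; left; apply/eqP; apply: eq_integral => y _.
  by rewrite /k /rot /= opprK scaleNr normrM (ger0_norm k0) EFinM.
- exact: (Lnorm_scale_le q0 k0 mkr kB).
Qed.

End adjoint_field.

(** * Removing the compact support of the test fields *)

Section cutoff_extension.
Context {R : realType} {n : nat}.
Local Notation V := 'rV[R]_n.
Local Notation g := (gauss_rV R n).
Variables (f : V -> R) (p q F alpha C : R).
Hypotheses (p0 : 0 < p) (q1 : 1 < q) (pq : p^-1 + q^-1 = 1).
Hypotheses (alpha0 : 0 < alpha) (alpha1 : alpha <= 1) (C0 : 0 <= C).
Hypotheses (mf : measurable_fun setT f) (fF : ('N[g]_p%:E[EFin \o f] <= F%:E)%E).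
Hypothesis fC : forall Phi, test_field Phi ->
  (\int[g]_x (f x * div_gauss Phi x)%:E <=
    C%:E * (Lnorm_field q Phi `^ alpha *
            'N[g]_q%:E[EFin \o div_gauss Phi] `^ (1 - alpha)))%E.
Variables (Psi : V -> V) (M A B : R).
Hypotheses (sPsi : forall i, smooth (component i Psi)) (PsiM : forall x, enorm (Psi x) <= M).
Hypotheses (A0 : 0 <= A) (PsiA : (Lnorm_field q Psi <= A%:E)%E).
Hypothesis PsiB : ('N[g]_q%:E[EFin \o div_gauss Psi] <= B%:E)%E.

Let q0 : 0 < q. Proof. exact: lt_trans q1. Qed.

Let chi (k : nat) : V -> R := cutoff k.+1%:R.

Let Phi (k : nat) (x : V) : V := chi k x *: Psi x.

Let err (k : nat) (x : V) : R := \sum_(i < n) partial i (chi k) x * Psi x ord0 i.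

Let eps (k : nat) : R := n%:R * (expR 1 * 4 / k.+1%:R * M).

Let M0 : 0 <= M. Proof. by rewrite (le_trans _ (PsiM 0))// enorm_ge0. Qed.

Let componentE k i : component i (Phi k) = chi k \* component i Psi.
Proof. by apply/funext => x; rewrite /component /Phi mxE. Qed.

Let smooth_Phi k i : smooth (component i (Phi k)).
Proof. by rewrite componentE; exact: (smoothM (smooth_cutoff _) (sPsi i)). Qed.

Let test_field_Phi k : test_field (Phi k).
Proof.
apply/test_fieldP; split; first exact: smooth_Phi.
exists k.+1%:R => x Phix; have chi0 : chi k x != 0.
  by apply: contraNneq Phix => h; rewrite /Phi h scale0r.
have := cutoff_support (ltr0Sn R k) chi0 => sx.
apply: ler_rV_norm => // i; rewrite -(@ler_pXn2r _ 2) ?nnegrE//.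
rewrite real_normK ?num_real// (le_trans _ sx)// /sumsq (bigD1 i)//= lerDl.
by apply: sumr_ge0 => j _; exact: sqr_ge0.
Qed.

Let div_Phi k x : div_gauss (Phi k) x = chi k x * div_gauss Psi x + err k x.
Proof.
rewrite /div_gauss /err mulr_sumr -big_split; apply: eq_bigr => i _.
rewrite componentE.
have -> : partial i (chi k \* component i Psi) x =
    chi k x * partial i (component i Psi) x + Psi x ord0 i * partial i (chi k) x.
  have := is_deriveM (is_derive_partial i x (smooth_cutoff k.+1%:R)) (is_derive_partial i x (sPsi i)).
  by case=> _ e; exact: e.
by rewrite /Phi mxE /=; ring.
Qed.

Let err_le k x : `|err k x| <= eps k.
Proof.
rewrite /eps; have -> : n%:R * (expR 1 * 4 / k.+1%:R * M) =
  \sum_(i < n) (expR 1 * 4 / k.+1%:R * M) by rewrite sumr_const card_ord mulr_natl.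
apply: le_trans (ler_norm_sum _ _ _) _; apply: ler_sum => i _; rewrite normrM ler_pM//.
- exact: partial_cutoff_le.
- exact: le_trans (ler_coor_enorm _ _) (PsiM x).
Qed.

Let eps_cvg : eps k @[k --> \oo] --> (0 : R).
Proof.
have -> : eps = (fun k => n%:R * (expR 1 * 4 * M) * k.+1%:R^-1).
  by apply/funext => k; rewrite /eps; field; rewrite gt_eqF.
rewrite -(mulr0 (n%:R * (expR 1 * 4 * M))); apply: cvgMr.
exact: cvg_harmonic.
Qed.

Let eps_le k : eps k <= eps 0.
Proof.
rewrite /eps ler_wpM2l// ler_wpM2r// ler_wpM2l ?mulr_ge0 ?expR_ge0//.
by rewrite lef_pV2 ?posrE// ler_nat.
Qed.

Let mdiv : measurable_fun setT (div_gauss Psi).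
Proof. exact: (smooth_measurable (smooth_div_gauss sPsi)). Qed.

Let mchi k : measurable_fun setT (chi k).
Proof. exact: (smooth_measurable (smooth_cutoff _)). Qed.

Let merr k : measurable_fun setT (err k).
Proof.
apply: measurable_sum => i; apply: measurable_funM.
  exact: (smooth_measurable (smooth_partial i (smooth_cutoff _))).
exact: (smooth_measurable (sPsi i)).
Qed.

Let chi_abs k x : `|chi k x| <= 1.
Proof. by rewrite ger0_norm ?cutoff_ge0 ?cutoff_le1. Qed.

Let Lnorm_Phi k : (Lnorm_field q (Phi k) <= A%:E)%E.
Proof.
apply: le_trans PsiA; apply: Lnorm_le => //.
- exact: (measurableT_comp measurable_enorm (field_measurable (smooth_Phi k))).
- exact: (measurableT_comp measurable_enorm (field_measurable sPsi)).
- move=> x; rewrite [leRHS]ger0_norm ?enorm_ge0// [leLHS]ger0_norm ?enorm_ge0//=.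
  by rewrite enormZ ler_piMl ?enorm_ge0.
Qed.

Let Lnorm_div_Phi k : ('N[g]_q%:E[EFin \o div_gauss (Phi k)] <= (B + eps k)%:E)%E.
Proof.
have -> : div_gauss (Phi k) = (chi k \* div_gauss Psi) \+ err k.
  by apply/funext => x; rewrite div_Phi.
apply: le_trans (minkowski_EFin _ _ _ (ltW q1)) _ => //; first exact: measurable_funM.
rewrite EFinD leeD//; last exact: (Lnorm_bounded g q0 (merr k) (err_le k)).
apply: le_trans PsiB; apply: Lnorm_le => //; first exact: measurable_funM.
by move=> x; rewrite normrM ler_piMl.
Qed.

(** Cutting off adds to the divergence the error <grad chi_k, Psi>, of order 1/k because Psi is
    bounded. The left side converges by dominated convergence; on the right a fixed B' > B absorbs
    the error for large k, so that no limit is taken inside the power. *)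
Lemma cutoff_extension (B' : R) : B < B' ->
  \int[g]_x (f x * div_gauss Psi x) <= C * (A `^ alpha * B' `^ (1 - alpha)).
Proof.
move=> BB'.
have B0 : 0 <= B by rewrite -lee_fin (le_trans _ PsiB)// Lnorm_ge0.
have [iI _] := hoelder_Rintegral p0 q0 pq mf mdiv fF PsiB.
have i_f := integrable_Lnorm p0 q0 pq mf fF.
rewrite -lee_fin /Rintegral fineK; last exact: (integrable_fin_num measurableT iI).
(* [eps] is nonincreasing, so [eps 0] dominates all cutoff errors at once. *)
pose D (x : V) : R := `|f x * div_gauss Psi x| + `|f x| * eps 0.
have iD : g.-integrable setT (EFin \o D).
  have := integrableD measurableT (integrable_norm iI)
    (integrableZr measurableT (eps 0) (integrable_norm i_f)).
  by congr (_.-integrable _ _); apply/funext => x /=; rewrite -EFinD.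
have cv : (\int[g]_x (f x * div_gauss (Phi k) x)%:E)%E @[k --> \oo] -->
    (\int[g]_x (f x * div_gauss Psi x)%:E)%E.
  apply: (@dominated_cvg _ _ _ g _ measurableT (fun k x => (f x * div_gauss (Phi k) x)%:E)
    (fun x => (f x * div_gauss Psi x)%:E) (EFin \o D)) => //.
  - move=> k; apply/measurable_EFinP; apply: measurable_funM => //.
    exact: (smooth_measurable (smooth_div_gauss (smooth_Phi k))).
  - move=> x _; apply: cvg_EFin; first by near=> k.
    apply: cvgMr.
    have -> : (fun k => div_gauss (Phi k) x) = (fun k => chi k x * div_gauss Psi x + err k x).
      by apply/funext => k; exact: div_Phi.
    rewrite -[X in _ --> X](addr0) -[X in _ --> X + _]mul1r.
    apply: cvgD; first by apply: cvgMl; exact: cvg_cutoff.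
    apply: (@squeeze_cvgr _ _ _ _ (fun k => - eps k) eps).
    + by near=> k; rewrite -ler_norml.
    + by rewrite -oppr0; exact: cvgN.
    + exact: eps_cvg.
  - move=> k x _; rewrite lee_fin div_Phi /D mulrDr (le_trans (ler_normD _ _))// lerD//.
    + by rewrite mulrCA normrM ler_piMl.
    + by rewrite normrM ler_wpM2l// (le_trans (err_le k x)).
rewrite -(cvg_lim _ cv)//; apply: lime_le; first by apply/cvg_ex; eexists; exact: cv.
have BB0 : 0 < B' - B by rewrite subr_gt0.
have ev : \forall k \near \oo, `|eps k| < B' - B.
  by have /cvgr0Pnorm_lt := eps_cvg; exact.
near=> k; apply: (le_trans (fC (test_field_Phi k))).
rewrite EFinM lee_wpmul2l ?lee_fin// EFinM -!poweR_EFin; apply: lee_pmul.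
- exact: poweR_ge0.
- exact: poweR_ge0.
- by apply: lee_poweR; rewrite ?(ltW alpha0)// ?Lnorm_ge0.
- apply: lee_poweR; rewrite ?subr_ge0// ?Lnorm_ge0//.
  apply: (le_trans (Lnorm_div_Phi k)); rewrite lee_fin -lerBrDl.
  rewrite (le_trans (ler_norm _))// ltW//.
  by near: k; exact: ev.
Unshelve. all: by end_near. Qed.

End cutoff_extension.

(** * Duality between L^p and L^q for vector fields *)

Section field_duality.
Context {R : realType} {n : nat}.
Local Notation V := 'rV[R]_n.
Local Notation g := (gauss_rV R n).
Variables (G : V -> V) (p q K : R).
Hypotheses (p1 : 1 < p) (q0 : 0 < q) (pq : p^-1 + q^-1 = 1) (K0 : 0 <= K).
Hypothesis mG : measurable_fun setT G.
Hypothesis hK : forall (Phi : V -> V) (A : R), measurable_fun setT Phi ->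
  (exists M : R, forall x, enorm (Phi x) <= M) ->
  (exists N : R, forall x, Phi x != 0 -> `|x| <= N) ->
  0 < A -> (Lnorm_field q Phi <= A%:E)%E -> \int[g]_x dotr (G x) (Phi x) <= K * A.

Let p0 : 0 < p. Proof. exact: lt_trans p1. Qed.

Let p1q : (p - 1) * q = p.
Proof.
have qn0 : q != 0 by rewrite gt_eqF.
have pn0 : p != 0 by rewrite gt_eqF.
have : (p^-1 + q^-1) * (p * q) = p * q by rewrite pq mul1r.
have -> : (p^-1 + q^-1) * (p * q) = q + p.
  by rewrite mulrDl mulrA mulVf// mul1r [p * q]mulrC mulrA mulVf// mul1r.
by move=> h; rewrite mulrBl mul1r -h addrC addKr.
Qed.

Let e (x : V) : R := enorm (G x).

Let e0 x : 0 <= e x. Proof. exact: enorm_ge0. Qed.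

Let me : measurable_fun setT e := measurableT_comp measurable_enorm mG.

(** Truncation in |G| makes the field bounded, truncation in x makes its support bounded; the sets
    increase to the whole space. *)
Let S (N : nat) : set V := [set x | e x <= N%:R] `&` [set x | enorm x <= N%:R].

Let mS N : measurable (S N).
Proof.
have ms (u : V -> R) : measurable_fun setT u -> measurable [set x | u x <= N%:R].
  move=> mu; have := mu measurableT _ (@measurable_itv R `]-oo, N%:R]).
  by rewrite setTI; congr (measurable _); apply/seteqP; split => x /=; rewrite in_itv.
by apply: measurableI; apply: ms => //; exact: measurable_enorm.
Qed.

Let I (N : nat) (x : V) : R := \1_(S N) x.

Let I01 N x : I N x = 0 \/ I N x = 1 /\ S N x.
Proof.
rewrite /I indicE; have [xS|xS] := boolP (x \in S N); last by left.
by right; split => //; move: xS; rewrite inE.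
Qed.

Let mI N : measurable_fun setT (I N).
Proof. exact: measurable_indic. Qed.

(* The extremal field of Hoelder's inequality, truncated; both sides of
   [enorm_Phi] and [dotr_Phi] vanish where [G] does. *)
Let Phi (N : nat) (x : V) : V := (I N x * e x `^ (p - 2)) *: G x.

Let h (N : nat) (x : V) : R := I N x * e x `^ p.

Let mh N : measurable_fun setT (h N).
Proof.
by apply: measurable_funM => //; exact: (measurableT_comp (measurable_powR p) me).
Qed.

Let mPhi N : measurable_fun setT (Phi N).
Proof.
apply: measurable_fun_rVP => i.
have m1 : measurable_fun setT (fun x => I N x * e x `^ (p - 2)).
  by apply: measurable_funM => //; exact: (measurableT_comp (measurable_powR (p - 2)) me).
have := measurable_funM m1 (measurable_field_component mG i).
by congr (measurable_fun _ _); apply/funext => x; rewrite /Phi mxE.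
Qed.

Let enorm_Phi N x : enorm (Phi N x) = I N x * e x `^ (p - 1).
Proof.
rewrite /Phi enormZ -/(e x) ger0_norm; last first.
  by rewrite mulr_ge0 ?powR_ge0//; case: (I01 N x) => [->|[-> _]].
rewrite -mulrA; congr (_ * _).
have [->|en0] := eqVneq (e x) 0; first by rewrite mulr0 powR0// subr_eq0 gt_eqF.
rewrite -[X in _ * X](powRr1 (e0 x)) -powRD; last by rewrite en0 implybT.
by congr (_ `^ _); ring.
Qed.

Let dotr_Phi N x : dotr (G x) (Phi N x) = h N x.
Proof.
rewrite /Phi dotrZr dotr_self -/(e x) /h -mulrA; congr (_ * _).
have [->|en0] := eqVneq (e x) 0; first by rewrite expr0n mulr0 powR0// gt_eqF.
rewrite -powR_mulrn// -powRD; last by rewrite en0 implybT.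
by congr (_ `^ _); ring.
Qed.

Let bounded_Phi N : exists M : R, forall x, enorm (Phi N x) <= M.
Proof.
exists (N%:R `^ (p - 1)) => x; rewrite enorm_Phi.
case: (I01 N x) => [->|[-> [eN _]]]; first by rewrite mul0r powR_ge0.
by rewrite mul1r; apply: ge0_ler_powR; rewrite ?subr_ge0 ?nnegrE ?(ltW p1).
Qed.

Let support_Phi N : exists N' : R, forall x, Phi N x != 0 -> `|x| <= N'.
Proof.
exists N%:R => x; rewrite /Phi; case: (I01 N x) => [->|[_ [_ xN]] _].
  by rewrite mul0r scale0r eqxx.
by apply: ler_rV_norm => // i; exact: le_trans (ler_coor_enorm _ _) xN.
Qed.

Let h_le N x : `|h N x| <= N%:R `^ p.
Proof.
rewrite /h; case: (I01 N x) => [->|[-> [eN _]]]; first by rewrite mul0r normr0 powR_ge0.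
rewrite mul1r ger0_norm ?powR_ge0//.
by apply: ge0_ler_powR; rewrite ?nnegrE ?(ltW p0).
Qed.

Let h0 N x : 0 <= h N x.
Proof. by rewrite mulr_ge0 ?powR_ge0//; case: (I01 N x) => [->|[-> _]]. Qed.

Let ih N : g.-integrable setT (EFin \o h N) := integrable_bounded g (mh N) (h_le N).

(** Testing on the extremal field gives J <= K J^(1/q). The truncation makes J finite, so J^(1/q)
    can be divided out when J > 0, leaving J^(1/p) <= K. *)
Let h_int N : \int[g]_x h N x <= K `^ p.
Proof.
set J := \int[g]_x h N x.
have J0 : 0 <= J by apply: Rintegral_ge0 => x _.
have [->|Jn0] := eqVneq J 0; first exact: powR_ge0.
have Jp : 0 < J by rewrite lt0r Jn0.
have Jq : 0 < J `^ q^-1 by exact: powR_gt0.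
have PhiJ : (Lnorm_field q (Phi N) <= (J `^ q^-1)%:E)%E.
  apply/Lnorm_leP => //; first exact: ltW.
  rewrite -powRrM mulVf ?gt_eqF// powRr1// /J /Rintegral fineK; last first.
    exact: (integrable_fin_num measurableT (ih N)).
  rewrite le_eqVlt; apply/orP; left; apply/eqP; apply: eq_integral => x _.
  rewrite /= ger0_norm ?enorm_ge0// enorm_Phi /h.
  case: (I01 N x) => [->|[-> _]]; first by rewrite !mul0r powR0// gt_eqF.
  by rewrite !mul1r -powRrM p1q.
have := hK (mPhi N) (bounded_Phi N) (support_Phi N) Jq PhiJ.
have -> : \int[g]_x dotr (G x) (Phi N x) = J.
  by apply: eq_Rintegral => x _; exact: dotr_Phi.
have JE : J = J `^ p^-1 * J `^ q^-1.
  by rewrite -powRD ?Jn0 ?implybT// pq powRr1.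
rewrite {1}JE ler_pM2r// => JK.
have -> : J = (J `^ p^-1) `^ p by rewrite -powRrM mulVf ?gt_eqF// powRr1.
by apply: ge0_ler_powR; rewrite ?nnegrE ?powR_ge0 ?(ltW p0).
Qed.

Lemma Lnorm_field_duality : (Lnorm_field p G <= K%:E)%E.
Proof.
apply/Lnorm_leP => //.
have E x : (`|(enorm \o G) x| `^ p)%:E = (e x `^ p)%:E by rewrite ger0_norm ?enorm_ge0.
under eq_integral do rewrite E.
have cvx x : (EFin \o h N) x @[N --> \oo] --> (e x `^ p)%:E.
  apply: cvg_EFin; first by near=> N.
  apply: cvg_near_cst; near=> N; change (h N x = e x `^ p); rewrite /h /I indicE mem_set ?mul1r//.
  split => /=.
    apply: (le_trans (ltW (truncnS_gt (e x)))); rewrite ler_nat; near: N.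
    exact: nbhs_infty_ge.
  apply: (le_trans (ltW (truncnS_gt (enorm x)))); rewrite ler_nat; near: N.
  exact: nbhs_infty_ge.
have hnd x : {homo (fun N => (EFin \o h N) x) : k m / (k <= m)%N >-> (k <= m)%E}.
  move=> k m km; rewrite lee_fin /h ler_wpM2r ?powR_ge0//.
  case: (I01 k x) => [->|[-> [xe xn]]].
    by case: (I01 m x) => [->|[-> _]].
  rewrite /I indicE mem_set//; split => /=.
    by rewrite (le_trans xe)// ler_nat.
  by rewrite (le_trans xn)// ler_nat.
have mEh N : measurable_fun setT (EFin \o h N) by exact/measurable_EFinP.
have cv := cvg_monotone_convergence (mu := g) measurableT mEh
  (fun N x _ => h0 N x) (fun x _ => @hnd x).
have -> : (\int[g]_x (e x `^ p)%:E = limn (fun N => \int[g]_x (EFin \o h N) x))%E.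
  rewrite (cvg_lim _ cv)//; apply: eq_integral => x _.
  by rewrite (cvg_lim _ (cvx x)).
apply: lime_le; first by apply/cvg_ex; eexists; exact: cv.
near=> N; have := h_int N; rewrite -lee_fin /Rintegral fineK//.
exact: (integrable_fin_num measurableT (ih N)).
Unshelve. all: by end_near. Qed.

End field_duality.

(** Since c^2/s^2 = 1/(e^(2t) - 1) and e^(2t) >= 1 + 2t > 1 + t. Replacing 2t by t costs a constant
    factor and buys strictness. *)
Lemma OU_coef_ratio {R : realType} (t : R) : 0 < t ->
  expR (- t) / Num.sqrt (1 - expR (- (2 * t))) < t `^ (- 2^-1).
Proof.
move=> t0; have [s0 cs1] := OU_coef t0.
move: s0 cs1; set s := Num.sqrt (1 - _); set c := expR (- t) => s0 cs1.
have c0 : 0 < c by exact: expR_gt0.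
have rt : 0 < Num.sqrt t by rewrite sqrtr_gt0.
rewrite powRN powR12_sqrt ?(ltW t0)// ltr_pdivrMr// ltr_pdivlMl//.
rewrite -(@ltr_pXn2r _ 2) ?nnegrE ?mulr_ge0 ?ltW// exprMn sqr_sqrtr ?ltW//.
have -> : s ^+ 2 = 1 - c ^+ 2 by rewrite -cs1 [c ^+ 2 + _]addrC addrK.
have c2 : c ^+ 2 * expR (2 * t) = 1.
  by rewrite expr2 -!expRD -[RHS]expR0; congr expR; ring.
have h : 1 + t < expR (2 * t).
  by apply: lt_le_trans (expR_ge1Dx _); rewrite ltrD2l ltr_pMl// ltr1n.
have c20 : 0 < c ^+ 2 by exact: exprn_gt0.
have := h; rewrite -(ltr_pM2l c20) c2 mulrDr mulr1 => h'.
by rewrite ltrBrDl [t * _]mulrC.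
Qed.

(** * From the inequality defining V to the bound on U *)

Section lower_bound_V.
Context {R : realType} {n : nat}.
Local Notation V := 'rV[R]_n.
Local Notation g := (gauss_rV R n).
Variables (f : V -> R) (p q alpha : R).
Hypotheses (p1 : 1 < p) (pq : p^-1 + q^-1 = 1).
Hypotheses (alpha0 : 0 < alpha) (alpha1 : alpha <= 1).
Hypothesis hf : f \in Lfun g p%:E.

Let p0 : 0 < p. Proof. exact: lt_trans p1. Qed.
Let q1 : 1 < q. Proof. exact: conjugate_gt1 p1 pq. Qed.
Let q0 : 0 < q. Proof. exact: lt_trans q1. Qed.

Section feasible.
Variable C : R.
Hypothesis C0 : 0 <= C.
Hypothesis fC : forall Phi, test_field Phi ->
  (\int[g]_x (f x * div_gauss Phi x)%:E <=
    C%:E * (Lnorm_field q Phi `^ alpha *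
            'N[g]_q%:E[EFin \o div_gauss Phi] `^ (1 - alpha)))%E.

Lemma mehler_gradient_dual_bound (t : R) (Phi : V -> V) (A : R) : 0 < t ->
  measurable_fun setT Phi -> (exists M : R, forall x, enorm (Phi x) <= M) ->
  (exists N : R, forall x, Phi x != 0 -> `|x| <= N) ->
  0 < A -> (Lnorm_field q Phi <= A%:E)%E ->
  \int[g]_x dotr (mehler_gradient (expR (- t)) (Num.sqrt (1 - expR (- (2 * t)))) f x) (Phi x) <=
  C * gauss_moment q `^ (1 - alpha) * t `^ (- ((1 - alpha) / 2)) * A.
Proof.
move=> t0 mPhi [M PhiM] [N PhiN] A0 PhiA.
have [mf fF] := Lfun_Lnorm hf.
have [s0 cs1] := OU_coef t0; have ratio := OU_coef_ratio t0.
move: s0 cs1 ratio; set s := Num.sqrt _; set c := expR _ => s0 cs1 ratio.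
have c0 : 0 < c by exact: expR_gt0.
have sn0 : s != 0 by rewrite gt_eqF.
have Cq0 := gauss_moment_gt0 q0.
(* The divergence of the adjoint field carries a minus sign while the inequality defining V is
   one-sided, so the field is reversed first; its norms do not change. *)
pose Phi' (x : V) : V := -1 *: Phi x.
have mPhi' : measurable_fun setT Phi' := measurable_scale_field (-1) mPhi.
have enormE x : enorm (Phi' x) = enorm (Phi x) by rewrite enormZ normrN1 mul1r.
have Phi'M x : enorm (Phi' x) <= M by rewrite enormE.
have bPhi' : exists N : R, forall x, Phi' x != 0 -> `|x| <= N.
  by exists N => x Phix; apply: PhiN; apply: contraNneq Phix => h; rewrite /Phi' h scaler0.
have Phi'A : (Lnorm_field q Phi' <= A%:E)%E.
  move: PhiA; rewrite /Lnorm_field; have -> : enorm \o Phi' = enorm \o Phi by exact/funext.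
  by [].
rewrite (mehler_gradient_pairing p0 q0 pq sn0 cs1 mf fF mPhi PhiM).
have -> : \int[g]_x (f x * (c / s * \int[g]_y dotr (s *: x + c *: y) (Phi (c *: x - s *: y)))) =
    \int[g]_x (f x * div_gauss (adjoint_field Phi' c s) x).
  apply: eq_Rintegral => x _; rewrite (div_gauss_adjoint_field c s0 mPhi' Phi'M bPhi').
  have -> : \int[g]_y dotr (s *: x + c *: y) (Phi' (c *: x - s *: y)) =
      -1 * \int[g]_y dotr (s *: x + c *: y) (Phi (c *: x - s *: y)).
    rewrite -(RintegralZl (-1) measurableT (integrable_dotr_rot c s x mPhi PhiM)).
    by apply: eq_Rintegral => y _; rewrite dotrZr.
  by rewrite mulN1r [c / s * - _]mulrN opprK.
(* The strict inequality leaves room for the error of [cutoff_extension]. *)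
have BB' : c / s * (gauss_moment q * A) < t `^ (- 2^-1) * (gauss_moment q * A).
  by rewrite ltr_pM2r// mulr_gt0.
apply: le_trans (cutoff_extension p0 q1 pq alpha0 alpha1 C0 mf fF fC
  (smooth_adjoint_field c s0 mPhi' Phi'M bPhi')
  (bounded_adjoint_field c0 cs1 mPhi' Phi'M bPhi')
  (Lnorm_adjoint_field p0 q0 pq c0 s0 cs1 mPhi' Phi'M bPhi' (ltW A0) Phi'A)
  (Lnorm_div_adjoint_field p0 q0 pq c0 s0 cs1 mPhi' Phi'M bPhi' (ltW A0) Phi'A) BB') _.
rewrite le_eqVlt; apply/orP; left; apply/eqP.
rewrite !powRM ?powR_ge0 ?mulr_ge0 ?(ltW Cq0) ?(ltW A0)// -powRrM.
have -> : - 2^-1 * (1 - alpha) = - ((1 - alpha) / 2) by ring.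
have AE : A = A `^ alpha * A `^ (1 - alpha).
  by rewrite -powRD ?(gt_eqF A0) ?implybT// addrC subrK powRr1// ltW.
rewrite [X in _ = _ * X]AE.
ring.
Qed.

Lemma Ugauss_le_feasible :
  (Ugauss p alpha f <= (gauss_moment q `^ (1 - alpha) * C)%:E)%E.
Proof.
apply/ereal_supP => _ [t t0 <-].
have [mf fF] := Lfun_Lnorm hf.
have [s0 cs1] := OU_coef t0.
have sn0 : Num.sqrt (1 - expR (- (2 * t))) != 0 by rewrite gt_eqF.
pose K := C * gauss_moment q `^ (1 - alpha) * t `^ (- ((1 - alpha) / 2)).
have K0 : 0 <= K by rewrite /K !mulr_ge0 ?powR_ge0.
have tp : 0 < t `^ ((1 - alpha) / 2) by exact: powR_gt0.
have -> : gauss_moment q `^ (1 - alpha) * C = t `^ ((1 - alpha) / 2) * K.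
  by rewrite /K powRN; field; rewrite gt_eqF.
rewrite EFinM lee_wpmul2l ?lee_fin ?(ltW tp)//.
apply: ge_ereal_inf; eexists.
  exists (mehler_gradient (expR (- t)) (Num.sqrt (1 - expR (- (2 * t)))) f) => //.
  rewrite OU_mehlerE; exact: (generalized_gradient_mehler p0 q0 pq sn0 cs1 mf fF).
apply: (Lnorm_field_duality p1 q0 pq K0 (measurable_mehler_gradient p0 q0 pq sn0 cs1 mf fF)).
by move=> Phi A mPhi bPhi sPhi A0 PhiA; exact: mehler_gradient_dual_bound.
Qed.

End feasible.

Lemma Ugauss_le_Vgauss :
  (Ugauss p alpha f <= (gauss_moment q `^ (1 - alpha))%:E * Vgauss q alpha f)%E.
Proof.
have k0 : 0 < gauss_moment q `^ (1 - alpha) by rewrite powR_gt0// gauss_moment_gt0.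
rewrite -lee_pdivrMl//; apply/ereal_infP => _ [C [C0 fC] <-].
by rewrite lee_pdivrMl// -EFinM; exact: Ugauss_le_feasible.
Qed.

End lower_bound_V.

Theorem theorem5p8 (R : realType) (n : nat) (p q alpha : R)
    (f : 'rV[R]_n -> R)
    (hn : (0 < n)%N) (hp : 1 < p) (hpq : p^-1 + q^-1 = 1)
    (halpha0 : 0 < alpha) (halpha1 : alpha <= 1)
    (hf : f \in Lfun (gauss_rV R n) p%:E) :
  [/\ (Vgauss q alpha f < +oo <-> Ugauss p alpha f < +oo)%E,
      (Ugauss p alpha f
         <= (gauss_moment q `^ (1 - alpha))%:E * Vgauss q alpha f)%E &
      (Vgauss q alpha f
         <= (4 * gauss_moment p * alpha^-1 + 1)%:E * Ugauss p alpha f)%E].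
Proof.
have UV := Ugauss_le_Vgauss hp hpq halpha0 halpha1 hf.
have VU := Vgauss_le_Ugauss hp hpq halpha0 halpha1 hf.
have p0 : 0 < p by exact: lt_trans hp.
split => //; split => [Voo|Uoo].
  by apply: (le_lt_trans UV); apply: lte_mul_pinfty => //; rewrite lee_fin powR_ge0.
apply: (le_lt_trans VU); apply: lte_mul_pinfty => //; rewrite lee_fin addr_ge0//.
by rewrite !mulr_ge0 ?invr_ge0 ?(ltW halpha0)// ltW// gauss_moment_gt0.
Qed.
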